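(* Let $n\ge1$, $0<p<1$, $\sigma\in J_n^+$, $\Lambda$ a continuous positive function, $\underline\vartheta,\overline\vartheta>0$, and $V\ge0$ continuous with $V(x,t)\ge\underline\vartheta\Lambda(t)|x|^\sigma$ for $|x|\ge1$, $t>0$, and $V(x,t)\le\overline\vartheta\Lambda(t)|x|^\sigma$ for $x\in\mathbb{R}^n$, $t>0$. Let $a\ge\frac{\sigma}{1-p}$ and $0\le u_0\in BC_a$ with $u_0\not\equiv0$. Let $\varepsilon_0>0$ be any constant such that $\int_{\{|x-y|\ge1\}}B(y)|x-y|^{\sigma+d}dy\ge\varepsilon_0|x|^{\sigma+d}$ for all $x$ and all $d\in[0,\frac{\sigma p}{1-p}]$. (1) If $0<p<\varepsilon_0\underline\vartheta/\overline\vartheta$, then the problem $\partial_tu-\Delta\partial_tu=\Delta u+Vu^p$, $u(\cdot,0)=u_0$, has a unique global s-solution $0\le u\in\mathcal{Z}_{\infty,a}$. (2) If moreover $V(x,t)=\Lambda(t)|x|^\sigma$, then for every $0<p<1$ this problem has a unique global s-solution $0\le u\in\mathcal{Z}_{\infty,a}$.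
   Context: $J_n^+=\{0\}\cup[1,\infty)$ if $n=1$, $J_n^+=[0,\infty)$ if $n\ge2$. $B=\mathcal{F}^{-1}((1+|\xi|^2)^{-1})$, $\mathcal{B}\varphi=B*\varphi=(I-\Delta)^{-1}\varphi$. $BC_a$: continuous functions with $|\varphi(x)|\le C|x|^a$ for large $|x|$, norm $\sup_x(R^2+|x|^2)^{-a/2}|\varphi(x)|$; $\mathcal{Z}_{T,a}=C([0,T);BC_a)$. A global s-solution is a function $u$ such that $\mu=e^tu\in\mathcal{Z}_{\infty,a}$ and $\mu(t)=u_0+\int_0^t\mathcal{B}\mu(\tau)d\tau+\int_0^te^{(1-p)\tau}\mathcal{B}[V\mu^p](\tau)d\tau$ for all $x\in\mathbb{R}^n$, $t\ge0$. *)

(* Defs.v *)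
From HB Require Import structures.
From mathcomp Require Import all_boot all_order all_algebra.
From mathcomp Require Import all_classical all_reals all_analysis.
Set Implicit Arguments. Unset Strict Implicit. Unset Printing Implicit Defensive.
Import Order.TTheory GRing.Theory Num.Theory.
Import numFieldNormedType.Exports.
Local Open Scope classical_set_scope.
Local Open Scope ring_scope.

Definition edot (R : realType) (n : nat) (x y : 'rV[R]_n) : R :=
  \sum_(i < n) x ord0 i * y ord0 i.
Definition enorm (R : realType) (n : nat) (x : 'rV[R]_n) : R :=
  Num.sqrt (\sum_(i < n) x ord0 i ^+ 2).

(* Lebesgue integral over R^n, as the iterated (n-fold) Lebesgue integral
   (Fubini/Tonelli: it coincides with the integral for the n-dimensional
   Lebesgue measure on nonnegative or integrable measurable functions). *)
Fixpoint iint (R : realType) (n : nat) : ('rV[R]_n -> \bar R) -> \bar R :=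
  match n with
  | 0 => fun f => f 0
  | m.+1 => fun f =>
      (\int[@lebesgue_measure R]_(x in [set: R])
          iint (fun v : 'rV[R]_m => f (row_mx (x%:M) v)))%E
  end.

Definition Rint (R : realType) (n : nat) (f : 'rV[R]_n -> R) : R :=
  fine (iint (fun x => (f x)%:E)).

Definition int0 (R : realType) (t : R) (g : R -> R) : R :=
  fine (\int[@lebesgue_measure R]_(tau in `[0%R, t]%classic) (g tau)%:E)%E.

(* Measurability of a function on R^n (Borel sigma-algebra, transported
   from the product sigma-algebra on n.-tuple R). *)
Definition rV_measurable (R : realType) (n : nat) (f : 'rV[R]_n -> R) : Prop :=
  measurable_fun [set: n.-tuple (measurableTypeR R)]
    (fun t : n.-tuple R => f (\row_(i < n) tnth t i)).

(* The Bessel kernel B = F^{-1}((1+|xi|^2)^{-1}), characterized as an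
   integrable function whose Fourier transform
   F B (xi) = \int B(x) e^{-i x.xi} dx equals (1+|xi|^2)^{-1}. *)
Definition is_bessel_kernel (R : realType) (n : nat) (B : 'rV[R]_n -> R) : Prop :=
  [/\ rV_measurable B,
      (iint (fun x => (`|B x|)%:E) < +oo)%E,
      forall xi : 'rV[R]_n, Rint (fun x => B x * cos (edot x xi)) = (1 + enorm xi ^+ 2)^-1
    & forall xi : 'rV[R]_n, Rint (fun x => B x * sin (edot x xi)) = 0].

Definition conv (R : realType) (n : nat) (B phi : 'rV[R]_n -> R) (x : 'rV[R]_n) : R :=
  Rint (fun y => B (x - y) * phi y).

Definition inBC (R : realType) (n : nat) (a : R) (phi : 'rV[R]_n -> R) : Prop :=
  continuous phi /\
  exists C R0 : R, forall x, R0 <= enorm x -> `|phi x| <= C * enorm x `^ a.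

(* The weighted distance in BC_a (with R = 1; all R > 0 give equivalent norms). *)
Definition BCdist_le (R : realType) (n : nat) (a : R) (phi psi : 'rV[R]_n -> R) (e : R) : Prop :=
  forall x, (1 + enorm x ^+ 2) `^ (- a / 2) * `|phi x - psi x| <= e.

Definition inZ (R : realType) (n : nat) (a : R) (w : R -> 'rV[R]_n -> R) : Prop :=
  (forall t, 0 <= t -> inBC a (w t)) /\
  (forall t, 0 <= t -> forall e, 0 < e -> exists2 d, 0 < d &
     forall s, 0 <= s -> `|s - t| < d -> BCdist_le a (w s) (w t) e).

Definition s_solution (R : realType) (n : nat) (B : 'rV[R]_n -> R)
  (V : 'rV[R]_n -> R -> R) (p a : R) (u0 : 'rV[R]_n -> R)
  (u : 'rV[R]_n -> R -> R) : Prop :=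
  let mu := fun t x => expR t * u x t in
  inZ a mu /\
  forall x t, 0 <= t ->
    mu t x = u0 x + int0 t (fun tau => conv B (mu tau) x)
             + int0 t (fun tau => expR ((1 - p) * tau) *
                                  conv B (fun y => V y tau * mu tau y `^ p) x).

Definition in_Jn (R : realType) (n : nat) (s : R) : Prop :=
  if n == 1%N then s = 0 \/ 1 <= s else 0 <= s.

Definition nonneg_sol (R : realType) (n : nat) (u : 'rV[R]_n -> R -> R) : Prop :=
  forall x t, 0 <= t -> 0 <= u x t.

(* Main.v *)
Require Import Defs.
From HB Require Import structures.
From mathcomp Require Import all_boot all_order all_algebra.
From mathcomp Require Import all_classical all_reals all_analysis.
From mathcomp Require Import measurable_realfun ring lra.
Import Order.TTheory GRing.Theory Num.Theory.
Import numFieldNormedType.Exports.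
Local Open Scope classical_set_scope.
Local Open Scope ring_scope.
Set Implicit Arguments. Unset Strict Implicit. Unset Printing Implicit Defensive.

(** Fourier uniqueness identifies the Bessel kernel with the Gaussian mixture
[int_0^oo e^(-s) g_s ds]; hence [B] is a probability density with a Gaussian lower bound and
exponential moments.  For [mu = e^t u] the problem is the fixed point equation
[mu = Psi mu := u0 + int_0^t B * (mu + e^((1-p)s) V mu^p) ds], whose nonlinearity is not Lipschitz
at [0], so everything rests on sharp lower bounds.

Put [L t = int_0^t e^((1-p)s) Lambda s ds], [kap = 1/(1-p)] and [b = sigma kap].  As [u0] is not
identically zero, a solution lies above a Gaussian-damped multiple of [L^kap |x|^b]; applying [Psi]
repeatedly removes the damping.  Since [B * |.|^b ~ |x|^b] at infinity, finitely many further
applications give [mu >= c L^kap |x|^b] for [|x|] large, with [c^(1-p)] as close to [(1-p) thl] as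
desired.  On such functions [p V mu^(p-1)] is bounded by [k L'/L + C], with [k] close to
[kap p thu / thl], which is smaller than [kap] when [p thu < thl].  Differences of iterates are
[O(L^al)] with [al] close to [kap], because [|x^p - y^p| <= |x - y|^p], and [Psi] contracts the norm
[sup |.| / (L^al e^(K t) w)], where [w = (r + |x|)^a] and [r] is so large that [B * w <= (1 + d) w].

Finally [eps0 <= 1]: take [d = 0] and let [|x|] tend to infinity in its defining inequality.  So
[p < eps0 thl / thu] implies [p thu < thl]; in the second part [thl = thu = 1]. *)

(** * Lebesgue measure on Euclidean space *)

(** The only lower bound available for every [u0] vanishes at time 0, so the Lipschitz constant of
    the nonlinearity is of size k L'/L, which is not integrable: shortening the time interval never
    makes [Psi] a contraction. Against the weight L^al, however, k L'/L integrates exactly to the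
    factor k / al. Two iterations optimise this number. The constant of the lower bound follows c
    |-> (1 - p) thl c^p, whose attracting fixed point makes k as small as possible; the order of
    vanishing of differences follows al |-> 1 + p al, attracted by kap. In the limit k / al is p thu
    / thl, so the hypothesis is used up entirely and no constant may be lost: averaging |x|^b,
    averaging the weight, and stopping each iteration after finitely many steps must each cost a
    factor arbitrarily close to 1. The bounded rest of the Lipschitz constant depends on the time
    horizon; exp (K t) absorbs it, so that the contraction ratio is the same for every horizon. *)

(* R^n is modelled by the nested product R * (R * ... * unit): its product measure unfolds like the
   recursion defining [iint], and [emb] maps it onto row vectors. *)
Record mspace (R : realType) := MSpace {
  mdisp : measure_display ;
  mtype :> measurableType mdisp ;
  mmeas : {sigma_finite_measure set mtype -> \bar R} }.

(** An alias of the product measure, to which sigma-finiteness is attached as an instance, so that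
    the product can be iterated. *)
Definition sigma_finite_prod d1 d2 (T1 : measurableType d1) (T2 : measurableType d2)
  (R : realType) (m1 : {sigma_finite_measure set T1 -> \bar R})
  (m2 : {sigma_finite_measure set T2 -> \bar R}) : set (T1 * T2) -> \bar R :=
  (m1 \x m2)%E.

Section sigma_finite_prod.
Context d1 d2 (T1 : measurableType d1) (T2 : measurableType d2) (R : realType).
Context (m1 : {sigma_finite_measure set T1 -> \bar R})
  (m2 : {sigma_finite_measure set T2 -> \bar R}).

HB.instance Definition _ := Measure.copy (sigma_finite_prod m1 m2) (m1 \x m2)%E.

Let sigma_finite_prodP : sigma_finite setT (sigma_finite_prod m1 m2).
Proof.
have /sigma_finiteP[F [TF ndF Foo]] := sigma_finiteT m1.
have /sigma_finiteP[G [TG ndG Goo]] := sigma_finiteT m2.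
(* The exhaustions are monotone, so the diagonal rectangles already cover the product. *)
exists (fun n => F n `*` G n) => [|k].
  rewrite -setXTT TF TG; apply/seteqP; split => -[x y].
    move=> [[i _ Fi] [j _ Gj]]; exists (maxn i j) => //; split => /=.
      by move/subsetPset: (ndF _ _ (leq_maxl i j)); exact.
    by move/subsetPset: (ndG _ _ (leq_maxr i j)); exact.
  by move=> [i _ [Fi Gi]]; split; exists i.
have [mF Fk] := Foo k; have [mG Gk] := Goo k.
split; first exact: measurableX.
by rewrite /sigma_finite_prod product_measure1E// lte_mul_pinfty// ge0_fin_numE.
Qed.

HB.instance Definition _ := Measure_isSigmaFinite.Build _ _ _
  (sigma_finite_prod m1 m2) sigma_finite_prodP.

End sigma_finite_prod.

Definition prod_mspace (R : realType) (S T : mspace R) : mspace R :=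
  @MSpace R _ (S * T)%type (sigma_finite_prod (mmeas S) (mmeas T)).

Definition line_mspace (R : realType) : mspace R :=
  @MSpace R _ (measurableTypeR R) (@lebesgue_measure R).

Fixpoint Rsp (R : realType) (n : nat) : mspace R :=
  match n with
  | 0 => @MSpace R _ unit [the {sigma_finite_measure set unit -> \bar R} of \d_tt]
  | m.+1 => prod_mspace (line_mspace R) (Rsp R m)
  end.

Notation lam R n := (mmeas (Rsp R n)).

Fixpoint emb (R : realType) (n : nat) : Rsp R n -> 'rV[R]_n :=
  match n with
  | 0 => fun _ => 0
  | m.+1 => fun z => row_mx (z.1%:M) (emb z.2)
  end.

Section iint_Rsp.
Context {R : realType}.

Lemma measurable_emb n (i : 'I_n) :
  measurable_fun setT (fun v : Rsp R n => emb v ord0 i).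
Proof.
elim: n i => [[]//|n IH] i /=.
case: (@split_ordP 1 n i) => j ->.
- rewrite (_ : (fun v => _) = fst); first exact: measurable_fst.
  apply/funext => v; apply: etrans (row_mxEl _ _ _ _) _.
  by rewrite mxE [j]ord1 eqxx mulr1n.
- rewrite (_ : (fun v => _) = (fun v : Rsp R n => emb v ord0 j) \o snd).
    by apply: measurableT_comp (IH j) _; exact: measurable_snd.
  by apply/funext => v; exact: row_mxEr.
Qed.

Lemma rV_measurable_comp d (T : measurableType d) n (f : 'rV[R]_n -> R) (h : T -> 'rV[R]_n) :
  rV_measurable f -> (forall i, measurable_fun setT (fun x => h x ord0 i)) ->
  measurable_fun setT (f \o h).
Proof.
move=> mf mh.
pose t x := [tuple h x ord0 i | i < n] : n.-tuple (measurableTypeR R).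
have mt : measurable_fun setT t.
  apply/measurable_fun_tnthP => i; rewrite (_ : _ \o _ = (fun x => h x ord0 i))//.
    exact: mh.
  by apply/funext => x /=; rewrite tnth_mktuple.
rewrite (_ : f \o h = (fun s : n.-tuple R => f (\row_(i < n) tnth s i)) \o t).
  exact: measurableT_comp.
apply/funext => x /=; congr f; apply/rowP => i.
by rewrite mxE tnth_mktuple.
Qed.

Lemma rV_measurable_emb n (f : 'rV[R]_n -> R) :
  rV_measurable f -> measurable_fun setT (fun v : Rsp R n => f (emb v)).
Proof. by move=> mf; exact: rV_measurable_comp mf (@measurable_emb n). Qed.

(** Tonelli on the positive and negative parts; their difference is measurable in the extended reals
    without any integrability. *)
Lemma measurable_integral d (Y : measurableType d) d' (T : measurableType d')
    (m : {sigma_finite_measure set T -> \bar R}) (f : Y * T -> \bar R) :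
  measurable_fun setT f -> measurable_fun setT (fun y => \int[m]_x f (y, x))%E.
Proof.
move=> mf.
rewrite (_ : (fun y => _) = (fun y => \int[m]_x (f^\+ (y, x)) - \int[m]_x (f^\- (y, x)))%E).
  apply: emeasurable_funB.
    by apply: (@measurable_fun_fubini_tonelli_F _ _ _ _ R m f^\+%E);
      [exact: measurable_funepos|move=> x; exact: funepos_ge0].
  by apply: (@measurable_fun_fubini_tonelli_F _ _ _ _ R m f^\-%E);
      [exact: measurable_funeneg|move=> x; exact: funeneg_ge0].
apply/funext => y; rewrite integralE.
by congr (_ - _)%E; apply: eq_integral => x _; rewrite ?funeposE ?funenegE.
Qed.

(** The induction generalises over the parameter space, which absorbs one integration variable at
    each step: [Y] becomes [Y] times the line. *)
Lemma measurable_iint_param n d (Y : measurableType d) (f : Y -> 'rV[R]_n -> \bar R) :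
  measurable_fun setT (fun z : Y * Rsp R n => f z.1 (emb z.2)) ->
  measurable_fun setT (fun y => iint (f y)).
Proof.
elim: n d Y f => [|n IH] d Y f mf /=.
  rewrite (_ : (fun y => _) = (fun z : Y * Rsp R 0 => f z.1 (emb z.2)) \o (fun y => (y, tt)))//.
  by apply: measurableT_comp => //; exact: measurable_fun_pair.
apply: (@measurable_integral _ Y _ _ (@lebesgue_measure R)
  (fun z => iint (fun v => f z.1 (row_mx (z.2)%:M v)))).
apply: (IH _ (Y * measurableTypeR R)%type (fun z v => f z.1 (row_mx (z.2)%:M v))).
rewrite (_ : (fun z => _) = (fun z : Y * Rsp R n.+1 => f z.1 (emb z.2)) \o
  (fun z : (Y * measurableTypeR R) * Rsp R n => (z.1.1, (z.1.2, z.2))))//.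
apply: measurableT_comp => //.
apply: measurable_fun_pair => /=; first by apply: measurableT_comp => //.
apply: measurable_fun_pair => //=; by apply: measurableT_comp => //.
Qed.

Lemma iint_ge0 n (f : 'rV[R]_n -> \bar R) : (forall x, 0 <= f x)%E -> (0 <= iint f)%E.
Proof.
elim: n f => [|n IH] f f0 //=.
by apply: integral_ge0 => x _; exact: IH.
Qed.

Lemma measurable_emb_slice n (f : 'rV[R]_n.+1 -> \bar R) (x : R) :
  measurable_fun setT (fun v : Rsp R n.+1 => f (emb v)) ->
  measurable_fun setT (fun v : Rsp R n => f (row_mx x%:M (emb v))).
Proof.
move=> mf; rewrite (_ : (fun v => _) = (fun v : Rsp R n.+1 => f (emb v)) \o (fun v => (x, v)))//.
by apply: measurableT_comp => //; exact: measurable_fun_pair.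
Qed.

Lemma ge0_iintE n (f : 'rV[R]_n -> \bar R) : (forall x, 0 <= f x)%E ->
  measurable_fun setT (fun v : Rsp R n => f (emb v)) ->
  (iint f = \int[lam R n]_v f (emb v))%E.
Proof.
elim: n f => [|n IH] f f0 mf.
  by rewrite /= integral_dirac// diracT mul1e.
rewrite [LHS]/=; under eq_integral => x _.
  rewrite IH//; last exact: measurable_emb_slice.
  over.
rewrite [lam _ _]/=.
by rewrite (@fubini_tonelli1 _ _ _ _ _ _ _ _ mf).
Qed.

(** Slices of an integrable function are integrable only for almost every first coordinate. The
    induction hypothesis therefore identifies the inner integrals almost everywhere, and
    measurability of the iterated integral has to come separately. *)
Lemma iintE n (f : 'rV[R]_n -> \bar R) :
  (lam R n).-integrable setT (fun v : Rsp R n => f (emb v)) ->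
  (iint f = \int[lam R n]_v f (emb v))%E.
Proof.
elim: n f => [|n IH] f fi.
  by rewrite /= integral_dirac// ?diracT ?mul1e//.
have mf := measurable_int _ fi.
rewrite [LHS]/= -[RHS](integral12_prod_meas1 fi).
apply: ae_eq_integral => //.
- exact: (@measurable_iint_param n _ (measurableTypeR R) (fun x v => f (row_mx x%:M v)) mf).
- exact: measurable_fubini_F fi.
- apply: filterS (ae_integrable1 fi) => x fx _.
  by rewrite IH.
Qed.

Lemma RintE n (f : 'rV[R]_n -> R) :
  (lam R n).-integrable setT (fun v : Rsp R n => (f (emb v))%:E) ->
  Defs.Rint f = \int[lam R n]_v f (emb v).
Proof. by move=> fi; rewrite /Defs.Rint iintE. Qed.

Lemma cvg_row (T : Type) (F : set_system T) {FF : Filter F} n (u : T -> 'rV[R]_n) (v : 'rV[R]_n) :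
  (forall i, u x ord0 i @[x --> F] --> v ord0 i) -> u x @[x --> F] --> v.
Proof.
move=> uv A [P Pv PA]; rewrite /nbhs /=.
have : F (fun x => forall i, P ord0 i (u x ord0 i)).
  by apply: filter_forall => i; exact: uv (Pv ord0 i).
by apply: filterS => x Px; apply: PA => i j; rewrite [i]ord1.
Qed.

(** [f] is the pointwise limit of its values on the grid of mesh 1/(k+1). Each approximation takes
    countably many values, each on a half-open box, so open sets of matrices never have to be
    compared with the product sigma-algebra. *)
Lemma continuous_rV_measurable n (f : 'rV[R]_n -> R) : continuous f -> rV_measurable f.
Proof.
move=> cf; pose T : measurableType _ := n.-tuple (measurableTypeR R).
pose q k (x : R) : int := Num.floor (x * k.+1%:R).
pose g k (z : 'rV[int]_n) : 'rV[R]_n := \row_i ((z ord0 i)%:~R / k.+1%:R).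
pose h k (t : T) := f (g k (\row_i q k (tnth t i))).
apply: (@measurable_fun_cvg _ _ _ setT h) => [k|t _].
- move=> _ Y mY; rewrite setTI.
  have -> : h k @^-1` Y = \bigcup_(z : 'rV[int]_n) ((\bigcap_(i in [set: 'I_n])
      [set t : T | q k (tnth t i) = z ord0 i]) `&` [set t : T | Y (f (g k z))]).
    apply/seteqP; split => [t /= Yt|t [z _ [tz Yz]]].
      by exists (\row_i q k (tnth t i)) => //; split => //= i _; rewrite mxE.
    rewrite /= /h (_ : \row_i _ = z)//; apply/rowP => i.
    by rewrite mxE; exact: tz i I.
  apply: countable_bigcupT_measurable => [|z]; first exact: countableP.
  have [Yz|nYz] := pselect (Y (f (g k z))); last first.
    rewrite (_ : _ `&` _ = set0)//; apply/seteqP; split => // t [_]; exact: nYz.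
  rewrite (_ : [set t | Y (f (g k z))] = setT) ?setIT; last by apply/seteqP; split.
  apply: fin_bigcap_measurable => [|i _]; first exact: finite_finset.
  rewrite (_ : [set t | _] = (fun t : T => tnth t i) @^-1`
      `[(z ord0 i)%:~R / k.+1%:R, (z ord0 i + 1)%:~R / k.+1%:R[).
    rewrite -[X in measurable X]setTI; apply: measurable_tnth => //.
  apply/seteqP; split => t /=; rewrite in_itv /= ler_pdivrMr// ltr_pdivlMr//.
    by move=> <-; rewrite /q floor_itv.
  by rewrite -floor_eq => /eqP.
- apply: continuous_cvg; first exact: cf.
  apply: cvg_row => i; apply/cvgrPdist_lt => e e0.
  near=> k; rewrite !mxE.
  have k0 : (0 : R) < k.+1%:R by [].
  rewrite ger0_norm; last by rewrite subr_ge0 ler_pdivrMr// floor_le.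
  rewrite ltrBlDr -ltrBlDl ltr_pdivlMr// mulrBl ltrBlDr.
  apply: lt_trans (_ : (q k (tnth t i))%:~R + 1 < _).
    by have /andP[_] := floor_itv (tnth t i * k.+1%:R); rewrite intrD.
  rewrite ltrD2l -ltr_pdivrMl// mulr1; near: k.
  exists (Num.truncn e^-1) => // k /= ek.
  by rewrite (lt_le_trans (truncnS_gt _))// ler_nat ltnS.
Unshelve. all: by end_near. Qed.

(** By uniqueness of Lebesgue measure half-open intervals suffice; reflection moves the open end to
    the other side and keeps the length. *)
Lemma lebesgue_measure_sub (c : R) (A : set R) : measurable A ->
  pushforward (@lebesgue_measure R) ((fun x => c - x) : _ -> measurableTypeR R) A
  = lebesgue_measure A.
Proof.
have mc : measurable_fun setT ((fun x => c - x) : R -> measurableTypeR R).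
  by apply: measurable_funB.
move=> mA; apply/esym.
have := @lebesgue_measure_unique R
  (pushforward (@lebesgue_measure R) ((fun x => c - x) : _ -> measurableTypeR R)).
apply => //= _ [[a b]] _ <-.
rewrite /pushforward (_ : _ @^-1` _ = `[c - b, c - a[%classic).
  rewrite !lebesgue_measure_itv/= !lte_fin ltrD2l ltrN2.
  by case: ifP => // _; rewrite -!EFinD; congr _%:E; rewrite opprB [RHS]addrC subrKA.
apply/seteqP; split => x /=; rewrite !in_itv/= => /andP[];
  rewrite ?ltrBrDl ?lerBlDl ?ltrBlDl ?lerBrDl => h1 h2;
  by apply/andP; split=> //; rewrite addrC.
Qed.

Lemma ge0_integral_line_sub (c : R) (f : R -> \bar R) : measurable_fun setT f ->
  (forall x, 0 <= f x)%E ->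
  (\int[@lebesgue_measure R]_x f (c - x)%R = \int[@lebesgue_measure R]_x f x)%E.
Proof.
move=> mf f0.
have mc : measurable_fun setT ((fun x => c - x) : measurableTypeR R -> measurableTypeR R).
  by apply: measurable_funB.
transitivity (\int[pushforward (@lebesgue_measure R)
    ((fun x => (c - x)%R) : _ -> measurableTypeR R)]_x f x)%E.
  by rewrite (ge0_integral_pushforward mc)// preimage_setT.
by apply: eq_measure_integral => //= A mA _; exact: lebesgue_measure_sub.
Qed.

Lemma row_mx_scalarE n (x : 'rV[R]_(1 + n)) : x = row_mx (x ord0 ord0)%:M (rsubmx x).
Proof.
rewrite -[LHS]hsubmxK; congr row_mx; apply/rowP => i.
by rewrite !mxE [i]ord1 mulr1n; congr (x _ _); apply/val_inj.
Qed.

Lemma sub_row_mx_scalar n (c : 'rV[R]_(1 + n)) (x : R) (v : 'rV[R]_n) :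
  c - row_mx x%:M v = row_mx (c ord0 ord0 - x)%:M (rsubmx c - v).
Proof. by rewrite {1}[c]row_mx_scalarE opp_row_mx add_row_mx -raddfB. Qed.

Lemma ge0_iint_sub n (c : 'rV[R]_n) (f : 'rV[R]_n -> \bar R) : (forall x, 0 <= f x)%E ->
  measurable_fun setT (fun v : Rsp R n => f (emb v)) ->
  iint (fun y => f (c - y)) = iint f.
Proof.
elim: n c f => [|n IH] c f f0 mf /=; first by congr f; apply/rowP => -[].
under eq_integral => x _.
  under [X in iint X]funext => v do rewrite (@sub_row_mx_scalar n c x v).
  rewrite (IH _ (fun v => f (row_mx (c ord0 ord0 - x)%:M v)))//; last exact: measurable_emb_slice.
  over.
apply: (@ge0_integral_line_sub _ (fun x => iint (fun v => f (row_mx x%:M v)))) => [|x].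
  exact: (@measurable_iint_param n _ (measurableTypeR R) (fun x v => f (row_mx x%:M v)) mf).
by apply: iint_ge0.
Qed.

End iint_Rsp.

(** * Uniqueness of Fourier transforms *)

Section integral_tools.
Context d (T : measurableType d) (R : realType).
Implicit Types (m : {measure set T -> \bar R}) (f h : T -> R).

Lemma measurable_cos d' (T' : measurableType d') (h : T' -> R) : measurable_fun setT h ->
  measurable_fun setT (fun x => cos (h x)).
Proof.
move=> mh; apply: (measurableT_comp (f := @cos R)) => //.
by apply: continuous_measurable_fun; exact: continuous_cos.
Qed.

Lemma measurable_continuous_comp d' (T' : measurableType d') (g : R -> R) (h : T' -> R) :
  continuous g -> measurable_fun setT h -> measurable_fun setT (fun x => g (h x)).
Proof.
by move=> cg mh; apply: (measurableT_comp (f := g)) => //; exact: continuous_measurable_fun.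
Qed.

Lemma integrable_mul_bounded m f h (C : R) : m.-integrable setT (EFin \o f) ->
  measurable_fun setT h -> (forall x, `|h x| <= C) ->
  m.-integrable setT (EFin \o (fun x => f x * h x)).
Proof.
move=> fi mh hC.
have mf : measurable_fun setT f by apply/measurable_EFinP; exact: measurable_int fi.
apply: (@le_integrable _ _ _ _ _ measurableT _ (fun x => C%:E * (f x)%:E)%E).
- by apply/measurable_EFinP; exact: measurable_funM.
- move=> x _ /=; rewrite lee_fin !normrM mulrC ler_wpM2r//.
  by rewrite (le_trans (hC x))// ler_norm.
- exact: integrableZl.
Qed.

Lemma integrable_norm_le m f h : m.-integrable setT (EFin \o h) ->
  measurable_fun setT f -> (forall x, `|f x| <= h x) -> m.-integrable setT (EFin \o f).
Proof.
move=> hi mf fh; apply: (@le_integrable _ _ _ _ _ measurableT _ (EFin \o h)) => //.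
  exact/measurable_EFinP.
by move=> x _ /=; rewrite lee_fin (le_trans (fh x))// ler_norm.
Qed.

Lemma integrable_addr m f h : m.-integrable setT (EFin \o f) -> m.-integrable setT (EFin \o h) ->
  m.-integrable setT (EFin \o (fun x => f x + h x)).
Proof. exact: (integrableD measurableT). Qed.

Lemma integrable_subr m f h : m.-integrable setT (EFin \o f) -> m.-integrable setT (EFin \o h) ->
  m.-integrable setT (EFin \o (fun x => f x - h x)).
Proof. exact: (integrableB measurableT). Qed.

Lemma integrable_mulr m (c : R) f : m.-integrable setT (EFin \o f) ->
  m.-integrable setT (EFin \o (fun x => c * f x)).
Proof. exact: (integrableZl measurableT). Qed.

Lemma integrableE m f : m.-integrable setT (EFin \o f) ->
  (\int[m]_x (f x)%:E = (\int[m]_x f x)%:E)%E.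
Proof. by move=> fi; rewrite /Rintegral fineK// integrable_fin_num. Qed.

Lemma integrable_measurable m f : m.-integrable setT (EFin \o f) -> measurable_fun setT f.
Proof. by move=> fi; apply/measurable_EFinP; exact: measurable_int fi. Qed.

Lemma Rintegral_dct m (f_ : nat -> T -> R) f h : m.-integrable setT (EFin \o h) ->
  (forall k, measurable_fun setT (f_ k)) -> (forall k x, `|f_ k x| <= h x) ->
  (forall x, f_ k x @[k --> \oo] --> f x) ->
  \int[m]_x f_ k x @[k --> \oo] --> \int[m]_x f x.
Proof.
move=> hi mf fh ff.
have mff : measurable_fun setT f by apply: measurable_fun_cvg => // x _; exact: ff.
have fhx x : `|f x| <= h x.
  have cn : `|f_ k x| @[k --> \oo] --> `|f x| by exact: cvg_norm.
  have <- := cvg_lim (@Rhausdorff R) cn; apply: limr_le; first by apply/cvg_ex; exists `|f x|.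
  by apply: nearW => k; exact: fh.
have fi : m.-integrable setT (EFin \o f) by exact: integrable_norm_le hi _ _.
apply: fine_cvg; rewrite -integrableE//.
apply: (@dominated_cvg _ _ _ m setT measurableT (fun k x => (f_ k x)%:E) (EFin \o f) (EFin \o h)) => //.
- by move=> k; exact/measurable_EFinP.
- by move=> x _; apply: cvg_EFin; [exact: nearW|exact: ff].
- by move=> k x _ /=; rewrite lee_fin.
Qed.

End integral_tools.

Lemma integrable_prodM d1 d2 (T1 : measurableType d1) (T2 : measurableType d2) (R : realType)
    (m1 : {sigma_finite_measure set T1 -> \bar R}) (m2 : {sigma_finite_measure set T2 -> \bar R})
    (f : T1 -> R) (g : T2 -> R) :
  m1.-integrable setT (EFin \o f) -> m2.-integrable setT (EFin \o g) ->
  (m1 \x m2)%E.-integrable setT (EFin \o (fun z => f z.1 * g z.2)).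
Proof.
move=> fi gi.
have mf := integrable_measurable fi; have mg := integrable_measurable gi.
apply/integrable12ltyP.
  apply/measurable_EFinP; apply: measurable_funM => /=.
    by apply: (measurableT_comp mf); exact: measurable_fst.
  by apply: (measurableT_comp mg); exact: measurable_snd.
have /integrableP[_ fo] := fi; have /integrableP[_ go] := gi.
under eq_integral => x _.
  under eq_integral => y _ do rewrite /= normrM EFinM.
  rewrite ge0_integralZl//; last by apply/measurable_EFinP; exact: measurableT_comp.
  over.
rewrite /= ge0_integralZr//; last 2 first.
- by apply/measurable_EFinP; exact: measurableT_comp.
- exact: integral_ge0.
by rewrite lte_mul_pinfty// ?integral_ge0// ge0_fin_numE// integral_ge0.
Qed.

Lemma Rintegral_Fubini d1 d2 (T1 : measurableType d1) (T2 : measurableType d2) (R : realType)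
    (m1 : {sigma_finite_measure set T1 -> \bar R}) (m2 : {sigma_finite_measure set T2 -> \bar R})
    (f : T1 * T2 -> R) : (m1 \x m2)%E.-integrable setT (EFin \o f) ->
  (forall x, m2.-integrable setT (EFin \o (fun y => f (x, y)))) ->
  (forall y, m1.-integrable setT (EFin \o (fun x => f (x, y)))) ->
  \int[m1]_x \int[m2]_y f (x, y) = \int[m2]_y \int[m1]_x f (x, y).
Proof.
move=> fi f1 f2; rewrite [LHS]/Rintegral [RHS]/Rintegral; congr fine.
under eq_integral => x _ do rewrite -(integrableE (f1 x)).
under [in RHS]eq_integral => y _ do rewrite -(integrableE (f2 y)).
exact: (Fubini fi).
Qed.

Lemma edot_is_linear (R : realType) n (x : 'rV[R]_n) (a : R) (y z : 'rV[R]_n) :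
  edot x (y + a *: z) = edot x y + a * edot x z.
Proof.
rewrite /edot mulr_sumr -big_split/=; apply: eq_bigr => i _.
by rewrite !mxE; ring.
Qed.

Lemma edot_delta (R : realType) n (x : 'rV[R]_n) i : edot x (delta_mx ord0 i) = x ord0 i.
Proof.
rewrite /edot (bigD1 i)//= big1 ?addr0 => [|j ji]; rewrite mxE eqxx/=.
  by rewrite eqxx mulr1.
by rewrite (negbTE ji) mulr0.
Qed.

Lemma cosM2 (R : realType) (x y : R) : cos x * cos y = 2^-1 * (cos (x + y) + cos (x - y)).
Proof. by rewrite cosD cosB; field. Qed.

Section real_line.
Context {R : realType}.

Lemma Rintegral_FTC (F f : R -> R) (a b : R) : a <= b ->
  (forall x : R, is_derive x (1 : R) F (f x)) -> continuous f ->
  \int[@lebesgue_measure R]_(x in `[a, b]) f x = F b - F a.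
Proof.
rewrite le_eqVlt => /predU1P[-> _ _|ab dF cf].
  by rewrite set_itv1 Rintegral_set1 subrr.
rewrite /Rintegral (@continuous_FTC2 _ f F)//.
- exact: continuous_subspaceT.
- have cF x : {for x, continuous F}.
    by apply: differentiable_continuous; apply/derivable1_diffP; have [] := dF x.
  split => [x _| |]; first by have [] := dF x.
    by apply: cvg_at_right_filter; exact: cF.
  by apply: cvg_at_left_filter; exact: cF.
- by move=> x _; rewrite derive1E; have [_ ->] := dF x.
Qed.

(** An improper fundamental theorem, by dominated convergence along exhausting intervals. The
    alternative [g x = 0] admits densities carried by a half line, for which the intervals do not
    exhaust the whole line. *)
Lemma Rintegral_FTC_lim (F f g : R -> R) (a b : nat -> R) (A B : R) :
  (forall k, a k <= b k) -> (forall x : R, is_derive x (1 : R) F (f x)) ->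
  continuous f ->
  lebesgue_measure.-integrable setT (EFin \o g) ->
  (forall k x, a k <= x <= b k -> g x = f x) ->
  (forall x, g x = 0 \/ \forall k \near \oo, a k <= x <= b k) ->
  F (a k) @[k --> \oo] --> A -> F (b k) @[k --> \oo] --> B ->
  \int[@lebesgue_measure R]_x g x = B - A.
Proof.
move=> ab dF cf gi gf g0 FA FB.
have mg := integrable_measurable gi.
pose h k x := g x * \1_(`[a k, b k]%classic) x.
apply: (@cvg_unique _ (@Rhausdorff R) (F (b k) - F (a k) @[k --> \oo])); last exact: cvgB.
rewrite (_ : (fun k => _) = (fun k => \int[@lebesgue_measure R]_x h k x)); last first.
  apply/funext => k; rewrite -(@Rintegral_FTC F f)// Rintegral_mkcond.
  apply: eq_Rintegral => x _; rewrite /h /patch indicE.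
  case: ifPn => xab; last by rewrite mulr0.
  by rewrite mulr1 (gf k)//; move: xab; rewrite inE /= in_itv.
rewrite /=; apply: (@Rintegral_dct _ (measurableTypeR R) _ lebesgue_measure h g (fun x => `|g x|)).
- exact: integrable_norm gi.
- by move=> k; apply: measurable_funM => //; exact: measurable_indic.
- by move=> k x; rewrite normrM indicE; case: (_ \in _); rewrite ?normr1 ?normr0 ?mulr1 ?mulr0.
- move=> x; have [gx|xk] := g0 x.
    by rewrite /h gx (_ : (fun k => _) = (fun=> 0)); [exact: cvg_cst|apply/funext => k; rewrite mul0r].
  apply: cvg_near_cst; apply: filterS xk => k xk.
  by rewrite /h indicE mem_set ?mulr1//= in_itv.
Qed.

Lemma expR_le_inv (x : R) : 0 < x -> expR (- x) <= x^-1.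
Proof.
move=> x0; rewrite expRN lef_pV2 ?posrE ?expR_gt0//.
by apply: le_trans (expR_ge1Dx x); rewrite lerDr.
Qed.

Lemma cvg_natSinv (c : R) : 0 < c -> (c * k.+1%:R)^-1 @[k --> \oo] --> (0 : R).
Proof.
move=> c0; rewrite (_ : (fun k => _) = (fun k => c^-1 * k.+1%:R^-1)).
  by rewrite -[X in _ --> X](mulr0 c^-1); apply: cvgMr; exact: cvg_harmonic.
by apply/funext => k; rewrite invfM.
Qed.

Lemma cvg_expRNM (c : R) : 0 < c -> expR (- (c * k.+1%:R)) @[k --> \oo] --> (0 : R).
Proof.
move=> c0; apply: (@squeeze_cvgr _ _ _ _ (fun=> 0) (fun k => (c * k.+1%:R)^-1)).
- by apply: nearW => k; rewrite expR_ge0/= expR_le_inv// mulr_gt0.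
- exact: cvg_cst.
- exact: cvg_natSinv.
Qed.

Lemma integral_exponential_cos (c s : R) : 0 < c ->
  \int[@lebesgue_measure R]_x (exponential_pdf c x * cos (s * x)) = c ^+ 2 / (c ^+ 2 + s ^+ 2).
Proof.
move=> c0.
have cs0 : c ^+ 2 + s ^+ 2 != 0 by rewrite gt_eqF// ltr_pwDl ?exprn_gt0// sqr_ge0.
(* Real part of c exp((- c + i s) x) / (- c + i s). *)
pose F (x : R) := c * expR (- c * x) * (s * sin (s * x) - c * cos (s * x)) / (c ^+ 2 + s ^+ 2).
pose f (x : R) := c * expR (- c * x) * cos (s * x).
have dF (x : R) : is_derive x (1 : R) F (f x).
  rewrite /F /f; apply: is_derive_eq.
  by rewrite /GRing.scale/=; field.
have cf : continuous f.
  move=> x; apply: differentiable_continuous; apply/derivable1_diffP.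
  exact: ex_derive.
rewrite (@Rintegral_FTC_lim F f _ (fun=> 0) (fun k => k.+1%:R) (- (c ^+ 2 / (c ^+ 2 + s ^+ 2))) 0)//.
- by rewrite sub0r opprK.
- apply: (integrable_mul_bounded (integrable_exponential_pdf c0)) => [|x]; last exact: cos_max.
  by apply: measurable_cos; exact: measurable_funM.
- move=> k x /andP[x0 _]; rewrite /exponential_pdf /patch mem_set//=.
  by rewrite in_itv/= x0.
- move=> x; have [x0|x0] := leP 0 x; last first.
    left; rewrite /exponential_pdf /patch memNset ?mul0r//=.
    by rewrite in_itv/= leNgt x0.
  right; exists (Num.truncn x) => // k /= xk.
  by rewrite (le_trans (ltW (truncnS_gt x)))// ler_nat ltnS.
- rewrite (_ : F 0 = - (c ^+ 2 / (c ^+ 2 + s ^+ 2))); first exact: cvg_cst.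
  by rewrite /F !mulr0 expR0 sin0 cos0; field.
- pose K := c * (`|s| + c) / (c ^+ 2 + s ^+ 2).
  apply/norm_cvg0P.
  apply: (@squeeze_cvgr _ _ _ _ (fun=> 0) (fun k => expR (- (c * k.+1%:R)) * K)).
  + apply: nearW => k; rewrite normr_ge0/= /F /K !mulNr.
    set E := expR _; have E0 : 0 <= E by exact: expR_ge0.
    rewrite !normrM (ger0_norm E0) (gtr0_norm c0) [X in _ * X]ger0_norm; last first.
      by rewrite invr_ge0 addr_ge0// sqr_ge0.
    rewrite mulrA ler_wpM2r ?invr_ge0 ?addr_ge0 ?sqr_ge0//.
    rewrite [X in X * _]mulrC -mulrA ler_wpM2l//; apply: ler_wpM2l; first exact: ltW.
    rewrite (le_trans (ler_normB _ _))// !normrM (gtr0_norm c0) lerD//.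
      by rewrite ler_piMr// sin_max.
    by apply: ler_piMr; [exact: ltW|exact: cos_max].
  + exact: cvg_cst.
  + by rewrite -[X in _ --> X](mul0r K); apply: cvgMl; exact: cvg_expRNM.
Qed.

Lemma continuous_cauchy (k u : R) : continuous (fun x : R => k / (1 + (k * (x - u)) ^+ 2)).
Proof.
move=> x; apply: cvgM; first exact: cvg_cst.
apply: cvgV; first by rewrite gt_eqF// ltr_pwDl// sqr_ge0.
apply: cvgD; first exact: cvg_cst.
have h : {for x, continuous (fun x : R => (k * (x - u)) ^+ 2)}.
  by apply: differentiable_continuous; apply/derivable1_diffP; exact: ex_derive.
exact: h.
Qed.

Lemma integral_atan (k a b u : R) : a <= b ->
  \int[@lebesgue_measure R]_(x in `[a, b]) (k / (1 + (k * (x - u)) ^+ 2)) =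
  atan (k * (b - u)) - atan (k * (a - u)).
Proof.
move=> ab; apply: (@Rintegral_FTC (fun x => atan (k * (x - u)))) => // x.
- by apply: is_derive_eq; rewrite /GRing.scale/=; ring.
- exact: continuous_cauchy.
Qed.

Lemma cvg_atan_y (u : nat -> R) : (forall A, \forall k \near \oo, A <= u k) ->
  atan (u k) @[k --> \oo] --> pi / 2.
Proof.
move=> uy; apply: (cvg_comp u atan _ (@cvgy_atan R)).
exact/cvgryPge.
Qed.

Lemma cvg_atan_Ny (u : nat -> R) : (forall A, \forall k \near \oo, u k <= - A) ->
  atan (u k) @[k --> \oo] --> - (pi / 2).
Proof.
move=> uy; rewrite (_ : (fun k => _) = (fun k => - atan (- u k))).
  apply: cvgN; apply: cvg_atan_y => A; apply: filterS (uy A) => k.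
  by rewrite lerNr.
by apply/funext => k; rewrite atanN opprK.
Qed.

Lemma near_natS_ge (A : R) : \forall k \near \oo, A <= k.+1%:R.
Proof.
exists (Num.truncn A) => // k /= Ak.
by rewrite (le_trans (ltW (truncnS_gt A)))// ler_nat ltnS.
Qed.

(* Half-space indicators are bounded limits of superpositions of characters: the cosine transform of
   an exponential is a Cauchy kernel, and the primitives of these kernels converge to a step
   function.  So a function annihilated by all characters remains so after multiplication by the
   indicator of a half space, hence by that of any measurable set. *)
Definition step_approx (a : R) (k : nat) (u : R) : R :=
  atan (k.+1%:R ^+ 2 * (a + k.+1%:R - u)) - atan (k.+1%:R ^+ 2 * (a + k.+1%:R^-1 - u)).

(** Both arctangents tend to pi / 2, except that the second tends to - pi / 2 when a < u. At u = a
    the offset 1/(k+1) decides: the steepness (k+1)^2 beats it, which is why the steepness is a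
    square. *)
Lemma cvg_step_approx a u : step_approx a k u @[k --> \oo] --> pi * (a < u)%R%:R.
Proof.
have k1 k : (1 : R) <= k.+1%:R by rewrite ler1n.
have kk k : (k.+1%:R : R) <= k.+1%:R ^+ 2 by rewrite expr2 ler_peMl.
have top : atan (k.+1%:R ^+ 2 * (a + k.+1%:R - u)) @[k --> \oo] --> pi / 2.
  apply: cvg_atan_y => A; near=> k.
  have h1 : 1 <= a + k.+1%:R - u.
    by rewrite addrAC -lerBlDl; near: k; exact: near_natS_ge.
  apply: le_trans (_ : k.+1%:R <= _); first by near: k; exact: near_natS_ge.
  by rewrite (le_trans (kk k))// ler_peMr// sqr_ge0.
have [au|ua] := ltP a u; rewrite ?mulr1 ?mulr0.
- have -> : pi = pi / 2 - - (pi / 2) :> R by field.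
  apply: cvgB => //; apply: cvg_atan_Ny => A; near=> k.
  have ua0 : 0 < u - a by rewrite subr_gt0.
  have h1 : k.+1%:R^-1 <= (u - a) / 2.
    rewrite invf_ple ?posrE ?divr_gt0//; near: k; exact: near_natS_ge.
  apply: le_trans (_ : k.+1%:R ^+ 2 * (- ((u - a) / 2)) <= _).
    by rewrite ler_wpM2l ?sqr_ge0//; move: (k.+1%:R^-1) h1 => c h1; lra.
  rewrite mulrN lerN2; apply: le_trans (_ : k.+1%:R * ((u - a) / 2) <= _).
    by rewrite -ler_pdivrMr ?divr_gt0//; near: k; exact: near_natS_ge.
  by apply: ler_wpM2r => //; rewrite divr_ge0// ltW.
- have -> : 0 = pi / 2 - pi / 2 :> R by rewrite subrr.
  apply: cvgB => //; apply: cvg_atan_y => A; near=> k.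
  apply: le_trans (_ : k.+1%:R <= _); first by near: k; exact: near_natS_ge.
  apply: le_trans (_ : k.+1%:R ^+ 2 * k.+1%:R^-1 <= _).
    by rewrite expr2 mulfK.
  by rewrite ler_wpM2l ?sqr_ge0//; move: (k.+1%:R^-1) => c; lra.
Unshelve. all: by end_near. Qed.

Lemma step_approx_bounded a k u : `|step_approx a k u| <= pi.
Proof.
have h x : `|atan x| <= pi / 2 :> R.
  by rewrite ler_norml !ltW ?atan_gtNpi2 ?atan_ltpi2.
rewrite (le_trans (ler_normB _ _))// (_ : pi = pi / 2 + pi / 2 :> R) ?lerD//.
by field.
Qed.

End real_line.

(** * Functions annihilated by all characters *)

Section fourier_uniqueness.
Context d (T : measurableType d) (R : realType) (m : {sigma_finite_measure set T -> \bar R}).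
Context (n : nat) (X : T -> 'rV[R]_n).
Context (mX : forall i, measurable_fun setT (fun v => X v ord0 i)).
Implicit Types f phi : T -> R.

Lemma measurable_edot xi : measurable_fun setT (fun v => edot (X v) xi).
Proof. by apply: measurable_sum => i; exact: measurable_funM. Qed.

(** The free phase [th] covers cosine and sine at once and replaces complex characters; it also
    makes the family closed under products, up to sums. *)
Definition fourier_zero f := m.-integrable setT (EFin \o f) /\
  forall xi th, \int[m]_v (f v * cos (edot (X v) xi + th)) = 0.

Lemma measurable_character xi th : measurable_fun setT (fun v => cos (edot (X v) xi + th)).
Proof. by apply: measurable_cos; apply: measurable_funD => //; exact: measurable_edot. Qed.

Lemma integrable_character f xi th : m.-integrable setT (EFin \o f) ->
  m.-integrable setT (EFin \o (fun v => f v * cos (edot (X v) xi + th))).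
Proof.
move=> fi; apply: (integrable_mul_bounded fi (measurable_character xi th)) => v.
exact: cos_max.
Qed.

Lemma fourier_zeroZ f c : fourier_zero f -> fourier_zero (fun v => c * f v).
Proof.
move=> [fi f0]; split => [|xi th].
  exact: (integrableZl measurableT c fi).
under eq_Rintegral => v _ do rewrite -mulrA.
by rewrite RintegralZl// ?f0 ?mulr0//; exact: integrable_character.
Qed.

Lemma fourier_zeroB f1 f2 : fourier_zero f1 -> fourier_zero f2 ->
  fourier_zero (fun v => f1 v - f2 v).
Proof.
move=> [f1i f10] [f2i f20]; split => [|xi th]; first exact: (integrableB measurableT f1i f2i).
under eq_Rintegral => v _ do rewrite mulrBl.
by rewrite RintegralB// ?f10 ?f20 ?subrr//; exact: integrable_character.
Qed.

Lemma fourier_zero_character f xi th : fourier_zero f ->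
  fourier_zero (fun v => f v * cos (edot (X v) xi + th)).
Proof.
move=> [fi f0]; split => [|xi' th']; first exact: integrable_character.
under eq_Rintegral => v _.
  rewrite -mulrA cosM2 mulrCA mulrDr.
  rewrite (_ : edot (X v) xi + th + _ = edot (X v) (xi + 1 *: xi') + (th + th')); last first.
    by rewrite edot_is_linear; ring.
  rewrite (_ : edot (X v) xi + th - _ = edot (X v) (xi + (-1) *: xi') + (th - th')); last first.
    by rewrite edot_is_linear; ring.
  over.
rewrite RintegralZl//; last first.
  by apply: integrable_addr; exact: integrable_character.
by rewrite RintegralD// ?f0 ?addr0 ?mulr0//; exact: integrable_character.
Qed.

(** Fubini exchanges the superposition over [y] with the integral against a character. It is used
    twice: cosines are mixed into Cauchy kernels, then Cauchy kernels into differences of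
    arctangents. *)
Lemma fourier_zero_mix d' (Y : measurableType d') (nu : {sigma_finite_measure set Y -> \bar R})
    (w : T * Y -> R) (h : Y -> R) f : measurable_fun setT w -> nu.-integrable setT (EFin \o h) ->
  (forall v y, `|w (v, y)| <= h y) -> m.-integrable setT (EFin \o f) ->
  (forall y, fourier_zero (fun v => f v * w (v, y))) ->
  fourier_zero (fun v => f v * \int[nu]_y w (v, y)).
Proof.
move=> mw hi wh fi fw.
have mwv v : measurable_fun setT (fun y => w (v, y)) by exact: measurableT_comp.
have wi v : nu.-integrable setT (EFin \o (fun y => w (v, y))).
  by apply: (integrable_norm_le hi).
have mwy y : measurable_fun setT (fun v => w (v, y)) by exact: measurableT_comp.
have mf := integrable_measurable fi.
have hint : forall v, `|\int[nu]_y w (v, y)| <= \int[nu]_y h y.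
  move=> v; apply: le_trans (le_normr_Rintegral _ (wi v)) _ => //.
  apply: le_Rintegral => //.
    by have := integrable_norm (wi v).
have mphi : measurable_fun setT (fun v => \int[nu]_y w (v, y)).
  apply/measurable_EFinP; under [X in measurable_fun _ X]eq_fun => v.
    rewrite /= -(integrableE (wi v)); over.
  by apply: (@measurable_integral R _ T _ Y nu (EFin \o w)); exact/measurable_EFinP.
split => [|xi th]; first exact: (integrable_mul_bounded fi mphi hint).
pose F (z : T * Y) := f z.1 * w z * cos (edot (X z.1) xi + th).
have FM v y : `|F (v, y)| <= `|f v| * h y.
  rewrite /F /= normrM normrM -mulrA ler_wpM2l//.
  rewrite (le_trans _ (wh v y))// ler_piMr//; exact: cos_max.
have mF : measurable_fun setT F.
  apply: measurable_funM; first by apply: measurable_funM => //; exact: (measurableT_comp mf measurable_fst).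
  exact: (measurableT_comp (measurable_character xi th) measurable_fst).
have Fi : (m \x nu)%E.-integrable setT (EFin \o F).
  apply: (integrable_norm_le (integrable_prodM (integrable_norm fi) hi)) => //.
  by move=> [v y]; exact: FM.
transitivity (\int[m]_v \int[nu]_y F (v, y)).
  apply: eq_Rintegral => v _; rewrite /F/=.
  under [in RHS]eq_Rintegral => y _ do rewrite mulrAC.
  by rewrite RintegralZl// mulrAC.
rewrite Rintegral_Fubini//.
- apply: etrans (_ : \int[nu]_y 0 = 0); last by rewrite Rintegral_cst// mul0r.
  by apply: eq_Rintegral => y _; have [_ ->] := fw y.
- move=> v; rewrite (_ : (fun y => _) = (fun y => (f v * cos (edot (X v) xi + th)) * w (v, y))).
    exact: (integrableZl measurableT _ (wi v)).
  by apply/funext => y; rewrite /F/= mulrAC.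
- by move=> y; apply: integrable_character; have [] := fw y.
Qed.

Lemma fourier_zero_cvg (phi_ : nat -> T -> R) phi f (C : R) : m.-integrable setT (EFin \o f) ->
  (forall k, measurable_fun setT (phi_ k)) ->
  (forall k v, `|phi_ k v| <= C) -> (forall v, phi_ k v @[k --> \oo] --> phi v) ->
  (forall k, fourier_zero (fun v => f v * phi_ k v)) -> fourier_zero (fun v => f v * phi v).
Proof.
move=> fi mphi phiC cphi f0.
have mph : measurable_fun setT phi by apply: measurable_fun_cvg => // v _; exact: cphi.
have phC v : `|phi v| <= C.
  have cn : `|phi_ k v| @[k --> \oo] --> `|phi v| by apply: cvg_norm; exact: cphi.
  have <- := cvg_lim (@Rhausdorff R) cn; apply: limr_le; first by apply/cvg_ex; exists `|phi v|.
  by apply: nearW => k; exact: phiC.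
split => [|xi th]; first exact: (integrable_mul_bounded fi mph phC).
have := @Rintegral_dct _ _ _ m (fun k v => f v * phi_ k v * cos (edot (X v) xi + th))
  (fun v => f v * phi v * cos (edot (X v) xi + th)) (fun v => C * `|f v|).
rewrite (_ : (fun k => Rintegral _ _ _) = (fun=> 0)); last first.
  by apply/funext => k; have [_ ->] := f0 k.
have mf := integrable_measurable fi.
move=> H; apply: (@cvg_unique R^o (@Rhausdorff R) ((0 : R) @[_ --> \oo])); last exact: cvg_cst.
apply: H.
- exact: (integrable_mulr C (integrable_norm fi)).
- move=> k; apply: measurable_funM; last exact: measurable_character.
  exact: measurable_funM.
- move=> k v; rewrite normrM -[leRHS]mulr1 ler_pM// ?cos_max// normrM mulrC.
  by rewrite ler_wpM2r.
- by move=> v; apply: cvgMl; apply: cvgMr; exact: cphi.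
Qed.

Lemma fourier_zero_cauchy f i (k x : R) : 0 < k -> fourier_zero f ->
  fourier_zero (fun v => f v * (k / (1 + (k * (x - X v ord0 i)) ^+ 2))).
Proof.
move=> k0 f0; have [fi _] := f0.
have ki0 : 0 < k^-1 by rewrite invr_gt0.
have E v : k / (1 + (k * (x - X v ord0 i)) ^+ 2) =
    k * \int[@lebesgue_measure R]_y (exponential_pdf k^-1 y * cos ((x - X v ord0 i) * y)).
  rewrite integral_exponential_cos//.
  have := sqr_ge0 (k * (x - X v ord0 i)).
  have := exprn_gt0 2 ki0; have := sqr_ge0 (x - X v ord0 i).
  move=> h1 h2 h3; field; rewrite gt_eqF//= !gt_eqF//; try lra.
rewrite (_ : (fun v => _) = (fun v => k * (f v * \int[@lebesgue_measure R]_y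
    (exponential_pdf k^-1 y * cos ((x - X v ord0 i) * y))))); last first.
  by apply/funext => v; rewrite E mulrCA.
apply: fourier_zeroZ.
have mv : measurable_fun setT (fun z : T * measurableTypeR R => X z.1 ord0 i).
  exact: (measurableT_comp (mX i) measurable_fst).
have m2 : measurable_fun setT (fun z : T * measurableTypeR R => z.2 : R).
  exact: measurable_snd.
apply: (@fourier_zero_mix _ (measurableTypeR R) (@lebesgue_measure R)
  (fun z => exponential_pdf k^-1 z.2 * cos ((x - X z.1 ord0 i) * z.2)) (exponential_pdf k^-1)).
- apply: measurable_funM.
    exact: (measurableT_comp (measurable_exponential_pdf k^-1) m2).
  apply: measurable_cos; apply: measurable_funM => //; exact: measurable_funB.
- exact: integrable_exponential_pdf.
- have e0 y : 0 <= exponential_pdf k^-1 y by apply: exponential_pdf_ge0; exact: ltW.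
  by move=> v y /=; rewrite normrM ger0_norm//; apply: ler_piMr => //; exact: cos_max.
- exact: fi.
(* The cosine of (x - X_i) y is a character of frequency - y along coordinate [i] with phase x y. *)
- move=> y; rewrite (_ : (fun v => _) = (fun v => exponential_pdf k^-1 y *
      (f v * cos (edot (X v) (0 + (- y) *: delta_mx ord0 i) + x * y)))).
    by apply: fourier_zeroZ; exact: fourier_zero_character.
  apply/funext => v /=; rewrite edot_is_linear edot_delta mulrCA; congr (_ * (_ * cos _)).
  have -> : edot (X v) 0 = 0 by rewrite /edot big1// => j _; rewrite mxE mulr0.
  by ring.
Qed.

Lemma fourier_zero_gt f i a : fourier_zero f ->
  fourier_zero (fun v => f v * (a < X v ord0 i)%R%:R).
Proof.
move=> f0; have [fi _] := f0.
have fk k : fourier_zero (fun v => f v * step_approx a k (X v ord0 i)).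
  have k0 : (0 : R) < k.+1%:R ^+ 2 by rewrite exprn_gt0.
  have k1 : (1 : R) <= k.+1%:R by rewrite ler1n.
  have ab : a + k.+1%:R^-1 <= a + k.+1%:R :> R.
    by rewrite lerD2l (le_trans _ k1)// invf_le1.
  pose w (z : T * measurableTypeR R) := (\1_(`[a + k.+1%:R^-1, a + k.+1%:R]%classic) (z.2 : R) : R) *
    (k.+1%:R ^+ 2 / (1 + (k.+1%:R ^+ 2 * (z.2 - X z.1 ord0 i)) ^+ 2)).
  rewrite (_ : (fun v => _) = (fun v => f v * \int[@lebesgue_measure R]_y w (v, y))); last first.
    apply/funext => v; rewrite /step_approx -integral_atan// Rintegral_mkcond; congr (_ * _).
    apply: eq_Rintegral => y _; rewrite /w /patch indicE/=.
    by case: ifP; rewrite ?mul1r ?mul0r.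
  have Q0 (z : R) : 0 < 1 + z ^+ 2 by rewrite ltr_pwDl// sqr_ge0.
  apply: (@fourier_zero_mix _ (measurableTypeR R) (@lebesgue_measure R) w
     (fun y => k.+1%:R ^+ 2 * \1_(`[a + k.+1%:R^-1, a + k.+1%:R]%classic) (y : R))).
  - apply: measurable_funM.
      have : measurable_fun setT (\1_(`[a + k.+1%:R^-1, a + k.+1%:R]%classic) : measurableTypeR R -> R).
        by apply: measurable_indic.
      by move/measurableT_comp; apply; exact: measurable_snd.
    under [X in measurable_fun _ X]eq_fun => z do rewrite -[_.2 - _]subr0.
    apply: (measurable_continuous_comp (g := fun s => k.+1%:R ^+ 2 / (1 + (k.+1%:R ^+ 2 * (s - 0)) ^+ 2))
      (h := fun z : T * measurableTypeR R => z.2 - X z.1 ord0 i)) => [|/=].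
      exact: continuous_cauchy.
    apply: measurable_funB; first exact: measurable_snd.
    exact: (measurableT_comp (mX i) measurable_fst).
  - apply: integrable_mulr; exact: integrable_indic_itv.
  - move=> v y; rewrite /w /= normrM mulrC indicE ger0_norm; last first.
      by rewrite divr_ge0// ltW.
    rewrite [X in _ * X]ger0_norm// ler_wpM2r// ler_pdivrMr// ler_peMr// ?lerDl ?sqr_ge0//.
  - exact: fi.
  - move=> y; rewrite (_ : (fun v => _) = (fun v => \1_(`[a + k.+1%:R^-1, a + k.+1%:R]%classic) (y : R) *
      (f v * (k.+1%:R ^+ 2 / (1 + (k.+1%:R ^+ 2 * (y - X v ord0 i)) ^+ 2))))).
      by apply: fourier_zeroZ; exact: fourier_zero_cauchy.
    by apply/funext => v; rewrite /w /= mulrCA.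
have : fourier_zero (fun v => f v * (pi * (a < X v ord0 i)%R%:R)).
  apply: (@fourier_zero_cvg (fun k v => step_approx a k (X v ord0 i)) _ _ pi) => //.
  - move=> k; apply: measurable_funB;
      apply: (measurable_continuous_comp (g := atan) (@continuous_atan R));
      by apply: measurable_funM => //; exact: measurable_funB.
  - by move=> k v; exact: step_approx_bounded.
  - by move=> v; exact: cvg_step_approx.
move=> /(fourier_zeroZ pi^-1); rewrite (_ : (fun v => _ * _) = (fun v => f v * (a < X v ord0 i)%R%:R))//.
by apply/funext => v; rewrite mulrCA mulKf// gt_eqF// pi_gt0.
Qed.

(** Quantifying over every null [f], not a fixed one, allows indicators to be multiplied one after
    the other. This gives intersections, hence a sigma-algebra outright, with no pi-lambda
    argument. *)
Definition fourier_stable : set (set T) :=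
  [set A | measurable A /\ forall f, fourier_zero f -> fourier_zero (fun v => f v * \1_A v)].

Lemma sigma_algebra_fourier_stable : sigma_algebra setT fourier_stable.
Proof.
split.
- split => // f f0; rewrite (_ : (fun v => _) = (fun v => 0 * f v)).
    exact: fourier_zeroZ.
  by apply/funext => v; rewrite indic0 mulr0 mul0r.
- move=> A [mA fA]; split => [|f f0]; first exact: measurableD.
  rewrite (_ : (fun v => _) = (fun v => f v - f v * \1_A v)).
    by apply: fourier_zeroB => //; exact: fA.
  apply/funext => v; rewrite !indicE in_setD in_setT/=.
  by case: (v \in A); rewrite ?mulr0 ?mulr1 ?subrr ?subr0.
- move=> A fA; split => [|f f0]; first by apply: bigcup_measurable => k _; have [] := fA k.
  have mA k : measurable (A k) by have [] := fA k.
  pose U k := \big[setU/set0]_(j < k) A j.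
  have mU k : measurable (U k) by apply: bigsetU_measurable.
  have fU k : fourier_zero (fun v => f v * \1_(U k) v).
    elim: k => [|k IH].
      rewrite (_ : (fun v => _) = (fun v => 0 * f v)); first exact: fourier_zeroZ.
      by apply/funext => v; rewrite /U big_ord0 indic0 mulr0 mul0r.
    rewrite (_ : (fun v => _) = (fun v => f v * \1_(A k) v -
        ((f v * \1_(U k) v) * \1_(A k) v - f v * \1_(U k) v))).
      apply: fourier_zeroB; first by have [_] := fA k; exact.
      by apply: fourier_zeroB => //; have [_] := fA k; exact.
    apply/funext => v; rewrite /U big_ord_recr/= -/(U k) !indicE in_setU.
    by case: (v \in U k); case: (v \in A k) => /=; ring.
  apply: (@fourier_zero_cvg (fun k => \1_(U k)) _ _ 1) => //.
  + by have [] := f0.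
  + by move=> k v; rewrite indicE; case: (_ \in _); rewrite ?normr1 ?normr0.
  + move=> v; rewrite [X in _ --> X]indicE; have [|vA] := boolP (v \in _).
      rewrite inE => -[j _ Aj]; apply: cvg_near_cst; exists j.+1 => // k /= jk.
      rewrite indicE mem_set// /U -bigcup_mkord; by exists j.
    rewrite (_ : (fun k => _) = (fun=> 0)); first exact: cvg_cst.
    apply/funext => k; rewrite indicE memNset// /U -bigcup_mkord => -[j _ Aj].
    by move: vA; rewrite notin_setE; apply; exists j.
Qed.

Lemma fourier_stable_coord i : measurable_fun (T := g_sigma_algebraType fourier_stable) setT
  (fun v => X v ord0 i : measurableTypeR R).
Proof.
apply: (measurability (RGenOInfty.G (R := R))); first exact: RGenOInfty.measurableE.
move=> _ [_ [a ->] <-]; rewrite setTI; apply: sub_sigma_algebra; split.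
  by rewrite -[X in measurable X]setTI; exact: mX.
move=> f f0; rewrite (_ : (fun v => _) = (fun v => f v * (a < X v ord0 i)%R%:R)).
  exact: fourier_zero_gt.
apply/funext => v; rewrite indicE; congr (_ * _%:R); congr nat_of_bool.
by apply/idP/idP; rewrite inE /= in_itv/= andbT.
Qed.

End fourier_uniqueness.

(** Meant for the identity map with the sigma-algebra of stable sets on its source: as the
    coordinates are measurable there, every measurable set of [Rsp R n] is stable. *)
Lemma measurable_into_Rsp (R : realType) d (S : measurableType d) n (h : S -> Rsp R n) :
  (forall i, measurable_fun setT (fun s => emb (h s) ord0 i)) -> measurable_fun setT h.
Proof.
elim: n h => [|n IH] h mh.
  by rewrite (_ : h = fun=> tt)//; apply/funext => s; case: (h s).
rewrite (_ : h = fun s => ((h s).1, (h s).2)); last by apply/funext => s; case: (h s).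
apply: measurable_fun_pair.
- rewrite (_ : (fun s => _) = (fun s => emb (h s) ord0 (@lshift 1 n ord0))); first exact: mh.
  apply/funext => s; apply/esym; apply: etrans (row_mxEl _ _ _ _) _.
  by rewrite mxE eqxx mulr1n.
- apply: IH => i; rewrite (_ : (fun s => _) = (fun s => emb (h s) ord0 (rshift 1 i))); first exact: mh.
  by apply/funext => s; apply/esym; exact: row_mxEr.
Qed.

(** Every measurable set [A] is stable, so frequency 0 and phase 0 applied to the product of [f]
    with the indicator of [A] say that [f] has integral 0 over [A]. *)
Theorem fourier_uniqueness (R : realType) n (f : Rsp R n -> R) :
  fourier_zero (lam R n) (@emb R n) f -> ae_eq (lam R n) setT (EFin \o f) (cst 0%E).
Proof.
move=> f0; have [fi _] := f0.
have sa := sigma_algebra_fourier_stable (lam R n) (@measurable_emb R n).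
apply: integral_ae_eq => // A _ mA.
have [_ fA] : fourier_stable (lam R n) (@emb R n) A.
  rewrite -(sigma_algebra_id sa).
  have := @measurable_into_Rsp R _ (g_sigma_algebraType (fourier_stable (lam R n) (@emb R n))) n id
    (fun i => @fourier_stable_coord _ _ _ (lam R n) _ _ (@measurable_emb R n) i).
  by move=> /(_ measurableT _ mA); rewrite setTI.
have [fAi fA0] := fA f f0.
have h : \int[lam R n]_v (f v * \1_A v) = 0.
  rewrite -[RHS](fA0 0 0); apply: eq_Rintegral => v _.
  rewrite (_ : edot _ _ = 0) ?addr0 ?cos0 ?mulr1//.
  by rewrite /edot big1// => i _; rewrite mxE mulr0.
rewrite [RHS]integral0_eq// integral_mkcond.
have -> : (EFin \o f) \_ A = EFin \o (fun v => f v * \1_A v).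
  by apply/funext => v; rewrite /patch /= indicE; case: ifP; rewrite ?mulr1 ?mulr0.
by rewrite (integrableE fAi) h.
Qed.

(** * Gaussians *)

Section gaussian.
Context {R : realType}.
Implicit Types (s x xi th : R).

(** The heat kernel at time [s]: the variance is 2 s, so that the Fourier transform is exp(- s
    xi^2). *)
Definition gauss1 s x : R := normal_pdf 0 (Num.sqrt (2 * s)) x.

Lemma gauss1E s x : 0 < s ->
  gauss1 s x = (Num.sqrt (4 * pi * s))^-1 * expR (- x ^+ 2 / (4 * s)).
Proof.
move=> s0; rewrite /gauss1 normal_pdfE; last by rewrite gt_eqF// sqrtr_gt0 mulr_gt0.
rewrite /normal_peak /normal_fun subr0 sqr_sqrtr; last by rewrite mulr_ge0// ltW.
by congr ((Num.sqrt _)^-1 * expR (_ / _)); rewrite -mulr_natr; ring.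
Qed.

Lemma gauss1_ge0 s x : 0 <= gauss1 s x.
Proof. exact: normal_pdf_ge0. Qed.

Lemma integrable_gauss1 s : lebesgue_measure.-integrable setT (EFin \o gauss1 s).
Proof. exact: integrable_normal_pdf. Qed.

Lemma integral_gauss1 s : \int[@lebesgue_measure R]_x gauss1 s x = 1.
Proof. by rewrite /Rintegral integral_normal_pdf. Qed.

Lemma measurable_gauss1 s : measurable_fun setT (gauss1 s).
Proof. exact: measurable_normal_pdf. Qed.

Lemma is_derive_gauss1 s x : 0 < s ->
  is_derive x (1 : R) (gauss1 s) (- (x / (2 * s)) * gauss1 s x).
Proof.
move=> s0; rewrite (gauss1E x s0).
rewrite (_ : gauss1 s = (fun x => (Num.sqrt (4 * pi * s))^-1 * expR (- x ^+ 2 / (4 * s)))); last first.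
  by apply/funext => y; rewrite gauss1E.
apply: is_derive_eq; rewrite /GRing.scale/=; field.
by rewrite !gt_eqF// sqrtr_gt0 !mulr_gt0 ?pi_gt0.
Qed.

(** Doubling the time leaves a spare factor exp(- x^2 / (8 s)) that absorbs |x|, while the peak
    changes by less than a factor 2. The aim is integrability of the first moment. *)
Lemma gauss1_moment_bound s x : 0 < s -> `|x| * gauss1 s x <= (1 + 8 * s) * (2 * gauss1 (2 * s) x).
Proof.
move=> s0; have s20 : 0 < 2 * s by rewrite mulr_gt0.
rewrite !gauss1E//.
have pk : (Num.sqrt (4 * pi * s))^-1 <= 2 * (Num.sqrt (4 * pi * (2 * s)))^-1.
  rewrite -[leLHS]mul1r ler_pdivrMr ?sqrtr_gt0 ?mulr_gt0 ?pi_gt0//.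
  rewrite mulrAC ler_pdivlMr ?sqrtr_gt0 ?mulr_gt0 ?pi_gt0// mul1r.
  rewrite -[leRHS]ger0_norm ?mulr_ge0 ?sqrtr_ge0// -sqrtr_sqr ler_sqrt ?sqr_ge0//.
  rewrite exprMn sqr_sqrtr ?mulr_ge0 ?pi_ge0 ?ltW//.
  have := mulr_gt0 (pi_gt0 R) s0; lra.
have -> : - x ^+ 2 / (4 * s) = - (x ^+ 2 / (8 * s)) + - x ^+ 2 / (4 * (2 * s)).
  by field; rewrite gt_eqF.
rewrite expRD; set e := expR _; set E2 := expR _; set p1 := _^-1; set p2 := _^-1.
have -> : `|x| * (p1 * (e * E2)) = p1 * (`|x| * e) * E2 by ring.
have -> : (1 + 8 * s) * (2 * (p2 * E2)) = 2 * p2 * (1 + 8 * s) * E2 by ring.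
rewrite ler_wpM2r ?expR_ge0//.
rewrite ler_pM ?mulr_ge0 ?invr_ge0 ?sqrtr_ge0 ?expR_ge0// {p1 p2 pk E2}/e.
rewrite expRN ler_pdivrMr ?expR_gt0//.
have e1 := expR_ge1Dx (x ^+ 2 / (8 * s)).
have x2 : `|x| <= 1 + x ^+ 2.
  by rewrite -(real_normK (num_real x)); have := normr_ge0 x; nra.
apply: le_trans x2 _; apply: le_trans (ler_wpM2l _ e1); last by rewrite addr_ge0// mulr_ge0 ?ltW.
have -> : (1 + 8 * s) * (1 + x ^+ 2 / (8 * s)) = 1 + 8 * s + x ^+ 2 / (8 * s) + x ^+ 2.
  by field; rewrite gt_eqF.
have : 0 <= x ^+ 2 / (8 * s) by rewrite divr_ge0 ?sqr_ge0// mulr_ge0 ?ltW.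
by lra.
Qed.

Lemma integrable_gauss1_moment s : 0 < s ->
  lebesgue_measure.-integrable setT (EFin \o (fun x => x * gauss1 s x)).
Proof.
move=> s0.
apply: (@integrable_norm_le _ (measurableTypeR R) _ lebesgue_measure _ (fun x => ((1 + 8 * s) * 2) * gauss1 (2 * s) x)).
- exact: (integrable_mulr _ (integrable_gauss1 _)).
- by apply: measurable_funM => //; exact: measurable_gauss1.
- by move=> x; rewrite normrM [X in _ * X]ger0_norm ?gauss1_ge0// -mulrA gauss1_moment_bound.
Qed.

Lemma gauss1_le s x : 0 < s -> x != 0 ->
  gauss1 s x <= (Num.sqrt (4 * pi * s))^-1 * (4 * s / x ^+ 2).
Proof.
move=> s0 x0; rewrite gauss1E// ler_wpM2l ?invr_ge0 ?sqrtr_ge0//.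
have x20 : 0 < x ^+ 2 by rewrite exprn_even_gt0.
have h : 0 < x ^+ 2 / (4 * s) by apply: divr_gt0 => //; rewrite mulr_gt0.
by rewrite mulNr (le_trans (expR_le_inv h))// invf_div.
Qed.

Lemma cvg_gauss1 s : 0 < s ->
  (gauss1 s k.+1%:R @[k --> \oo] --> (0 : R)) /\ (gauss1 s (- k.+1%:R) @[k --> \oo] --> (0 : R)).
Proof.
move=> s0.
have E : (fun k : nat => gauss1 s (- k.+1%:R)) = (fun k => gauss1 s k.+1%:R).
  by apply/funext => k; rewrite !gauss1E// sqrrN.
rewrite E; suff H : gauss1 s k.+1%:R @[k --> \oo] --> (0 : R) by [].
pose c := (Num.sqrt (4 * pi * s))^-1 * (4 * s).
apply: (@squeeze_cvgr _ _ _ _ (fun=> 0) (fun k => c * k.+1%:R^-1)).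
- apply: nearW => k; rewrite gauss1_ge0/=.
  apply: le_trans (gauss1_le s0 _) _ => //; rewrite /c mulrA.
  apply: ler_wpM2l; first by rewrite mulr_ge0 ?invr_ge0 ?sqrtr_ge0// mulr_ge0// ltW.
  by rewrite lef_pV2 ?posrE ?exprn_gt0// expr2 ler_peMl// ler1n.
- exact: cvg_cst.
- by rewrite -[X in _ --> X](mulr0 c); apply: cvgMr; exact: cvg_harmonic.
Qed.

Lemma cosDpi2 x : cos (x + pi / 2) = - sin x.
Proof. by rewrite cosD cos_pihalf sin_pihalf mulr0 mulr1 sub0r. Qed.

Lemma integrable_gauss1_cos s xi th :
  lebesgue_measure.-integrable setT (EFin \o (fun x => gauss1 s x * cos (x * xi + th))).
Proof.
apply: (integrable_mul_bounded (integrable_gauss1 s)) => [|x]; last exact: cos_max.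
by apply: measurable_cos; apply: measurable_funD => //; exact: measurable_funM.
Qed.

Lemma integrable_gauss1_moment_cos s xi th : 0 < s ->
  lebesgue_measure.-integrable setT (EFin \o (fun x => x * gauss1 s x * cos (x * xi + th))).
Proof.
move=> s0; apply: (integrable_mul_bounded (integrable_gauss1_moment s0)) => [|x]; last exact: cos_max.
by apply: measurable_cos; apply: measurable_funD => //; exact: measurable_funM.
Qed.

(** Integration by parts: x times the Gaussian is - 2 s times its derivative, and the boundary terms
    vanish. Writing the sine as a cosine shifted by pi / 2 lets one identity serve all phases. *)
Lemma integral_gauss1_sin_moment s xi th : 0 < s ->
  \int[@lebesgue_measure R]_x (x * gauss1 s x * cos (x * xi + (th + pi / 2))) =
  - (2 * s * xi) * \int[@lebesgue_measure R]_x (gauss1 s x * cos (x * xi + th)).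
Proof.
move=> s0.
pose F x := gauss1 s x * cos (x * xi + (th - pi / 2)).
pose f x := (2 * s)^-1 * (x * gauss1 s x * cos (x * xi + (th + pi / 2))) +
  xi * (gauss1 s x * cos (x * xi + th)).
have dg x := is_derive_gauss1 x s0.
have dF x : is_derive x (1 : R) F (f x).
  rewrite /F; apply: is_derive_eq; rewrite /GRing.scale/= /f.
  have -> : x * xi + (th + pi / 2) = (x * xi + (th - pi / 2)) + pi by field.
  have -> : x * xi + th = (x * xi + (th - pi / 2)) + pi / 2 by field.
  rewrite cosDpi2 cosDpi; field; by rewrite gt_eqF.
have i1 := integrable_mulr (2 * s)^-1 (integrable_gauss1_moment_cos xi (th + pi / 2) s0).
have i2 := integrable_mulr xi (integrable_gauss1_cos s xi th).
have : \int[@lebesgue_measure R]_x f x = 0 - 0.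
  apply: (@Rintegral_FTC_lim _ F f f (fun k => - k.+1%:R) (fun k => k.+1%:R)) => //.
  - by move=> k; rewrite ge0_cp.
  - move=> x; have cg : {for x, continuous (gauss1 s)}.
      by apply: differentiable_continuous; apply/derivable1_diffP; have [] := dg x.
    have cc t : {for x, continuous (fun x => cos (x * xi + t))}.
      by apply: differentiable_continuous; apply/derivable1_diffP; exact: ex_derive.
    apply: cvgD; apply: cvgMr; [apply: cvgM; [apply: cvgM|]|apply: cvgM].
    + exact: cvg_id.
    + exact: cg.
    + exact: cc.
    + exact: cg.
    + exact: cc.
  - exact: (integrable_addr i1 i2).
  - move=> x; right; near=> k; rewrite lerNl; apply/andP; split; near: k; exact: near_natS_ge.
  - apply/norm_cvg0P; apply: (@squeeze_cvgr _ _ _ _ (fun=> 0) (fun k => gauss1 s (- k.+1%:R))).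
    + apply: nearW => k; rewrite normr_ge0/= /F normrM ger0_norm ?gauss1_ge0//.
      by apply: ler_piMr; [exact: gauss1_ge0|exact: cos_max].
    + exact: cvg_cst.
    + by have [] := cvg_gauss1 s0.
  - apply/norm_cvg0P; apply: (@squeeze_cvgr _ _ _ _ (fun=> 0) (fun k => gauss1 s k.+1%:R)).
    + apply: nearW => k; rewrite normr_ge0/= /F normrM ger0_norm ?gauss1_ge0//.
      by apply: ler_piMr; [exact: gauss1_ge0|exact: cos_max].
    + exact: cvg_cst.
    + by have [] := cvg_gauss1 s0.
rewrite RintegralD// !RintegralZl//; last 2 first.
- exact: integrable_gauss1_moment_cos.
- exact: integrable_gauss1_cos.
set I1 := Rintegral _ _ _; set I2 := Rintegral _ _ _; rewrite subrr => h.
have s2 : 2 * s != 0 by rewrite gt_eqF// mulr_gt0.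
have -> : I1 = 2 * s * ((2 * s)^-1 * I1 + xi * I2) - 2 * s * xi * I2 by field; rewrite gt_eqF.
by rewrite h; ring.
Unshelve. all: by end_near. Qed.

(** As a function of the frequency the transform solves c' = - 2 s y c, by differentiation under the
    integral and [integral_gauss1_sin_moment]; hence c exp(s y^2) is constant. *)
Lemma fourier_gauss1 s xi th : 0 < s ->
  \int[@lebesgue_measure R]_x (gauss1 s x * cos (x * xi + th)) = expR (- (s * xi ^+ 2)) * cos th.
Proof.
move=> s0.
pose c y := \int[@lebesgue_measure R]_x (gauss1 s x * cos (x * y + th)).
have dc (y : R) : is_derive y (1 : R) c (- (2 * s * y) * c y).
  pose f (y : R) (x : R) := gauss1 s x * cos (x * y + th).
  have df (z x : R) : is_derive z (1 : R) (f ^~ x) (x * gauss1 s x * cos (x * z + (th + pi / 2))).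
    rewrite /f; apply: is_derive_eq; rewrite /GRing.scale/= addrA cosDpi2; ring.
  have yI : `](y - 1), (y + 1)[%classic y by rewrite /= in_itv/=; apply/andP; split; lra.
  have hi := integrable_norm (integrable_gauss1_moment s0).
  have drv z x : `](y - 1), (y + 1)[%classic z -> setT x -> derivable (f ^~ x) z 1.
    by move=> _ _; have [] := df z x.
  have ub z x : `](y - 1), (y + 1)[%classic z -> setT x ->
      `|partial1of2 f z x| <= `|x * gauss1 s x|.
    move=> _ _; rewrite /partial1of2 derive1E; have [_ ->] := df z x.
    by rewrite normrM; apply: ler_piMr => //; exact: cos_max.
  have der := @derivable_under_integral R _ (measurableTypeR R) lebesgue_measure f setT measurableT
    y (y - 1) (y + 1) yI (fun z _ => integrable_gauss1_cos s z th)
    drv (fun x => `|x * gauss1 s x|) (fun=> normr_ge0 _) hi ub.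
  have val := @differentiation_under_integral R _ (measurableTypeR R) lebesgue_measure f setT measurableT
    y (y - 1) (y + 1) yI (fun z _ => integrable_gauss1_cos s z th)
    drv (fun x => `|x * gauss1 s x|) (fun=> normr_ge0 _) hi ub.
  split => //; rewrite -derive1E [LHS]val -integral_gauss1_sin_moment//.
  apply: eq_Rintegral => x _; rewrite /partial1of2 derive1E; by have [_ ->] := df y x.
pose h y := c y * expR (s * y ^+ 2).
have dh (y : R) : is_derive y (1 : R) h 0.
  by rewrite /h; apply: is_derive_eq; rewrite /GRing.scale/=; ring.
have hc : h xi = h 0.
  exact: is_derive_0_is_cst.
move: hc; rewrite /h expr0n/= mulr0 expR0 mulr1 => hc.
have c0 : c 0 = cos th.
  rewrite /c; under eq_Rintegral => x _ do rewrite mulr0 add0r.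
  by rewrite RintegralZr ?integral_gauss1 ?mul1r//; exact: integrable_gauss1.
rewrite -/(c xi) -c0 -hc mulrCA -expRD addrC.
by rewrite subrr expR0 mulr1.
Qed.

End gaussian.

(** * Fubini for real-valued integrals, with slices integrable almost everywhere *)

Section real_fubini.
Context d1 d2 (T1 : measurableType d1) (T2 : measurableType d2) (R : realType).
Context (m1 : {sigma_finite_measure set T1 -> \bar R})
  (m2 : {sigma_finite_measure set T2 -> \bar R}) (f : T1 * T2 -> R).
Context (fi : (m1 \x m2)%E.-integrable setT (EFin \o f)).

Lemma ae_eq_fubini_F : ae_eq m1 setT (fubini_F m2 (EFin \o f))
  (EFin \o (fun x => \int[m2]_y f (x, y))).
Proof.
apply: filterS (ae_integrable1 fi) => x fx _ /=.
by rewrite /fubini_F /Rintegral fineK// integrable_fin_num.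
Qed.

Lemma measurable_Rintegral_F : measurable_fun setT (fun x => \int[m2]_y f (x, y)).
Proof.
apply: (measurableT_comp (f := fine)); first exact: fine_measurable.
by apply: (@measurable_integral R _ T1 _ T2 m2 (EFin \o f)); exact: measurable_int fi.
Qed.

Lemma integrable_Rintegral_F : m1.-integrable setT (EFin \o (fun x => \int[m2]_y f (x, y))).
Proof.
have /integrableP[mF Fi] := integrable_fubini_F fi.
apply/integrableP; split; first by apply/measurable_EFinP; exact: measurable_Rintegral_F.
rewrite (_ : (\int[m1]_x _)%E = (\int[m1]_x `|fubini_F m2 (EFin \o f) x|)%E)//.
apply: ge0_ae_eq_integral => //.
- by apply: measurableT_comp => //; apply/measurable_EFinP; exact: measurable_Rintegral_F.
- exact: measurableT_comp.
- by apply: filterS ae_eq_fubini_F => x h _; rewrite h.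
Qed.

Lemma Rintegral_prod : \int[(m1 \x m2)%E]_z f z = \int[m1]_x \int[m2]_y f (x, y).
Proof.
rewrite [LHS]/Rintegral [RHS]/Rintegral; congr fine.
rewrite -(integral12_prod_meas1 fi); apply: ae_eq_integral => //.
- exact: measurable_fubini_F fi.
- by apply/measurable_EFinP; exact: measurable_Rintegral_F.
- exact: ae_eq_fubini_F.
Qed.

End real_fubini.

Section real_fubini_swap.
Context d1 d2 (T1 : measurableType d1) (T2 : measurableType d2) (R : realType).
Context (m1 : {sigma_finite_measure set T1 -> \bar R})
  (m2 : {sigma_finite_measure set T2 -> \bar R}) (f : T1 * T2 -> R).
Context (fi : (m1 \x m2)%E.-integrable setT (EFin \o f)).

Lemma integrable_swap : (m2 \x m1)%E.-integrable setT (EFin \o (fun z => f (z.2, z.1))).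
Proof.
have mf := measurable_int _ fi.
have ms : measurable_fun setT (fun z : T2 * T1 => (f (z.2, z.1))%:E).
  apply: (measurableT_comp mf (g := fun z => (z.2, z.1))).
  exact: measurable_fun_pair.
apply/integrable12ltyP => //.
by have /(integrable21ltyP _ _ mf) := fi.
Qed.

Lemma Rintegral_swap :
  \int[m1]_x \int[m2]_y f (x, y) = \int[m2]_y \int[m1]_x f (x, y).
Proof.
rewrite -(Rintegral_prod fi) -[RHS](Rintegral_prod integrable_swap) /Rintegral; congr fine.
rewrite -(integral12_prod_meas1 fi) -[RHS](integral12_prod_meas1 integrable_swap).
exact: (Fubini fi).
Qed.

End real_fubini_swap.

Section heat_kernel.
Context {R : realType} (n : nat).
Implicit Types (s : R) (y xi : 'rV[R]_n).

Definition gauss s y : R := \prod_(i < n) gauss1 s (y ord0 i).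

Lemma enorm_sqr y : enorm y ^+ 2 = \sum_(i < n) y ord0 i ^+ 2.
Proof. by rewrite /enorm sqr_sqrtr// sumr_ge0// => i _; rewrite sqr_ge0. Qed.

Lemma enorm_ge0 y : 0 <= enorm y. Proof. exact: sqrtr_ge0. Qed.

Lemma gaussE s y : 0 < s ->
  gauss s y = ((Num.sqrt (4 * pi * s))^-1) ^+ n * expR (- (enorm y ^+ 2) / (4 * s)).
Proof.
move=> s0; rewrite /gauss; under eq_bigr => i _ do rewrite gauss1E//.
rewrite big_split/= prodr_const card_ord -expR_sum; congr (_ * expR _).
by rewrite enorm_sqr -mulr_suml sumrN.
Qed.

Lemma gauss_ge0 s y : 0 <= gauss s y.
Proof. by apply: prodr_ge0 => i _; exact: gauss1_ge0. Qed.

End heat_kernel.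

Section heat_kernel_integral.
Context {R : realType}.
Implicit Types (s : R).

Lemma gauss_row n s (x : R) (v : 'rV[R]_n) :
  gauss s (row_mx x%:M v) = gauss1 s x * gauss s v.
Proof.
rewrite /gauss big_split_ord/=; congr (_ * _); last by apply: eq_bigr => i _; rewrite row_mxEr.
by rewrite big_ord1 row_mxEl mxE eqxx mulr1n.
Qed.

Lemma edot_row n (x : R) (v : 'rV[R]_n) (xi : 'rV[R]_(1 + n)) :
  edot (row_mx x%:M v) xi = x * xi ord0 ord0 + edot v (rsubmx xi).
Proof.
rewrite /edot big_split_ord/=; congr (_ + _); last by apply: eq_bigr => i _; rewrite row_mxEr mxE.
rewrite big_ord1 row_mxEl mxE eqxx mulr1n; congr (_ * xi _ _); exact/val_inj.
Qed.

Lemma enorm_sqr_row n (xi : 'rV[R]_(1 + n)) :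
  enorm xi ^+ 2 = xi ord0 ord0 ^+ 2 + enorm (rsubmx xi) ^+ 2.
Proof.
rewrite !enorm_sqr big_split_ord/= big_ord1; congr (_ + _).
  by congr (xi _ _ ^+ 2); exact/val_inj.
by apply: eq_bigr => i _; rewrite mxE.
Qed.

Lemma integrable_gauss n s : (lam R n).-integrable setT (EFin \o (fun v => gauss s (emb v))).
Proof.
elim: n => [|n IH].
  apply: (eq_integrable _ (fun=> 1%E)) => //; last first.
    apply: (@finite_measure_integrable_cst _ _ R (\d_tt : {finite_measure set _ -> \bar R})) => //.
  by move=> v _; rewrite /gauss /= big_ord0.
rewrite (_ : EFin \o _ = EFin \o (fun v : Rsp R n.+1 => gauss1 s v.1 * gauss s (emb v.2))).
  exact: (integrable_prodM (integrable_gauss1 s) IH).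
by apply/funext => v; congr _%:E; exact: gauss_row.
Qed.

Lemma fourier_gauss n s xi th : 0 < s ->
  \int[lam R n]_v (gauss s (emb v) * cos (edot (emb v) xi + th)) =
  expR (- (s * enorm xi ^+ 2)) * cos th.
Proof.
move=> s0; elim: n xi th => [|n IH] xi th.
  have := measurable_int _ (integrable_character (@measurable_emb R 0) xi th (integrable_gauss 0 s)).
  rewrite /Rintegral [lam _ _]/= => mg; rewrite integral_dirac//.
  rewrite diracT mul1e/=.
  by rewrite /gauss /edot /enorm !big_ord0 sqrtr0 expr0n/= mulr0 oppr0 expR0 add0r.
transitivity (\int[@lebesgue_measure R]_x \int[lam R n]_v
   (gauss s (emb ((x, v) : Rsp R n.+1)) * cos (edot (emb ((x, v) : Rsp R n.+1)) xi + th))).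
  apply: Rintegral_prod.
  exact: (integrable_character (@measurable_emb R n.+1) xi th (integrable_gauss n.+1 s)).
have xiE : enorm xi ^+ 2 = xi ord0 ord0 ^+ 2 + enorm (@rsubmx R 1 1 n xi) ^+ 2 by exact: enorm_sqr_row.
under eq_Rintegral => x _.
  under eq_Rintegral => v _ do rewrite /= (@gauss_row n) (@edot_row n) -mulrA [x * _ + _]addrC -addrA.
  rewrite RintegralZl//; last first.
    by apply: integrable_character; [exact: measurable_emb|exact: integrable_gauss].
  rewrite IH mulrCA; over.
rewrite RintegralZl//; last exact: integrable_gauss1_cos.
by rewrite fourier_gauss1// mulrA -expRD xiE; congr (expR _ * _); ring.
Qed.

End heat_kernel_integral.

(** * The Bessel kernel *)

Lemma Rintegral_ae_eq d (T : measurableType d) (R : realType) (m : {measure set T -> \bar R})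
    (f g : T -> R) : measurable_fun setT f -> measurable_fun setT g ->
  {ae m, forall x, f x = g x} -> \int[m]_x f x = \int[m]_x g x.
Proof.
move=> mf mg fg; rewrite /Rintegral; congr fine.
apply: ae_eq_integral => //; [exact/measurable_EFinP|exact/measurable_EFinP|].
by apply: filterS fg => x -> _.
Qed.

Lemma integrable_ae_eq d (T : measurableType d) (R : realType) (m : {measure set T -> \bar R})
    (f g : T -> R) : measurable_fun setT g -> {ae m, forall x, f x = g x} ->
  m.-integrable setT (EFin \o f) -> m.-integrable setT (EFin \o g).
Proof.
move=> mg fg fi; have mf := integrable_measurable fi; have /integrableP[_ fo] := fi.
apply/integrableP; split; first exact/measurable_EFinP.
rewrite (_ : (\int[m]_x _)%E = (\int[m]_x `|(EFin \o f) x|)%E)//.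
apply: ge0_ae_eq_integral => //.
- by apply: measurableT_comp => //; exact/measurable_EFinP.
- by apply: measurableT_comp => //; exact/measurable_EFinP.
- by apply: filterS fg => x h _; rewrite /= h.
Qed.

Section bessel.
Context {R : realType} (n : nat).
Implicit Types (s : R) (y xi : 'rV[R]_n).

(** The heat kernel extended by 0 to [s <= 0]. Real powers stand for the square root and the
    quotient, so that joint measurability in time and space can be read off the formula. *)
Definition heat s y : R := \1_(`]0, +oo[%classic) s *
  (((4 * pi * s) `^ (- 2^-1)) ^+ n * expR (- (enorm y ^+ 2) * (4 * s) `^ (- 1))).

Lemma heatE s y : 0 < s -> heat s y = gauss s y.
Proof.
move=> s0; rewrite /heat indicE mem_set ?mul1r/=; last by rewrite in_itv/= s0.
rewrite gaussE// powRN powR12_sqrt; last by rewrite !mulr_ge0// ?pi_ge0// ltW.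
by rewrite powR_inv1// mulr_ge0// ltW.
Qed.

Lemma heat_le0 s y : s <= 0 -> heat s y = 0.
Proof.
move=> s0; rewrite /heat indicE memNset ?mul0r//=.
by rewrite in_itv/= andbT ltNge s0.
Qed.

Lemma heat_ge0 s y : 0 <= heat s y.
Proof.
by have [s0|s0] := leP s 0; [rewrite heat_le0|rewrite heatE// gauss_ge0].
Qed.

Lemma measurable_enorm_sqr d (T : measurableType d) (h : T -> 'rV[R]_n) :
  (forall i, measurable_fun setT (fun x => h x ord0 i)) ->
  measurable_fun setT (fun x => enorm (h x) ^+ 2).
Proof.
move=> mh; under [X in measurable_fun _ X]eq_fun => x do rewrite enorm_sqr.
by apply: measurable_sum => i; exact: measurable_funX.
Qed.

Lemma measurable_heat c :
  measurable_fun setT (fun z : Rsp R n * measurableTypeR R => heat (c * z.2) (emb z.1)).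
Proof.
have m2 : measurable_fun setT (fun z : Rsp R n * measurableTypeR R => c * z.2 : R).
  by apply: measurable_funM => //; exact: measurable_snd.
have mi : measurable_fun setT (\1_(`]0, +oo[%classic) : measurableTypeR R -> R).
  exact: measurable_indic.
apply: measurable_funM; first exact: (measurableT_comp mi m2).
apply: measurable_funM.
  apply: measurable_funX; apply: (measurableT_comp (measurable_powR (- 2^-1))).
  by apply: measurable_funM => //.
apply: (measurableT_comp (@measurable_expR R)); apply: measurable_funM.
  apply: measurableT_comp => //; apply: measurable_enorm_sqr => i.
  exact: (measurableT_comp (@measurable_emb R n i) measurable_fst).
apply: (measurableT_comp (measurable_powR (- 1))).
by apply: measurable_funM => //.
Qed.

Lemma integrable_heat s : (lam R n).-integrable setT (EFin \o (fun v => heat s (emb v))).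
Proof.
have [s0|s0] := leP s 0.
  rewrite (_ : EFin \o _ = cst 0%E); first exact: integrable0.
  by apply/funext => v /=; rewrite heat_le0.
rewrite (_ : EFin \o _ = EFin \o (fun v => gauss s (emb v))); first exact: integrable_gauss.
by apply/funext => v /=; rewrite heatE.
Qed.

Lemma fourier_heat s xi th :
  \int[lam R n]_v (heat s (emb v) * cos (edot (emb v) xi + th)) =
  \1_(`]0, +oo[%classic) s * (expR (- (s * enorm xi ^+ 2)) * cos th).
Proof.
have [s0|s0] := leP s 0.
  rewrite indicE memNset ?mul0r//=; last by rewrite in_itv/= andbT ltNge s0.
  under eq_Rintegral => v _ do rewrite heat_le0// mul0r.
  by rewrite Rintegral_cst// mul0r.
rewrite indicE mem_set ?mul1r//=; last by rewrite in_itv/= s0.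
by under eq_Rintegral => v _ do rewrite heatE//; rewrite fourier_gauss.
Qed.

Lemma integral_heat s : \int[lam R n]_v heat s (emb v) = \1_(`]0, +oo[%classic) s.
Proof.
have := fourier_heat s 0 0.
rewrite enorm_sqr big1 => [|i _]; last by rewrite mxE expr0n.
rewrite mulr0 oppr0 expR0 cos0 !mulr1 => <-; apply: eq_Rintegral => v _.
rewrite (_ : edot _ _ = 0) ?addr0 ?cos0 ?mulr1//.
by rewrite /edot big1// => i _; rewrite mxE mulr0.
Qed.

(** Integrating in space first leaves at most |w|, since the heat kernel has mass 1. The scale [c]
    is 1 for the kernel itself and 2 for its exponential moment. *)
Lemma integrable_heat_mix (w : R -> R) c : 0 < c -> lebesgue_measure.-integrable setT (EFin \o w) ->
  (lam R n \x lebesgue_measure)%E.-integrable setT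
    (EFin \o (fun z : Rsp R n * measurableTypeR R => w z.2 * heat (c * z.2) (emb z.1))).
Proof.
move=> c0 wi; have mw := integrable_measurable wi.
apply/(@integrable21ltyP _ _ _ (measurableTypeR R)).
  apply/measurable_EFinP; apply: measurable_funM; last exact: measurable_heat.
  exact: (measurableT_comp mw measurable_snd).
have /integrableP[_ wo] := wi; apply: le_lt_trans wo.
apply: ge0_le_integral => //.
- by move=> s _; exact: integral_ge0.
- apply: (@measurable_fun_fubini_tonelli_G _ _ _ _ _ (lam R n)
    (fun z : Rsp R n * measurableTypeR R => `|(w z.2 * heat (c * z.2) (emb z.1))%:E|%E)) => //.
  apply: measurableT_comp => //; apply/measurable_EFinP; apply: measurable_funM; last exact: measurable_heat.
  exact: (measurableT_comp mw measurable_snd).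
- by apply: measurableT_comp => //; exact/measurable_EFinP.
move=> s _ /=.
under eq_integral => v _ do rewrite normrM EFinM [`|heat _ _|]ger0_norm ?heat_ge0//.
have hi := integrable_heat (c * s).
rewrite ge0_integralZl//; last 2 first.
- exact: measurable_int hi.
- by move=> v _; rewrite lee_fin heat_ge0.
rewrite (integrableE hi) integral_heat -EFinM lee_fin ler_piMr// indicE.
Qed.

(** From dimension 2 on the mixture diverges at the origin, where [Rintegral] returns the default 0;
    pointwise statements about it hold almost everywhere only. *)
Definition bessel (v : Rsp R n) : R :=
  \int[@lebesgue_measure R]_s (exponential_pdf 1 s * heat s (emb v)).

Lemma integrable_bessel_prod : (lam R n \x lebesgue_measure)%E.-integrable setT
  (EFin \o (fun z : Rsp R n * measurableTypeR R => exponential_pdf 1 z.2 * heat z.2 (emb z.1))).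
Proof.
have H := @integrable_heat_mix (exponential_pdf 1) 1 ltr01 (integrable_exponential_pdf ltr01).
rewrite (_ : (fun z : _ * _ => _) = (fun z : Rsp R n * measurableTypeR R =>
  exponential_pdf 1 z.2 * heat (1 * z.2) (emb z.1))); first exact: H.
by apply/funext => z; rewrite mul1r.
Qed.

Lemma integrable_bessel : (lam R n).-integrable setT (EFin \o bessel).
Proof. exact: integrable_Rintegral_F integrable_bessel_prod. Qed.

(** The integrand is 1/(1 + q) times the exponential density of rate 1 + q, except at [s = 0], where
    the indicator vanishes and the density does not. *)
Lemma laplace_indic (q : R) : 0 <= q ->
  \int[@lebesgue_measure R]_s (exponential_pdf 1 s * (\1_(`]0, +oo[%classic) s * expR (- (s * q)))) =
  (1 + q)^-1.
Proof.
move=> q0; have q1 : 0 < 1 + q by rewrite ltr_pwDl.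
transitivity (\int[@lebesgue_measure R]_s ((1 + q)^-1 * exponential_pdf (1 + q) s)); last first.
  rewrite RintegralZl//; last exact: integrable_exponential_pdf.
  by rewrite /Rintegral integral_exponential_pdf//= mulr1.
apply: Rintegral_ae_eq.
- apply: measurable_funM; first exact: measurable_exponential_pdf.
  apply: measurable_funM; first exact: measurable_indic.
  by apply: (measurableT_comp (@measurable_expR R)); apply: measurableT_comp => //; exact: measurable_funM.
- by apply: measurable_funM => //; exact: measurable_exponential_pdf.
- exists [set 0]; split; [exact: measurable_set1|exact: lebesgue_measure_set1|].
  move=> s /= ns; apply: contrapT => s0; apply: ns.
  rewrite /exponential_pdf /patch indicE; have [sp|sp] := ltP 0 s.
    rewrite !mem_set ?mul1r/=; last 2 first.
    - by rewrite in_itv/= sp.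
    - by rewrite in_itv/= ltW.
    rewrite mulKf ?gt_eqF// -expRD; congr expR; ring.
  rewrite !memNset ?mul0r ?mulr0//= in_itv/= andbT.
  - by move=> s1; move: sp; rewrite leNgt s1.
  - by move=> s1; apply: s0; apply/eqP; rewrite eq_le sp.
Qed.

Lemma fourier_bessel xi th :
  \int[lam R n]_v (bessel v * cos (edot (emb v) xi + th)) = (1 + enorm xi ^+ 2)^-1 * cos th.
Proof.
have hb := integrable_bessel_prod.
pose F (z : Rsp R n * measurableTypeR R) :=
  exponential_pdf 1 z.2 * heat z.2 (emb z.1) * cos (edot (emb z.1) xi + th).
have mc := measurable_character (@measurable_emb R n) xi th.
have Fi : (lam R n \x lebesgue_measure)%E.-integrable setT (EFin \o F).
  apply: (integrable_mul_bounded hb (C := 1)) => [|z]; last exact: cos_max.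
  exact: (measurableT_comp mc measurable_fst).
transitivity (\int[lam R n]_v \int[@lebesgue_measure R]_s F (v, s)).
  apply: Rintegral_ae_eq.
  - by apply: measurable_funM => //; exact: integrable_measurable integrable_bessel.
  - exact: (measurable_Rintegral_F Fi).
  - apply: filterS (ae_integrable1 hb) => v hv.
    by rewrite /F /bessel /= RintegralZr.
rewrite (Rintegral_swap Fi).
have q0 : 0 <= enorm xi ^+ 2 by rewrite sqr_ge0.
rewrite -(laplace_indic q0) -RintegralZr//; last first.
  apply: (integrable_mul_bounded (integrable_exponential_pdf (@ltr01 R)) (C := 1)).
    apply: measurable_funM; first exact: measurable_indic.
    by apply: (measurableT_comp (@measurable_expR R)); apply: measurableT_comp => //; exact: measurable_funM.
  move=> s; rewrite indicE; case: (boolP (s \in _)) => [|_]; last by rewrite mul0r normr0.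
  rewrite inE /= in_itv/= andbT => s0; rewrite mul1r ger0_norm ?expR_ge0// -expR0 ler_expR.
  by rewrite oppr_le0 mulr_ge0// ltW.
apply: eq_Rintegral => s _; rewrite /F/=.
under eq_Rintegral => v _ do rewrite -mulrA.
rewrite RintegralZl// ?fourier_heat ?mulrA//.
by apply: integrable_character; [exact: measurable_emb|exact: integrable_heat].
Qed.

End bessel.

Section kernel.
Context {R : realType} (n : nat) (B : 'rV[R]_n -> R).
Context (hB : is_bessel_kernel B).

Let b (v : Rsp R n) := B (emb v).

Lemma measurable_kernel : measurable_fun setT b.
Proof. by have [mB _ _ _] := hB; exact: rV_measurable_emb. Qed.

Lemma integrable_kernel : (lam R n).-integrable setT (EFin \o b).
Proof.
have [_ Bi _ _] := hB; apply/integrableP; split; first exact/measurable_EFinP/measurable_kernel.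
rewrite -(@ge0_iintE R n (fun x => `|B x|%:E))//.
by apply/measurable_EFinP; apply: measurableT_comp => //; exact: measurable_kernel.
Qed.

Lemma fourier_kernel xi th :
  \int[lam R n]_v (b v * cos (edot (emb v) xi + th)) = (1 + enorm xi ^+ 2)^-1 * cos th.
Proof.
have [_ _ Bc Bs] := hB.
have ic := integrable_character (@measurable_emb R n) xi 0 integrable_kernel.
have ii := integrable_character (@measurable_emb R n) xi (- (pi / 2)) integrable_kernel.
have cE : \int[lam R n]_v (b v * cos (edot (emb v) xi + 0)) = (1 + enorm xi ^+ 2)^-1.
  rewrite -Bc RintE; first by apply: eq_Rintegral => v _; rewrite addr0.
  by move: ic; under eq_fun do rewrite addr0.
have sN x : cos (x + - (pi / 2)) = sin x :> R.
  by rewrite cosB cos_pihalf sin_pihalf mulr0 add0r mulr1.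
have sE : \int[lam R n]_v (b v * cos (edot (emb v) xi + - (pi / 2))) = 0.
  rewrite -(Bs xi) RintE; first by apply: eq_Rintegral => v _; rewrite sN.
  by move: ii; under eq_fun do rewrite sN.
transitivity (\int[lam R n]_v (cos th * (b v * cos (edot (emb v) xi + 0)) -
    sin th * (b v * cos (edot (emb v) xi + - (pi / 2))))).
  by apply: eq_Rintegral => v _; rewrite addr0 sN cosD; ring.
rewrite RintegralB//; [|exact: integrable_mulr|exact: integrable_mulr].
by rewrite !RintegralZl// cE sE mulr0 subr0 mulrC.
Qed.

Lemma kernel_ae_bessel : {ae lam R n, forall v, b v = bessel v}.
Proof.
have fi := integrable_subr integrable_kernel (integrable_bessel n).
have : fourier_zero (lam R n) (@emb R n) (fun v => b v - bessel v).
  split => // xi th; under eq_Rintegral do rewrite mulrBl.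
  rewrite RintegralB//; last 2 first.
  - by apply: integrable_character; [exact: measurable_emb|exact: integrable_kernel].
  - by apply: integrable_character; [exact: measurable_emb|exact: integrable_bessel].
  by rewrite fourier_kernel fourier_bessel subrr.
move=> /fourier_uniqueness; apply: filterS => v /(_ I) [] /eqP.
by rewrite subr_eq0 => /eqP.
Qed.

Lemma gauss_lower s (y : 'rV[R]_n) : 1 <= s <= 2 ->
  ((Num.sqrt (4 * pi * 2))^-1) ^+ n * expR (- (enorm y ^+ 2) / 4) <= gauss s y.
Proof.
move=> /andP[s1 s2]; have s0 : 0 < s by rewrite (lt_le_trans ltr01).
have p0 := pi_gt0 R.
rewrite gaussE// ler_pM ?exprn_ge0 ?invr_ge0 ?sqrtr_ge0 ?expR_ge0//.
  rewrite lerXn2r ?nnegrE ?invr_ge0 ?sqrtr_ge0// lef_pV2 ?posrE ?sqrtr_gt0 ?mulr_gt0//.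
  by rewrite ler_sqrt; [rewrite ler_pM2l ?mulr_gt0|rewrite !mulr_ge0// ltW].
rewrite ler_expR !mulNr lerN2 ler_wpM2l ?sqr_ge0// lef_pV2 ?posrE ?mulr_gt0//.
by rewrite ler_peMr.
Qed.

(** Only the times 1 <= s <= 2 of the mixture are kept: there the exponential weight is at least
    exp(- 2) and the heat kernel exceeds a fixed Gaussian. *)
Lemma kernel_lower : exists2 c : R, 0 < c &
  {ae lam R n, forall v, c * expR (- (enorm (emb v) ^+ 2) / 4) <= b v}.
Proof.
pose c : R := expR (- 2) * ((Num.sqrt (4 * pi * 2))^-1) ^+ n.
exists c; first by rewrite mulr_gt0 ?expR_gt0// exprn_gt0// invr_gt0 sqrtr_gt0 !mulr_gt0 ?pi_gt0.
have hb := @integrable_bessel_prod R n.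
apply: filterS2 kernel_ae_bessel (ae_integrable1 hb) => v -> hv.
pose g (s : R) : R := c * expR (- (enorm (emb v) ^+ 2) / 4) * \1_(`[1, 2]%classic) s.
have i12 : lebesgue_measure.-integrable setT (EFin \o (\1_(`[1, 2]%classic) : R -> R)).
  exact: integrable_indic_itv.
have -> : c * expR (- (enorm (emb v) ^+ 2) / 4) = \int[@lebesgue_measure R]_s g s.
  rewrite RintegralZl// /Rintegral integral_indic// setIT.
  have := @lebesgue_measure_itv R `[1, 2]; rewrite /= lte_fin ltr1n => ->.
  by rewrite -EFinB/= (_ : 2 - 1 = 1) ?mulr1//; ring.
apply: le_Rintegral => //; first exact: (integrable_mulr _ i12).
move=> s _; rewrite /g indicE; have [|_] := boolP (s \in _); last first.
  by rewrite mulr0 mulr_ge0 ?heat_ge0// exponential_pdf_ge0.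
rewrite inE /= in_itv/= => s12; have /andP[s1 s2] := s12.
have s0 : 0 < s by rewrite (lt_le_trans ltr01).
rewrite mulr1 /c -mulrA heatE// ler_pM ?expR_ge0//.
- rewrite /exponential_pdf /patch mem_set/=; last by rewrite in_itv/= ltW.
  by rewrite mul1r mulN1r ler_expR lerN2.
- exact: gauss_lower.
Qed.

(** Doubling the time once more: the two exponents differ by the square (|y| - 2 s)^2 / (8 s). The
    price exp(s / 2) is affordable because the mixture carries the weight exp(- s). *)
Lemma gauss_exp_bound s (y : 'rV[R]_n) : 0 < s ->
  gauss s y * expR (enorm y / 2) <= 2 ^+ n * expR (s / 2) * gauss (2 * s) y.
Proof.
move=> s0; have s20 : 0 < 2 * s by rewrite mulr_gt0.
rewrite !gaussE//.
have pk : (Num.sqrt (4 * pi * s))^-1 <= 2 * (Num.sqrt (4 * pi * (2 * s)))^-1.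
  rewrite -[leLHS]mul1r ler_pdivrMr ?sqrtr_gt0 ?mulr_gt0 ?pi_gt0//.
  rewrite mulrAC ler_pdivlMr ?sqrtr_gt0 ?mulr_gt0 ?pi_gt0// mul1r.
  rewrite -[leRHS]ger0_norm ?mulr_ge0 ?sqrtr_ge0// -sqrtr_sqr ler_sqrt ?sqr_ge0//.
  rewrite exprMn sqr_sqrtr ?mulr_ge0 ?pi_ge0 ?ltW//.
  have := mulr_gt0 (pi_gt0 R) s0; lra.
set p1 := _^-1 in pk *; set p2 := _^-1 in pk *.
have -> : p1 ^+ n * expR (- enorm y ^+ 2 / (4 * s)) * expR (enorm y / 2) =
    p1 ^+ n * expR (- enorm y ^+ 2 / (4 * s) + enorm y / 2) by rewrite expRD mulrA.
have -> : 2 ^+ n * expR (s / 2) * (p2 ^+ n * expR (- enorm y ^+ 2 / (4 * (2 * s)))) =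
    (2 * p2) ^+ n * expR (s / 2 + - enorm y ^+ 2 / (4 * (2 * s))).
  by rewrite exprMn expRD; ring.
have p10 : 0 <= p1 by rewrite invr_ge0 sqrtr_ge0.
rewrite ler_pM ?expR_ge0 ?exprn_ge0// ?lerXn2r ?nnegrE ?(le_trans p10)// ler_expR.
rewrite -subr_ge0 (_ : _ - _ = (enorm y - 2 * s) ^+ 2 / (8 * s)).
  by rewrite divr_ge0 ?sqr_ge0// mulr_ge0// ltW.
by field; rewrite gt_eqF.
Qed.

Lemma measurable_enorm_emb : measurable_fun setT (fun v : Rsp R n => enorm (emb v)).
Proof.
apply: measurable_continuous_comp; first exact: sqrt_continuous.
by apply: measurable_sum => i; apply: measurable_funX; exact: measurable_emb.
Qed.

Lemma integrable_kernel_exp :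
  (lam R n).-integrable setT (EFin \o (fun v => b v * expR (enorm (emb v) / 2))).
Proof.
have hb := @integrable_bessel_prod R n.
have half0 : (0 : R) < 2^-1 by rewrite invr_gt0.
(* exp(- s) exp(s / 2) is twice the exponential density of rate 1/2; together with the factor 2^n of
   [gauss_exp_bound] this gives 2^(n+1). *)
have h2 := @integrable_heat_mix R n (fun s => 2 ^+ n.+1 * exponential_pdf 2^-1 s) 2 (ltr0Sn _ _)
  (integrable_mulr _ (integrable_exponential_pdf half0)).
have me : measurable_fun setT (fun v : Rsp R n => expR (enorm (emb v) / 2)).
  apply: (measurableT_comp (@measurable_expR R)); apply: measurable_funM => //.
  exact: measurable_enorm_emb.
pose F (z : Rsp R n * measurableTypeR R) :=
  exponential_pdf 1 z.2 * heat z.2 (emb z.1) * expR (enorm (emb z.1) / 2).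
have Fi : (lam R n \x lebesgue_measure)%E.-integrable setT (EFin \o F).
  apply: (integrable_norm_le h2).
    apply: measurable_funM; first exact: integrable_measurable hb.
    exact: (measurableT_comp me measurable_fst).
  move=> [v s]; rewrite /F /= ger0_norm; last first.
    by rewrite mulr_ge0 ?expR_ge0// mulr_ge0 ?heat_ge0// exponential_pdf_ge0.
  have [s0|s0] := leP s 0.
    by rewrite heat_le0// mulr0 mul0r mulr_ge0 ?heat_ge0// mulr_ge0 ?exponential_pdf_ge0 ?exprn_ge0.
  have -> : exponential_pdf 1 s = expR (- s) :> R.
    rewrite /exponential_pdf /patch mem_set/=; last by rewrite in_itv/= ltW.
    by rewrite mul1r mulN1r.
  have -> : exponential_pdf 2^-1 s = 2^-1 * expR (- s / 2) :> R.
    rewrite /exponential_pdf /patch mem_set/=; last by rewrite in_itv/= ltW.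
    by congr (_ * expR _); field.
  rewrite !heatE ?mulr_gt0// -mulrA.
  apply: le_trans (ler_wpM2l (expR_ge0 _) (gauss_exp_bound (emb v) s0)) _.
  rewrite exprS (_ : - s / 2 = - s + s / 2); last by field.
  by rewrite expRD le_eqVlt; apply/orP; left; apply/eqP; field.
apply: integrable_ae_eq (integrable_Rintegral_F Fi).
  by apply: measurable_funM => //; exact: measurable_kernel.
apply: filterS2 kernel_ae_bessel (ae_integrable1 hb) => v -> hv.
by rewrite /F /bessel /= RintegralZr.
Qed.

End kernel.

(** * Averages against the kernel *)

Section continuous_arith.
Context {R : realType} {U : topologicalType}.
Implicit Types f g : U -> R.

Lemma continuous_cstr (a : R) : continuous (fun _ : U => a).
Proof. by move=> z; apply: cvg_cst. Qed.

Lemma continuous_addr f g : continuous f -> continuous g -> continuous (fun z => f z + g z).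
Proof. by move=> cf cg z; exact: (cvgD (cf z) (cg z)). Qed.

Lemma continuous_oppr f : continuous f -> continuous (fun z => - f z).
Proof. by move=> cf z; exact: (cvgN (cf z)). Qed.

Lemma continuous_subr f g : continuous f -> continuous g -> continuous (fun z => f z - g z).
Proof. by move=> cf cg; apply: continuous_addr => //; exact: continuous_oppr. Qed.

Lemma continuous_mulr f g : continuous f -> continuous g -> continuous (fun z => f z * g z).
Proof. by move=> cf cg z; exact: (cvgM (cf z) (cg z)). Qed.

Lemma continuous_compr f (h : R -> R) : continuous f -> continuous h ->
  continuous (fun z => h (f z)).
Proof. by move=> cf ch z; apply: (continuous_comp (cf z)); exact: ch. Qed.

End continuous_arith.

Section euclidean.
Context {R : realType} {n : nat}.
Implicit Types x y z : 'rV[R]_n.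

Lemma edotC x y : edot x y = edot y x.
Proof. by apply: eq_bigr => i _; rewrite mulrC. Qed.

Lemma enormN x : enorm (- x) = enorm x.
Proof. by rewrite /enorm; congr Num.sqrt; apply: eq_bigr => i _; rewrite mxE sqrrN. Qed.

Lemma enorm0 : enorm (0 : 'rV[R]_n) = 0.
Proof. by rewrite /enorm big1 ?sqrtr0// => i _; rewrite mxE expr0n. Qed.

Lemma enorm_sqrD x y : enorm (x + y) ^+ 2 = enorm x ^+ 2 + 2 * edot x y + enorm y ^+ 2.
Proof.
rewrite !enorm_sqr mulr_sumr -!big_split/=; apply: eq_bigr => i _.
by rewrite mxE; ring.
Qed.

Lemma edot_le x y : edot x y <= enorm x * enorm y.
Proof.
have x0 := enorm_ge0 x; have y0 := enorm_ge0 y.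
have [yE|yn] := eqVneq (enorm y) 0.
  rewrite yE mulr0; have yi i : y ord0 i = 0.
    have /eqP := enorm_sqr y; rewrite yE expr0n/= eq_sym psumr_eq0 => [|j _]; last exact: sqr_ge0.
    by move=> /allP /(_ i (mem_index_enum _)); rewrite sqrf_eq0 => /eqP.
  by rewrite /edot big1// => i _; rewrite yi mulr0.
have yp : 0 < enorm y by rewrite lt_neqAle eq_sym yn.
have := sqr_ge0 (enorm (x + (- (edot x y / enorm y ^+ 2)) *: y)).
have ZE a : enorm (a *: y) ^+ 2 = a ^+ 2 * enorm y ^+ 2.
  rewrite !enorm_sqr mulr_sumr; apply: eq_bigr => i _; by rewrite mxE exprMn.
have dE a : edot x (a *: y) = a * edot x y.
  by rewrite /edot mulr_sumr; apply: eq_bigr => i _; rewrite mxE mulrCA.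
rewrite enorm_sqrD ZE dE.
have -> : enorm x ^+ 2 + 2 * (- (edot x y / enorm y ^+ 2) * edot x y) +
    (- (edot x y / enorm y ^+ 2)) ^+ 2 * enorm y ^+ 2 =
    (enorm x ^+ 2 * enorm y ^+ 2 - edot x y ^+ 2) / enorm y ^+ 2.
  by field.
rewrite pmulr_lge0 ?invr_gt0 ?exprn_gt0// subr_ge0 -exprMn => h.
have [d0|d0] := leP (edot x y) 0; first by rewrite (le_trans d0)// mulr_ge0.
by rewrite -(ler_pXn2r (isT : (0 < 2)%N)) ?nnegrE ?mulr_ge0// ltW.
Qed.

Lemma ler_enormD x y : enorm (x + y) <= enorm x + enorm y.
Proof.
rewrite -(ler_pXn2r (isT : (0 < 2)%N)) ?nnegrE ?addr_ge0 ?enorm_ge0// enorm_sqrD sqrrD.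
have := edot_le x y; have := sqr_ge0 (enorm x); rewrite -mulr_natl; lra.
Qed.

Lemma ler_enormB x y : enorm (x - y) <= enorm x + enorm y.
Proof. by rewrite -(enormN y) ler_enormD. Qed.

Lemma enorm_distl x y : enorm x - enorm y <= enorm (x - y).
Proof. by rewrite lerBlDr; have := ler_enormD (x - y) y; rewrite subrK. Qed.

Lemma continuous_enorm : continuous (@enorm R n).
Proof.
have cs (s : seq 'I_n) : continuous (fun x : 'rV[R]_n => \sum_(i <- s) x ord0 i ^+ 2).
  elim: s => [|i s IH].
    by rewrite (_ : (fun x => _) = (fun=> 0)); [exact: continuous_cstr|apply/funext => x; rewrite big_nil].
  rewrite (_ : (fun x => _) = (fun x => x ord0 i ^+ 2 + \sum_(j <- s) x ord0 j ^+ 2)); last first.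
    by apply/funext => x; rewrite big_cons.
  apply: continuous_addr IH; apply: continuous_compr (@exprn_continuous R 2).
  exact: coord_continuous.
exact: continuous_compr (cs _) (@sqrt_continuous R).
Qed.

End euclidean.

Section reflection.
Context {R : realType} {n : nat}.

Lemma integrable_sub_emb (g : 'rV[R]_n -> R) (x : 'rV[R]_n) : rV_measurable g ->
  (lam R n).-integrable setT (EFin \o (fun v => g (emb v))) ->
  (lam R n).-integrable setT (EFin \o (fun v => g (x - emb v))).
Proof.
move=> mg gi; have mg1 := rV_measurable_emb mg.
have mg2 : measurable_fun setT (fun v : Rsp R n => g (x - emb v)).
  apply: (@rV_measurable_comp R _ (Rsp R n) n g (fun v => x - emb v)) => // i.
  by under eq_fun do rewrite !mxE; apply: measurable_funB => //; exact: measurable_emb.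
apply/integrableP; split; first exact/measurable_EFinP.
have /integrableP[_] := gi.
rewrite -(@ge0_iintE R n (fun y => `|(g y)%:E|%E))//; last first.
  by apply: measurableT_comp => //; exact/measurable_EFinP.
rewrite -(@ge0_iintE R n (fun y => `|(g (x - y))%:E|%E))//; last first.
  by apply: measurableT_comp => //; exact/measurable_EFinP.
rewrite (@ge0_iint_sub R n x (fun y => `|(g y)%:E|%E))//.
by apply: measurableT_comp => //; exact/measurable_EFinP.
Qed.

Lemma ge0_Rintegral_sub_emb (g : 'rV[R]_n -> R) (x : 'rV[R]_n) : rV_measurable g ->
  (forall y, 0 <= g y) ->
  \int[lam R n]_v g (x - emb v) = \int[lam R n]_v g (emb v).
Proof.
move=> mg g0; have mg1 := rV_measurable_emb mg.
have mg2 : measurable_fun setT (fun v : Rsp R n => g (x - emb v)).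
  apply: (@rV_measurable_comp R _ (Rsp R n) n g (fun v => x - emb v)) => // i.
  by under eq_fun do rewrite !mxE; apply: measurable_funB => //; exact: measurable_emb.
rewrite /Rintegral; congr fine.
rewrite -(@ge0_iintE R n (fun y => (g y)%:E))//; last exact/measurable_EFinP.
rewrite -(@ge0_iintE R n (fun y => (g (x - y))%:E)); last 2 first.
- by move=> y; rewrite lee_fin.
- exact/measurable_EFinP.
by rewrite (@ge0_iint_sub R n x (fun y => (g y)%:E))//; exact/measurable_EFinP.
Qed.

(** g = (|g| + g) - |g| reduces the claim to nonnegative functions. *)
Lemma Rintegral_sub_emb (g : 'rV[R]_n -> R) (x : 'rV[R]_n) : rV_measurable g ->
  (lam R n).-integrable setT (EFin \o (fun v => g (emb v))) ->
  \int[lam R n]_v g (x - emb v) = \int[lam R n]_v g (emb v).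
Proof.
move=> mg gi; have gxi := integrable_sub_emb x mg gi.
have mn : rV_measurable (fun y => `|g y|) by apply: measurableT_comp.
have mp : rV_measurable (fun y => `|g y| + g y) by exact: measurable_funD.
have split h : (lam R n).-integrable setT (EFin \o h) ->
    \int[lam R n]_v h v = \int[lam R n]_v (`|h v| + h v) - \int[lam R n]_v `|h v|.
  move=> hi; have hn := integrable_norm hi.
  by rewrite RintegralD// addrC addKr.
rewrite (split _ gxi) (split _ gi); congr (_ - _).
  apply: (ge0_Rintegral_sub_emb x mp) => y; rewrite addrC -lerBlDr sub0r lerNl.
  by rewrite -normrN ler_norm.
exact: (ge0_Rintegral_sub_emb x mn).
Qed.

(** Used to show that a continuous function which is positive at one point cannot vanish almost
    everywhere. *)
Lemma box_positive (y : 'rV[R]_n) (e : R) : 0 < e -> exists A : set (Rsp R n),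
  [/\ measurable A, (0 < lam R n A)%E & forall v, A v -> forall i, `|y ord0 i - emb v ord0 i| < e].
Proof.
move=> e0; elim: n y => [|m IH] y.
  exists setT; split => //; last by move=> v _ [].
  by rewrite /= diracT lte_fin.
have [A [mA A0 Ay]] := IH (@rsubmx R 1 1 m y).
pose I := `](y ord0 ord0 - e), (y ord0 ord0 + e)[%classic : set (measurableTypeR R).
have mI : measurable I by exact: measurable_itv.
exists (I `*` A); split.
- exact: measurableX mI mA.
- rewrite (_ : lam R m.+1 _ = lebesgue_measure I * lam R m A)%E; last exact: product_measure1E.
  rewrite mule_gt0// /I.
  have := @lebesgue_measure_itv R `](y ord0 ord0 - e), (y ord0 ord0 + e)[.
  rewrite /= lte_fin (_ : _ - e < _ + e) => [->|]; last by lra.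
  by rewrite -EFinB lte_fin; lra.
- move=> [x v] [Ix Av] i; case: (@split_ordP 1 m i) => j ->.
    have -> : emb ((x, v) : Rsp R m.+1) ord0 (lshift m j) = x.
      by apply: etrans (row_mxEl _ _ _ _) _; rewrite mxE [j]ord1 eqxx mulr1n.
    have -> : lshift m j = ord0 by apply/val_inj; rewrite /= [j]ord1.
    by move: Ix; rewrite /I/= in_itv/= ltr_norml => /andP[h1 h2]; apply/andP; split; lra.
  have -> : emb ((x, v) : Rsp R m.+1) ord0 (rshift 1 j) = emb v ord0 j by exact: row_mxEr.
  by have := Ay v Av j; rewrite mxE.
Qed.

End reflection.

Section average.
Context {R : realType} (n : nat) (B : 'rV[R]_n -> R).
Context (hB : is_bessel_kernel B).
Implicit Types (phi psi : 'rV[R]_n -> R) (x : 'rV[R]_n).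

Definition avg phi : R := \int[lam R n]_v (B (emb v) * phi (emb v)).

Definition expw (z : 'rV[R]_n) : R := expR (enorm z / 2).

(** The growth rate 1/2 is the one allowed by the exponential moment [integrable_kernel_exp]. *)
Definition adm phi := continuous phi /\ exists C, forall z, `|phi z| <= C * expw z.

Lemma kernel_ae_ge0 : {ae lam R n, forall v, 0 <= B (emb v)}.
Proof.
have [c c0 h] := kernel_lower hB; apply: filterS h => v; apply: le_trans.
by rewrite mulr_ge0 ?expR_ge0// ltW.
Qed.

Lemma adm_measurable phi : adm phi -> rV_measurable phi.
Proof. by move=> [+ _]; exact: continuous_rV_measurable. Qed.

Lemma integrable_avg phi (C : R) : rV_measurable phi -> (forall z, `|phi z| <= C * expw z) ->
  (lam R n).-integrable setT (EFin \o (fun v => B (emb v) * phi (emb v))).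
Proof.
move=> mphi phiC.
apply: (integrable_norm_le (integrable_mulr C (integrable_norm (integrable_kernel_exp hB)))).
  by apply: measurable_funM; [exact: measurable_kernel|exact: rV_measurable_emb].
move=> v /=; rewrite !normrM mulrCA [X in _ <= _ * (_ * X)]ger0_norm ?expR_ge0//.
by rewrite ler_wpM2l.
Qed.

Lemma adm_integrable phi : adm phi ->
  (lam R n).-integrable setT (EFin \o (fun v => B (emb v) * phi (emb v))).
Proof. by move=> ap; have [_ [C hC]] := ap; exact: integrable_avg (adm_measurable ap) hC. Qed.

Lemma admZ a phi : adm phi -> adm (fun z => a * phi z).
Proof.
move=> [c1 [C1 h1]]; split; first exact: continuous_mulr (@continuous_cstr _ _ a) c1.
by exists (`|a| * C1) => z; rewrite normrM -mulrA ler_wpM2l.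
Qed.

Lemma adm_cst a : adm (fun=> a).
Proof.
split; first exact: continuous_cstr.
exists `|a| => z; rewrite ler_peMr// /expw -expR0 ler_expR divr_ge0//; exact: enorm_ge0.
Qed.

Lemma avgD phi psi : adm phi -> adm psi -> avg (fun z => phi z + psi z) = avg phi + avg psi.
Proof.
move=> a1 a2; rewrite /avg -RintegralD//; [|exact: adm_integrable|exact: adm_integrable].
by apply: eq_Rintegral => v _; rewrite mulrDr.
Qed.

Lemma avgZ a phi : adm phi -> avg (fun z => a * phi z) = a * avg phi.
Proof.
move=> a1; rewrite /avg -RintegralZl//; last exact: adm_integrable.
by apply: eq_Rintegral => v _; rewrite mulrCA.
Qed.

Lemma avg1 : avg (fun=> 1) = 1.
Proof.
have [_ _ Bc _] := hB; have := Bc 0; rewrite enorm0 expr0n/= addr0 invr1 => h; rewrite -[RHS]h.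
have E v : edot v 0 = 0 :> R by rewrite /edot big1// => i _; rewrite mxE mulr0.
rewrite RintE; last first.
  have := integrable_kernel hB; apply: eq_integrable => // v _ /=.
  by rewrite E cos0 mulr1.
by apply: eq_Rintegral => v _; rewrite E cos0.
Qed.

Lemma le_avg_integrable phi psi :
  (lam R n).-integrable setT (EFin \o (fun v => B (emb v) * phi (emb v))) ->
  (lam R n).-integrable setT (EFin \o (fun v => B (emb v) * psi (emb v))) ->
  (forall z, phi z <= psi z) -> avg phi <= avg psi.
Proof.
move=> i1 i2 h; rewrite -subr_ge0 -RintegralB//.
have mB := integrable_measurable (integrable_subr i2 i1).
rewrite (@Rintegral_ae_eq _ _ _ _ _ (fun v => `|B (emb v) * psi (emb v) - B (emb v) * phi (emb v)|)).
- exact: Rintegral_ge0.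
- exact: mB.
- exact: measurableT_comp.
- apply: filterS kernel_ae_ge0 => v b0.
  by rewrite ger0_norm// subr_ge0 ler_wpM2l.
Qed.

Lemma le_avg phi psi : adm phi -> adm psi -> (forall z, phi z <= psi z) -> avg phi <= avg psi.
Proof. by move=> a1 a2; apply: le_avg_integrable; exact: adm_integrable. Qed.

Lemma avg_dct (phi_ : nat -> 'rV[R]_n -> R) phi (C : R) : (forall k, continuous (phi_ k)) ->
  (forall k z, `|phi_ k z| <= C * expw z) -> (forall z, phi_ k z @[k --> \oo] --> phi z) ->
  avg (phi_ k) @[k --> \oo] --> avg phi.
Proof.
move=> cphi phiC phik.
apply: (Rintegral_dct (integrable_mulr C (integrable_norm (integrable_kernel_exp hB)))).
- move=> k; apply: measurable_funM; first exact: measurable_kernel.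
  exact: rV_measurable_emb (continuous_rV_measurable (cphi k)).
- move=> k v /=; rewrite !normrM mulrCA [X in _ <= _ * (_ * X)]ger0_norm ?expR_ge0//.
  by rewrite ler_wpM2l.
- by move=> v; apply: cvgMr; exact: phik.
Qed.

(** The substitution of x - y for y moves the translation from the kernel onto the function: all
    convolutions become averages against one fixed density, with no regularity asked of [B]. *)
Lemma conv_avg phi x : adm (fun z => phi (x - z)) -> Defs.conv B phi x = avg (fun z => phi (x - z)).
Proof.
move=> ap; have ai := adm_integrable ap.
pose g z := B z * phi (x - z).
have mg : rV_measurable g.
  have [mB _ _ _] := hB; apply: measurable_funM; first exact: mB.
  exact: (adm_measurable ap).
have gE : (fun y => B (x - y) * phi y) = (fun y => g (x - y)).
  by apply/funext => y; rewrite /g opprB addrCA subrr addr0.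
rewrite /Defs.conv gE RintE; last exact: integrable_sub_emb.
by rewrite (Rintegral_sub_emb x mg ai).
Qed.

Definition gfun (a : R) (z : 'rV[R]_n) : R := expR (- (a * enorm z ^+ 2)).

Lemma continuous_gfun a : continuous (gfun a).
Proof.
apply: continuous_compr (@continuous_expR R); apply: continuous_oppr.
apply: continuous_mulr; first exact: continuous_cstr.
exact: continuous_compr (@continuous_enorm R n) (@exprn_continuous R 2).
Qed.

Lemma gfun_gauss a z : 0 < a ->
  gfun a z = (Num.sqrt (4 * pi * (4 * a)^-1)) ^+ n * gauss (4 * a)^-1 z.
Proof.
move=> a0; have a40 : 0 < (4 * a)^-1 by rewrite invr_gt0 mulr_gt0.
rewrite gaussE// exprVn mulVKf; last by rewrite expf_neq0// gt_eqF// sqrtr_gt0 !mulr_gt0// pi_gt0.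
by congr expR; field; rewrite gt_eqF.
Qed.

Lemma integrable_gfun a : 0 < a -> (lam R n).-integrable setT (EFin \o (fun v => gfun a (emb v))).
Proof.
move=> a0; have := integrable_mulr ((Num.sqrt (4 * pi * (4 * a)^-1)) ^+ n) (integrable_gauss n (4 * a)^-1).
by apply: eq_integrable => // v _ /=; rewrite gfun_gauss.
Qed.

Lemma integral_gfun_gt0 a : 0 < a -> 0 < \int[lam R n]_v gfun a (emb v).
Proof.
move=> a0; under eq_Rintegral do rewrite gfun_gauss//.
rewrite RintegralZl//; last exact: integrable_gauss.
have a40 : 0 < (4 * a)^-1 by rewrite invr_gt0 mulr_gt0.
have := fourier_gauss (n := n) 0 0 a40; rewrite enorm0 expr0n/= mulr0 oppr0 expR0 cos0 mulr1.
rewrite (@eq_Rintegral _ _ _ _ _ (fun v => gauss (4 * a)^-1 (emb v))) => [->|v _].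
  by rewrite mulr1 exprn_gt0// sqrtr_gt0 !mulr_gt0// pi_gt0.
by rewrite addr0 (_ : edot _ _ = 0) ?cos0 ?mulr1// /edot big1// => i _; rewrite mxE mulr0.
Qed.

Lemma avg_lower : exists2 c : R, 0 < c & forall phi, adm phi -> (forall z, 0 <= phi z) ->
  (lam R n).-integrable setT (EFin \o (fun v => gfun 4^-1 (emb v) * phi (emb v))) /\
  c * \int[lam R n]_v (gfun 4^-1 (emb v) * phi (emb v)) <= avg phi.
Proof.
have [c c0 hc] := kernel_lower hB; exists c => // phi ap p0.
have ai := adm_integrable ap; have mp := rV_measurable_emb (adm_measurable ap).
have mg : measurable_fun setT (fun v : Rsp R n => gfun 4^-1 (emb v)).
  exact: rV_measurable_emb (continuous_rV_measurable (@continuous_gfun _)).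
have ie : {ae lam R n, forall v, c * (gfun 4^-1 (emb v) * phi (emb v)) <= B (emb v) * phi (emb v)}.
  apply: filterS hc => v; rewrite mulrA => hv; rewrite ler_wpM2r// (le_trans _ hv)//.
  by rewrite /gfun mulNr [4^-1 * _]mulrC.
have gi : (lam R n).-integrable setT (EFin \o (fun v => gfun 4^-1 (emb v) * phi (emb v))).
  apply/integrableP; split; first by apply/measurable_EFinP; exact: measurable_funM.
  have /integrableP[_] := integrable_mulr c^-1 ai; apply: le_lt_trans.
  apply: ae_ge0_le_integral => //.
  - by apply: measurableT_comp => //; apply/measurable_EFinP; exact: measurable_funM.
  - apply: measurableT_comp => //; apply/measurable_EFinP; apply: measurable_funM => //.
    exact: integrable_measurable ai.
  apply: filterS ie => v hv _ /=; rewrite lee_fin !normrM (ger0_norm (p0 _)) ger0_norm ?expR_ge0//.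
  rewrite [`|c^-1|]gtr0_norm ?invr_gt0// ler_pdivlMl// (le_trans hv)//.
  by rewrite ler_wpM2r// ler_norm.
split => //; rewrite -RintegralZl// -subr_ge0 -RintegralB//; last exact: (integrable_mulr c gi).
have mm := integrable_measurable (integrable_subr ai (integrable_mulr c gi)).
rewrite (@Rintegral_ae_eq _ _ _ _ _ (fun v => `|B (emb v) * phi (emb v) - c * (gfun 4^-1 (emb v) * phi (emb v))|)).
- exact: Rintegral_ge0.
- exact: mm.
- exact: measurableT_comp.
- by apply: filterS ie => v hv; rewrite ger0_norm// subr_ge0.
Qed.

(** The half spaces z.x <= 0 and z.x >= 0 are exchanged by z |-> - z and cover everything, so each
    carries at least half of the Gaussian mass. The bound is thus uniform in the direction of
    [x]. *)
Lemma avg_half_space (a : R) : 0 <= a -> exists2 k : R, 0 < k & forall (x : 'rV[R]_n) phi,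
  adm phi -> (forall z, 0 <= phi z) ->
  (forall z, edot z x <= 0 -> gfun a z <= phi z) -> k <= avg phi.
Proof.
move=> a0; have [c c0 hc] := avg_lower.
have a4 : 0 < a + 4^-1 by rewrite ltr_wpDl.
pose J := \int[lam R n]_v gfun (a + 4^-1) (emb v).
have J0 : 0 < J by exact: integral_gfun_gt0.
exists (c * (J / 2)); first by rewrite mulr_gt0// divr_gt0.
move=> x phi ap p0 hphi; have [gi hi] := hc phi ap p0; apply: le_trans hi; rewrite ler_pM2l//.
pose H (z : 'rV[R]_n) : R := gfun (a + 4^-1) z * (edot z x <= 0)%R%:R.
have mle : rV_measurable (fun z : 'rV[R]_n => (edot z x <= 0)%R%:R : R).
  apply: measurableT_comp => //.
  rewrite /rV_measurable.
  apply: measurable_fun_ler => //; apply: measurable_sum => i; apply: measurable_funM => //.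
  by under eq_fun do rewrite mxE; exact: measurable_tnth.
have mgf : rV_measurable (gfun (a + 4^-1)) by exact: continuous_rV_measurable (@continuous_gfun _).
have mH : rV_measurable H by exact: measurable_funM.
have gfi := integrable_gfun a4.
have Hi : (lam R n).-integrable setT (EFin \o (fun v => H (emb v))).
  apply: (integrable_mul_bounded (h := fun v => (edot (emb v) x <= 0)%R%:R) gfi (C := 1)) => [|v].
    exact: (rV_measurable_emb mle).
  by rewrite ger0_norm// lern1 leq_b1.
have gE z : gfun 4^-1 z * gfun a z = gfun (a + 4^-1) z by rewrite /gfun -expRD; congr expR; ring.
apply: le_trans (_ : \int[lam R n]_v H (emb v) <= _); last first.
  apply: le_Rintegral => // v _; rewrite /H -gE -mulrA ler_wpM2l ?expR_ge0//.
  by case: (leP (edot _ _) 0) => h; rewrite ?mulr1 ?mulr0// hphi.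
have HN : \int[lam R n]_v H (- emb v) = \int[lam R n]_v H (emb v).
  by rewrite -[RHS](ge0_Rintegral_sub_emb 0 mH) => [|z]; [apply: eq_Rintegral => v _; rewrite sub0r|
    rewrite mulr_ge0 ?expR_ge0].
have HNi : (lam R n).-integrable setT (EFin \o (fun v => H (- emb v))).
  by have := integrable_sub_emb 0 mH Hi; under eq_fun do rewrite sub0r.
rewrite ler_pdivrMr// mulr_natr mulr2n -{1}HN -RintegralD//.
apply: le_Rintegral => //; first exact: (integrable_addr HNi Hi).
move=> v _; rewrite /H; set g := gfun _ (emb v).
have -> : gfun (a + 4^-1) (- emb v) = g by rewrite /g /gfun enormN.
have -> : edot (- emb v) x = - edot (emb v) x.
  by rewrite /edot -sumrN; apply: eq_bigr => i _; rewrite mxE mulNr.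
have g0 : 0 <= g by exact: expR_ge0.
rewrite -mulrDr ler_peMr// oppr_le0 -natrD ler1n.
by case: (leP (edot (emb v) x) 0) => h; rewrite ?addn1// ltW.
Qed.

(** |x - y|^2 <= 2 |x|^2 + 2 |y|^2 splits the Gaussian below the kernel into a factor in [x] and a
    factor in [y]; the latter has a positive integral against [u], which is continuous, nonnegative
    and not identically 0. *)
Lemma avg_translate_lower (u : 'rV[R]_n -> R) : (forall x, adm (fun z => u (x - z))) ->
  continuous u -> (forall y, 0 <= u y) -> (exists y, u y != 0) ->
  exists2 A0 : R, 0 < A0 & forall x, A0 * gfun 2^-1 x <= avg (fun z => u (x - z)).
Proof.
move=> au cu u0 [y0 uy0]; have [c c0 hc] := avg_lower.
have mu := continuous_rV_measurable cu.
have mgf a : rV_measurable (gfun a) by exact: continuous_rV_measurable (@continuous_gfun _).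
have g0 a z : 0 <= gfun a z by exact: expR_ge0.
pose F (y : 'rV[R]_n) := gfun 2^-1 y * u y.
have cF : continuous F by apply: continuous_mulr => //; exact: continuous_gfun.
have F0 y : 0 <= F y by rewrite mulr_ge0.
have key x y : gfun 2^-1 x * F y <= gfun 4^-1 (x - y) * u y.
  rewrite /F mulrA ler_wpM2r// /gfun -expRD ler_expR.
  have h : enorm (x - y) ^+ 2 <= (enorm x + enorm y) ^+ 2.
    by rewrite lerXn2r ?nnegrE ?addr_ge0 ?enorm_ge0// ler_enormB.
  by have := sqr_ge0 (enorm x - enorm y); nra.
have Gi x : (lam R n).-integrable setT (EFin \o (fun v => gfun 4^-1 (x - emb v) * u (emb v))).
  have [gi _] := hc _ (au x) (fun z => u0 _).
  rewrite (_ : (fun v => _) = (fun v : Rsp R n => gfun 4^-1 (x - emb v) * u (x - (x - emb v)))).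
    apply: (@integrable_sub_emb R n (fun z => gfun 4^-1 z * u (x - z)) x _ gi).
    by apply: measurable_funM; [exact: mgf|exact: adm_measurable (au x)].
  by apply/funext => v; rewrite subKr.
have Fi : (lam R n).-integrable setT (EFin \o (fun v => F (emb v))).
  apply: (integrable_norm_le (integrable_mulr (gfun 2^-1 0)^-1 (Gi 0))) => [|v].
    exact: rV_measurable_emb (continuous_rV_measurable cF).
  rewrite ger0_norm// ler_pdivlMl ?expR_gt0//.
exists (c * \int[lam R n]_v F (emb v)).
  rewrite mulr_gt0// lt_neqAle Rintegral_ge0// andbT eq_sym; apply/negP => /eqP I0.
  have Fae : ae_eq (lam R n) setT (EFin \o (fun v => F (emb v))) (cst 0%E).
    apply/(ae_eq_integral_abs _ measurableT); first exact: measurable_int Fi.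
    under eq_integral => v _ do rewrite /= ger0_norm//.
    by rewrite (integrableE Fi) I0.
  have Fy0 : 0 < F y0 by rewrite mulr_gt0 ?expR_gt0// lt_neqAle eq_sym uy0 u0.
  have /cvgrPdist_lt /(_ _ Fy0) := cF y0.
  move=> /nbhs_ballP[e e0 eF].
  have [A [mA A0 Ay]] := box_positive y0 e0.
  have [N [mN N0 NF]] := Fae.
  have AN : A `<=` N.
    move=> v Av; apply: NF => /= /(_ I) [] Fv.
    have : `|F y0 - F (emb v)| < F y0.
      by apply: eF; split => // i j; rewrite [i]ord1; exact: Ay.
    by rewrite Fv subr0 ger0_norm// ltxx.
  have := le_measure (lam R n) (mem_set mA) (mem_set mN) AN.
  by move=> /(lt_le_trans A0); rewrite [X in (_ < X)%E](N0 : _ = 0%E) ltxx.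
move=> x; have [_] := hc _ (au x) (fun z => u0 _); apply: le_trans.
rewrite -mulrA ler_pM2l// mulrC -RintegralZl//.
rewrite -(ge0_Rintegral_sub_emb x (g := fun z => gfun 4^-1 z * u (x - z))); last 2 first.
- by apply: measurable_funM; [exact: mgf|exact: adm_measurable (au x)].
- by move=> y; rewrite mulr_ge0.
under [leRHS]eq_Rintegral do rewrite subKr.
apply: le_Rintegral => //; exact: (integrable_mulr _ Fi).
Qed.

End average.

(** * Real powers and time integrals *)

Section powers.
Context {R : realType}.
Implicit Types x y r s b p : R.

Lemma le_powR_base b x y : 0 <= b -> 0 <= x -> x <= y -> x `^ b <= y `^ b.
Proof.
by move=> b0 x0 xy; apply: ge0_ler_powR; rewrite ?nnegrE// (le_trans x0).
Qed.

Lemma powR_base1 b : 1 `^ b = 1 :> R.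
Proof. by rewrite powR1. Qed.

Lemma powRD_pos x r s : 0 < x -> x `^ (r + s) = x `^ r * x `^ s.
Proof. by move=> x0; rewrite powRD// (gt_eqF x0) implybT. Qed.

Lemma powRD_nneg x r s : 0 <= r -> 0 <= s -> x `^ (r + s) = x `^ r * x `^ s.
Proof.
move=> r0 s0; have [->|xn] := eqVneq x 0; last by rewrite powRD// xn implybT.
have [->|rn] := eqVneq r 0; first by rewrite add0r powRr0 mul1r.
have rp : 0 < r by rewrite lt_neqAle eq_sym rn.
by rewrite [0 `^ r]powR0// mul0r powR0// gt_eqF// ltr_wpDr.
Qed.

Lemma powR_ge_id x p : 0 <= x -> x <= 1 -> 0 <= p -> p <= 1 -> x <= x `^ p.
Proof.
move=> x0 x1 p0 p1; have [->|xn] := eqVneq x 0; first exact: powR_ge0.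
have xp : 0 < x by rewrite lt_neqAle eq_sym xn.
rewrite /powR (negbTE xn) -[leLHS]lnK// ler_expR.
by have := ln_le0 x1; nra.
Qed.

Lemma powR_ge1 x p : 1 <= x -> 0 <= p -> 1 <= x `^ p.
Proof. by move=> x1 p0; rewrite -[leLHS](powR_base1 p) le_powR_base. Qed.

Lemma continuous_maxr0 : continuous (fun r : R => Num.max r 0).
Proof.
move=> r; have -> : (fun r : R => Num.max r 0) = (fun r => 2^-1 * (r + `|r|)).
  apply/funext => s; case: (leP s 0) => s0.
    by rewrite ler0_norm// subrr mulr0.
  by rewrite gtr0_norm//; field.
apply: cvgM; first exact: cvg_cst.
by apply: cvgD; [exact: cvg_id|exact: (@norm_continuous _ R r)].
Qed.

(** For a negative base [powR] takes a conventional value that does not match the limit at 0; the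
    truncation restores continuity on the whole line. *)
Lemma continuous_powR_max b : 0 <= b -> continuous (fun r : R => Num.max r 0 `^ b).
Proof.
rewrite le_eqVlt => /predU1P[<-|b0] r.
  by under eq_fun do rewrite powRr0; exact: cvg_cst.
have [r0|r0] := leP r 0; last first.
  have d := is_derive1_powR b r0.
  have c : {for r, continuous ((@powR R)^~ b)}.
    by apply: differentiable_continuous; apply/derivable1_diffP; have [] := d.
  rewrite /continuous_at (max_l (ltW r0)); apply: cvg_trans c; apply: near_eq_cvg.
  near=> s; rewrite max_l//; apply: ltW; near: s; exact: lt_nbhsr.
rewrite /continuous_at max_r//= powR0 ?gt_eqF//; apply/cvgrPdist_lt => e e0.
have dp : 0 < e `^ b^-1 by exact: powR_gt0.
have rd : \forall s \near r, `|r - s| < e `^ b^-1.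
  by apply/nbhs_ballP; exists (e `^ b^-1).
near=> s; rewrite sub0r normrN ger0_norm ?powR_ge0//.
have -> : e = (e `^ b^-1) `^ b by rewrite -powRrM mulVf ?gt_eqF// powRr1// ltW.
apply: (le_lt_trans (y := `|r - s| `^ b)).
  apply: le_powR_base; [exact: ltW|by rewrite le_max lexx orbT|].
  by rewrite ge_max normr_ge0 andbT distrC (le_trans _ (ler_norm _))//; lra.
apply: gt0_ltr_powR => //; rewrite ?nnegrE//; first exact: ltW.
Unshelve. all: by end_near. Qed.

(** Young's inequality for r^p and 1 with conjugate exponents 1/p and 1/(1 - p): the concave power
    lies below its tangent at 1. *)
Lemma bernoulli_powR p r : 0 < p -> p < 1 -> 0 <= r -> r `^ p <= p * r + 1 - p.
Proof.
move=> p0 p1 r0.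
have h := @conjugate_powR R (r `^ p) 1 p^-1 (1 - p)^-1 (powR_ge0 _ _) ler01.
move: h; rewrite !invr_gt0 !invrK subr_gt0 mulr1 powR_base1 -powRrM divff ?gt_eqF// powRr1// mul1r.
by move=> /(_ p0 p1) h; have := h (ltac:(ring)); rewrite mulrC; lra.
Qed.

(** By homogeneity the larger number may be taken to be 1. Then s <= s^p and 1 - s <= (1 - s)^p add
    up to 1 <= s^p + (1 - s)^p. *)
Lemma ler_powR_dist p x y : 0 < p -> p < 1 -> 0 <= x -> 0 <= y ->
  `|x `^ p - y `^ p| <= `|x - y| `^ p.
Proof.
move=> p0 p1; wlog yx : x y / y <= x => [hw x0 y0|x0 y0].
  have [yx|/ltW xy] := leP y x; first exact: hw.
  by rewrite distrC [`|x - y|]distrC; exact: hw.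
have yxp : y `^ p <= x `^ p by apply: le_powR_base => //; exact: ltW.
rewrite !ger0_norm ?subr_ge0//.
have [->|xn] := eqVneq x 0; first by rewrite powR0 ?gt_eqF// (le_trans _ (powR_ge0 _ _))// sub0r oppr_le0 powR_ge0.
have xp : 0 < x by rewrite lt_neqAle eq_sym xn.
pose s := y / x.
have s0 : 0 <= s by rewrite divr_ge0.
have s1 : s <= 1 by rewrite ler_pdivrMr// mul1r.
have -> : y = s * x by rewrite /s divfK.
have -> : x - s * x = (1 - s) * x by ring.
rewrite (powRM p s0 x0) (@powRM _ (1 - s) x) ?subr_ge0//; rewrite -{1}[x `^ p]mul1r -mulrBl ler_wpM2r ?powR_ge0//.
have := powR_ge_id s0 s1 (ltW p0) (ltW p1).
have := @powR_ge_id (1 - s) p; rewrite subr_ge0 s1 => /(_ isT); rewrite (ltW p0) (ltW p1) => h.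
by have := h (ltac:(lra)) isT isT; lra.
Qed.

(** The tangent inequality at the smaller of the two numbers, rescaled from 1; the slope decreases
    with the base point, so a common lower bound [k] may replace it. *)
Lemma ler_powR_lip p x y k : 0 < p -> p < 1 -> 0 < k -> k <= x -> k <= y ->
  `|x `^ p - y `^ p| <= p * k `^ (p - 1) * `|x - y|.
Proof.
move=> p0 p1 k0; wlog yx : x y / y <= x => [hw kx ky|kx ky].
  have [yx|/ltW xy] := leP y x; first exact: hw.
  by rewrite distrC [`|x - y|]distrC; exact: hw.
have y0 : 0 < y by exact: lt_le_trans ky.
have yxp : y `^ p <= x `^ p by apply: le_powR_base => //; exact: ltW.
rewrite !ger0_norm ?subr_ge0//.
have h := bernoulli_powR p0 p1 (divr_ge0 (ltW (lt_le_trans y0 yx)) (ltW y0)).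
have xE : x = (x / y) * y by rewrite divfK// gt_eqF.
have -> : x `^ p = (x / y) `^ p * y `^ p.
  by rewrite {1}xE powRM//; [rewrite divr_ge0// ltW// (lt_le_trans y0)|exact: ltW].
have yE : y `^ p = y * y `^ (p - 1) by rewrite mulr_powRB1// ltW.
have q0 : 0 <= y `^ (p - 1) by exact: powR_ge0.
apply: (@le_trans _ _ (p * y `^ (p - 1) * (x - y))).
  have -> : p * y `^ (p - 1) * (x - y) = p * (x / y - 1) * (y `^ p).
    by rewrite yE; field; rewrite gt_eqF.
  by have := powR_ge0 y p; nra.
rewrite ler_wpM2r ?subr_ge0// ler_wpM2l ?(ltW p0)//.
rewrite -[p - 1]opprB !powRN lef_pV2 ?posrE ?powR_gt0//.
by apply: le_powR_base => //; [rewrite subr_ge0 ltW|exact: ltW].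
Qed.

(** Scaling by 1 + 2 b before applying 1 + s <= exp(s) lowers the exponential rate to b / (1 + 2 b),
    which is below the admissible 1/2. *)
Lemma powR_le_expR b : 0 <= b -> exists2 C : R, 0 < C & forall r, 0 <= r -> (1 + r) `^ b <= C * expR (r / 2).
Proof.
move=> b0; exists ((1 + 2 * b) `^ b); first by rewrite powR_gt0//; lra.
move=> r r0; have c0 : 0 < 1 + 2 * b by lra.
apply: (@le_trans _ _ (((1 + 2 * b) * (1 + r / (1 + 2 * b))) `^ b)).
  apply: le_powR_base => //; first by lra.
  by rewrite mulrDr mulr1 mulrCA divff ?gt_eqF// mulr1; lra.
have d0 : 0 <= r / (1 + 2 * b) by rewrite divr_ge0// ltW.
rewrite powRM; [|exact: ltW|by rewrite addr_ge0].
rewrite ler_pM2l ?powR_gt0//.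
apply: (@le_trans _ _ (expR (r / (1 + 2 * b)) `^ b)).
  by apply: le_powR_base => //; [rewrite addr_ge0|exact: expR_ge1Dx].
rewrite -expRM ler_expR mulrAC ler_pdivrMr//; nra.
Qed.

End powers.

(** Reduces continuity to sequences, for which dominated convergence is available; confining them to
    the neighbourhood [P] provides a common majorant. *)
Lemma continuous_seq {R : realType} {U : pseudoMetricType R} (f : U -> R) (x : U) (P : set U) :
  nbhs x P ->
  (forall u : nat -> U, u k @[k --> \oo] --> x -> (forall k, P (u k)) -> f (u k) @[k --> \oo] --> f x) ->
  {for x, continuous f}.
Proof.
move=> xP H; apply/cvgrPdist_lt => e e0; apply: contrapT => nh.
have ex k : exists y, [/\ P y, ball x (k.+1%:R^-1) y & e <= `|f x - f y|].
  apply: contrapT => nex; apply: nh.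
  have : nbhs x (P `&` ball x (k.+1%:R^-1)).
    by apply: filterI => //; apply: nbhsx_ballx; rewrite invr_gt0.
  apply: filterS => y [Py By]; rewrite ltNge; apply/negP => ey; apply: nex.
  by exists y.
have [u hu] := choice ex.
have ux : u k @[k --> \oo] --> x.
  apply/cvg_ballP => d d0.
  near=> k; have [_ + _] := hu k; apply: le_ball.
  near: k; have /cvgrPdist_le /(_ _ d0) := @cvg_harmonic R.
  by apply: filterS => k; rewrite sub0r normrN ger0_norm// invr_ge0.
have := H u ux (fun k => let: And3 h _ _ := hu k in h).
move=> /cvgrPdist_lt /(_ _ e0) /filter_ex[k].
by have [_ _ h] := hu k; rewrite ltNge h.
Unshelve. all: by end_near. Qed.

Section time_integral.
Context {R : realType}.
Implicit Types (g h : R -> R) (s t : R).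

Lemma int0E t g : int0 t g = \int[@lebesgue_measure R]_(tau in `[0, t]) g tau.
Proof. by []. Qed.

Lemma integrable_int0 t g : continuous g ->
  (@lebesgue_measure R).-integrable `[0, t]%classic (EFin \o g).
Proof.
move=> cg; apply: continuous_compact_integrable; first exact: segment_compact.
exact: continuous_subspaceT.
Qed.

Lemma eq_int0 t g h : (forall s, 0 <= s -> s <= t -> g s = h s) -> int0 t g = int0 t h.
Proof.
move=> gh; rewrite !int0E; apply: eq_Rintegral => s; rewrite inE/= in_itv/= => /andP[s0 st].
exact: gh.
Qed.

Lemma int0_le0 t g : t <= 0 -> int0 t g = 0.
Proof.
rewrite int0E le_eqVlt => /predU1P[->|t0]; first by rewrite set_itv1 Rintegral_set1.
by rewrite set_itv_ge ?Rintegral_set0// bnd_simp -ltNge.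
Qed.

Lemma le_int0 t g h : continuous g -> continuous h ->
  (forall s, 0 <= s -> s <= t -> g s <= h s) -> int0 t g <= int0 t h.
Proof.
move=> cg ch gh; rewrite !int0E; apply: le_Rintegral => //; [exact: integrable_int0..|].
by move=> s /=; rewrite in_itv/= => /andP[]; exact: gh.
Qed.

Lemma int0D t g h : continuous g -> continuous h ->
  int0 t (fun s => g s + h s) = int0 t g + int0 t h.
Proof. by move=> cg ch; rewrite !int0E RintegralD//; exact: integrable_int0. Qed.

Lemma int0Z t c g : continuous g -> int0 t (fun s => c * g s) = c * int0 t g.
Proof. by move=> cg; rewrite !int0E RintegralZl//; exact: integrable_int0. Qed.

Lemma int0B t g h : continuous g -> continuous h ->
  int0 t (fun s => g s - h s) = int0 t g - int0 t h.
Proof. by move=> cg ch; rewrite !int0E RintegralB//; exact: integrable_int0. Qed.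

Lemma int0_cst t c : 0 <= t -> int0 t (fun=> c) = c * t.
Proof.
move=> t0; rewrite int0E Rintegral_cst//.
have := @lebesgue_measure_itv R `[0, t]; rewrite /= lte_fin.
move: t0; rewrite le_eqVlt => /predU1P[<-|t0]; first by rewrite ltxx => ->.
by rewrite t0 => ->; rewrite /= subr0.
Qed.

Lemma int0_ge0 t g : (forall s, 0 <= s -> s <= t -> 0 <= g s) -> 0 <= int0 t g.
Proof.
move=> g0; rewrite int0E; apply: Rintegral_ge0 => // s /=.
by rewrite in_itv/= => /andP[]; exact: g0.
Qed.

Lemma norm_int0 t g : continuous g -> `|int0 t g| <= int0 t (fun s => `|g s|).
Proof. by move=> cg; rewrite !int0E le_normr_Rintegral//; exact: integrable_int0. Qed.

Lemma norm_int0_le t g h : continuous g -> continuous h ->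
  (forall s, 0 <= s -> s <= t -> `|g s| <= h s) -> `|int0 t g| <= int0 t h.
Proof.
move=> cg ch gh; apply: le_trans (norm_int0 _ cg) _; apply: le_int0 => //.
by move=> x; apply: continuous_comp; [exact: cg|exact: norm_continuous].
Qed.

Lemma int0_lip s t g K : continuous g -> 0 <= s -> s <= t ->
  (forall r, 0 <= r -> r <= t -> `|g r| <= K) -> `|int0 t g - int0 s g| <= K * (t - s).
Proof.
move=> cg s0 st gK.
have gi : (@lebesgue_measure R).-integrable `]s, t]%classic (EFin \o g).
  apply: (integrableS _ _ _ (integrable_int0 t cg)) => // r /=.
  by rewrite !in_itv/= => /andP[sr ->]; rewrite (le_trans s0)// ltW.
rewrite !int0E (Rintegral_itvB (integrable_int0 _ cg))// ?bnd_simp//.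
apply: le_trans (le_normr_Rintegral _ gi) _ => //.
apply: (@le_trans _ _ (\int[@lebesgue_measure R]_(r in `]s, t]) K)).
  apply: le_Rintegral => //.
  - exact: integrable_norm gi.
  - apply: (integrableS _ _ _ (integrable_int0 t (@continuous_cstr _ _ K))) => // r /=.
    by rewrite !in_itv/= => /andP[sr ->]; rewrite (le_trans s0)// ltW.
  - move=> r /=; rewrite in_itv/= => /andP[sr rt]; apply: gK => //.
    by rewrite (le_trans s0)// ltW.
rewrite Rintegral_cst//.
have := @lebesgue_measure_itv R `]s, t]; rewrite /= lte_fin.
move: st; rewrite le_eqVlt => /predU1P[->|st].
  by rewrite ltxx => ->; rewrite subrr mulr0.
by rewrite st => ->.
Qed.

Lemma int0_dct t (g_ : nat -> R -> R) g C : (forall k, continuous (g_ k)) ->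
  (forall k s, 0 <= s -> s <= t -> `|g_ k s| <= C) ->
  (forall s, 0 <= s -> s <= t -> g_ k s @[k --> \oo] --> g s) ->
  int0 t (g_ k) @[k --> \oo] --> int0 t g.
Proof.
move=> cg gC gk; pose I := `[0, t]%classic : set (measurableTypeR R).
have pE h : (h \_ I) = (fun s => h s * \1_I s).
  by apply/funext => s; rewrite /patch indicE; case: ifP => _; rewrite ?mulr1 ?mulr0.
have iE h : int0 t h = \int[@lebesgue_measure R]_s (h s * \1_I s).
  by rewrite int0E Rintegral_mkcond -pE.
rewrite iE; under eq_fun do rewrite iE.
apply: (@Rintegral_dct _ (measurableTypeR R) _ lebesgue_measure _ _ (fun s => C * \1_I s)).
- have := integrable_int0 t (@continuous_cstr _ _ C).
  move=> /integrable_mkcond; rewrite restrict_EFin pE; apply.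
  exact: measurable_itv.
- move=> k; apply: measurable_funM; last by apply: measurable_indic; exact: measurable_itv.
  exact: continuous_measurable_fun.
- move=> k s; rewrite indicE; case: (boolP (s \in I)) => [|_]; last by rewrite !mulr0 normr0.
  by rewrite inE /I/= in_itv/= => /andP[s0 st]; rewrite !mulr1 gC.
- move=> s; rewrite indicE; case: (boolP (s \in I)) => [|_].
    rewrite inE /I/= in_itv/= => /andP[s0 st]; rewrite mulr1.
    by under eq_fun do rewrite mulr1; exact: gk.
  by rewrite mulr0; under eq_fun do rewrite mulr0; exact: cvg_cst.
Qed.

Lemma locally_bounded g T : continuous g -> exists2 C, 0 < C & forall s, 0 <= s -> s <= T -> `|g s| <= C.
Proof.
move=> cg; have [T0|T0] := leP 0 T; last by exists 1 => // s s0 sT; move: (le_trans s0 sT); rewrite leNgt T0.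
have cn : continuous (fun s => `|g s|).
  by move=> x; apply: continuous_comp; [exact: cg|exact: norm_continuous].
have [c _ hc] := EVT_max T0 (continuous_subspaceT cn).
exists (`|g c| + 1); first by rewrite ltr_wpDl.
by move=> s s0 sT; rewrite (le_trans (hc s _)) ?lerDl// in_itv/= s0.
Qed.

Lemma continuous_int0 g : continuous g -> continuous (int0 (R := R) ^~ g).
Proof.
move=> cg t; have [C C0 gC] := locally_bounded (t + 1) cg.
have key s r : s <= r -> r <= t + 1 -> `|int0 r g - int0 s g| <= C * (r - s).
  move=> sr rt; have [s0|s0] := leP 0 s.
    by apply: int0_lip => // q q0 qr; apply: gC => //; exact: le_trans rt.
  rewrite (int0_le0 g (ltW s0)) -(int0_le0 g (lexx 0)).
  have [r0|r0] := leP 0 r; last first.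
    rewrite (int0_le0 g (ltW r0)) int0_le0// subrr normr0 mulr_ge0 ?subr_ge0//; exact: ltW.
  apply: le_trans (int0_lip (K := C) cg (lexx 0) r0 _) _ => [q q0 qr|].
    by apply: gC => //; exact: le_trans rt.
  by rewrite ler_pM2l//; lra.
apply/cvgrPdist_lt => e e0; near=> s.
have h : C * `|t - s| < e.
  rewrite mulrC -ltr_pdivlMr//; near: s.
  by apply: (@cvgr_dist_lt _ _ _ _ _ id _ cvg_id); exact: divr_gt0.
have st : s <= t + 1 by apply: ltW; near: s; apply: lt_nbhsl; rewrite ltrDl.
apply: le_lt_trans h; have [ts|ts] := leP s t.
  by rewrite [X in _ <= _ * X]ger0_norm ?subr_ge0//; apply: key => //; lra.
by rewrite distrC [X in _ <= _ * X]distrC [X in _ <= _ * X]gtr0_norm ?subr_gt0//; apply: key => //; exact: ltW.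
Unshelve. all: by end_near. Qed.

Lemma le_int0_mono g s t : continuous g -> (forall r, 0 <= g r) -> s <= t -> int0 s g <= int0 t g.
Proof.
move=> cg g0 st; have [s0|s0] := leP 0 s; last first.
  by rewrite int0_le0 ?(ltW s0)//; apply: int0_ge0.
rewrite -subr_ge0 !int0E (Rintegral_itvB (integrable_int0 _ cg))// ?bnd_simp//.
exact: Rintegral_ge0.
Qed.

(** The integrand is the derivative of L^(b+1) / (b+1) with L' = g. As L vanishes at 0, the power is
    differentiated on the open interval only, and continuity covers the endpoints. *)
Lemma int0_powR g b t : continuous g -> (forall s, 0 <= g s) -> (forall s, 0 < s -> 0 < int0 s g) ->
  0 <= b -> int0 t (fun s => g s * int0 s g `^ b) = int0 t g `^ (b + 1) / (b + 1).
Proof.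
move=> cg g0 L0 b0; have b1 : 0 < b + 1 by rewrite ltr_wpDl.
pose L s := int0 s g.
have cL : continuous L by exact: continuous_int0.
have Lge s : 0 <= L s by exact: int0_ge0.
have cLp c : 0 <= c -> continuous (fun s => L s `^ c).
  move=> c0; rewrite (_ : (fun s => _) = (fun s => Num.max (L s) 0 `^ c)).
    exact: continuous_compr cL (continuous_powR_max c0).
  by apply/funext => s; rewrite max_l.
have [t0|t0] := leP t 0; first by rewrite !int0_le0// powR0 ?mul0r// gt_eqF.
pose F s := L s `^ (b + 1) / (b + 1).
have cF : continuous F by apply: continuous_mulr; [exact/cLp/ltW|exact: continuous_cstr].
have dF s : s \in `]0, t[ -> is_derive s (1 : R) F (g s * L s `^ b).
  rewrite in_itv/= => /andP[s0 st].
  have [dL dLE] := continuous_FTC1_closed st (integrable_int0 _ cg) s0 (cg s).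
  have dLs : is_derive s (1 : R) L (g s).
    by split; [exact: dL|rewrite -derive1E; exact: dLE].
  have dp := is_derive1_powR (b + 1) (L0 _ s0).
  have := is_derive1_comp dp dLs => dc.
  have dM : is_derive s (1 : R) (fun s => (b + 1)^-1 *: (L s `^ (b + 1))) ((b + 1)^-1 *: ((b + 1) * L s `^ (b + 1 - 1) * g s)).
    exact: is_deriveZ.
  rewrite (_ : F = (fun s => (b + 1)^-1 *: (L s `^ (b + 1)))); last by apply/funext => r; rewrite /F mulrC.
  apply: is_derive_eq; rewrite /GRing.scale/= addrK; field; exact: lt0r_neq0.
have FTC := @continuous_FTC2 R (fun s => g s * L s `^ b) F 0 t t0.
have F0 : F 0 = 0 by rewrite /F /L int0_le0// powR0 ?mul0r// gt_eqF.
rewrite int0E /Rintegral FTC.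
- by rewrite F0 /= subr0.
- by apply: continuous_subspaceT; apply: continuous_mulr => //; exact: cLp.
- split => [s /dF[]//| |].
    by apply: cvg_at_right_filter; exact: cF.
  by apply: cvg_at_left_filter; exact: cF.
- by move=> s /dF ds; rewrite derive1E; have [_ ->] := ds.
Qed.

Lemma continuous_expRM (K : R) : continuous (fun s => expR (K * s)).
Proof.
apply: continuous_compr (@continuous_expR R); apply: continuous_mulr; first exact: continuous_cstr.
by move=> s; exact: cvg_id.
Qed.

Lemma int0_expR_le K t : 0 < K -> int0 t (fun s => expR (K * s)) <= expR (K * t) / K.
Proof.
move=> K0; have [t0|t0] := leP t 0; first by rewrite int0_le0// divr_ge0 ?expR_ge0// ltW.
have dF s : is_derive s (1 : R) (fun s => K^-1 * expR (K * s)) (expR (K * s)).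
  by apply: is_derive_eq; rewrite /GRing.scale/=; field; exact: lt0r_neq0.
rewrite int0E (Rintegral_FTC (ltW t0) dF).
- by rewrite mulrC lerBlDr lerDl mulr_ge0 ?expR_ge0// invr_ge0 ltW.
- exact: continuous_expRM.
Qed.

End time_integral.

(** * Weighted function classes *)

Lemma continuous_shiftl {R : realType} {n : nat} (phi : 'rV[R]_n -> R) (x : 'rV[R]_n) : continuous phi ->
  continuous (fun z : 'rV[R]_n => phi (x - z)).
Proof.
move=> cphi z s /cphi /nbhs_ballP[e e0 es]; apply/nbhs_ballP; exists e => // y [_ zy].
apply: es; split => // i j; rewrite !mxE /ball/= (_ : _ - _ = - (z i j - y i j)); last by ring.
by rewrite normrN; exact: zy.
Qed.

Lemma continuous_shiftr {R : realType} {n : nat} (phi : 'rV[R]_n -> R) (z : 'rV[R]_n) : continuous phi ->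
  continuous (fun x : 'rV[R]_n => phi (x - z)).
Proof.
move=> cphi x s /cphi /nbhs_ballP[e e0 es]; apply/nbhs_ballP; exists e => // y [_ xy].
apply: es; split => // i j; rewrite !mxE /ball/= (_ : _ - _ = x i j - y i j); last by ring.
exact: xy.
Qed.

Lemma continuous_seqE {R : realType} {U : topologicalType} (f : U -> R) (u : nat -> U) x :
  continuous f -> u k @[k --> \oo] --> x -> f (u k) @[k --> \oo] --> f x.
Proof. by move=> cf ux; exact: (@cvg_comp _ _ _ u f _ _ _ ux (cf x)). Qed.

Lemma nbhs_le_add1 {R : realType} {U : topologicalType} (f : U -> R) x : continuous f ->
  nbhs x [set y | f y <= f x + 1].
Proof.
move=> cf; have /cvgrPdist_lt /(_ _ ltr01) := cf x.
by apply: filterS => y /=; rewrite ltr_norml => /andP[]; lra.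
Qed.

Lemma continuous_unif {R : realType} {U : topologicalType} (f : U -> R) x :
  (forall e, 0 < e -> exists g : U -> R, {for x, continuous g} /\ nbhs x [set y | `|f y - g y| <= e]) ->
  {for x, continuous f}.
Proof.
move=> H; apply/cvgrPdist_lt => e e0; have e4 : 0 < e / 4 by rewrite divr_gt0.
have [g [/cvgrPdist_lt /(_ _ e4) cg fg]] := H _ e4.
have fgx := nbhs_singleton fg; apply: filterS2 cg fg => y /= h1 h2.
have -> : f x - f y = (f x - g x) + ((g x - g y) - (f y - g y)) by ring.
move: fgx h1 h2; rewrite /= !ler_norml !ltr_norml => /andP[a1 a2] /andP[a3 a4] /andP[a5 a6].
by apply/andP; split; lra.
Qed.

Section weighted.
Context {R : realType} (n : nat) (B : 'rV[R]_n -> R) (hB : is_bessel_kernel B).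
Context (w : 'rV[R]_n -> R) (CB Ce : R).
Context (cw : continuous w) (w1 : forall x, 1 <= w x).
Context (wexp : forall x z, w (x - z) <= Ce * w x * expw z).
Context (wavg : forall x, avg B (fun z => w (x - z)) <= CB * w x).
Implicit Types (phi psi : 'rV[R]_n -> R) (x : 'rV[R]_n) (m : R -> 'rV[R]_n -> R).

Definition cv phi x : R := avg B (fun z => phi (x - z)).

Definition bw phi := continuous phi /\ exists C, forall x, `|phi x| <= C * w x.

(** Separate continuity with a locally uniform weighted bound is what dominated convergence carries
    through [cv] and [int0]. Continuity in the norm of [BC_a] is recovered only for the solution,
    from a Lipschitz bound in time. *)
Definition gd m := [/\ forall t, continuous (m t), forall x, continuous (m^~ x) &
  forall T, exists C, forall t, t <= T -> forall x, `|m t x| <= C * w x].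

Lemma w_gt0 x : 0 < w x. Proof. exact: lt_le_trans ltr01 (w1 x). Qed.

Lemma bound_ge0 phi C : (forall x, `|phi x| <= C * w x) -> 0 <= C.
Proof.
by move=> /(_ 0) h; move: (le_trans (normr_ge0 _) h); rewrite pmulr_lge0// w_gt0.
Qed.

Lemma bound_shift phi C x z (D : R) : w x <= D -> 0 <= C -> `|phi (x - z)| <= C * w (x - z) ->
  `|phi (x - z)| <= C * (`|Ce| * D) * expw z.
Proof.
move=> xD C0 /le_trans; apply; rewrite -mulrA; apply: ler_wpM2l => //.
apply: le_trans (wexp x z) _; rewrite -!mulrA.
apply: (@le_trans _ _ (`|Ce| * (w x * expw z))).
  by apply: ler_wpM2r; rewrite ?ler_norm// mulr_ge0 ?expR_ge0// ltW// w_gt0.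
by apply: ler_wpM2l => //; apply: ler_wpM2r => //; exact: expR_ge0.
Qed.

Lemma bw_adm phi x : bw phi -> adm (fun z => phi (x - z)).
Proof.
move=> [cphi [C phiC]]; split; first exact: continuous_shiftl.
by exists (C * (`|Ce| * w x)) => z; apply: bound_shift => //; exact: bound_ge0 phiC.
Qed.

Lemma bw_w : bw w.
Proof. by split=> //; exists 1 => x; rewrite mul1r ger0_norm// ltW// w_gt0. Qed.

Lemma bwD phi psi : bw phi -> bw psi -> bw (fun x => phi x + psi x).
Proof.
move=> [c1 [C1 h1]] [c2 [C2 h2]]; split; first exact: continuous_addr.
by exists (C1 + C2) => x; rewrite mulrDl (le_trans (ler_normD _ _))// lerD.
Qed.

Lemma bwZ c phi : bw phi -> bw (fun x => c * phi x).
Proof.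
move=> [c1 [C1 h1]]; split; first exact: continuous_mulr (@continuous_cstr _ _ c) c1.
by exists (`|c| * C1) => x; rewrite normrM -mulrA ler_wpM2l.
Qed.

Lemma bwB phi psi : bw phi -> bw psi -> bw (fun x => phi x - psi x).
Proof.
move=> h1 h2; have := bwD h1 (bwZ (-1) h2).
by rewrite (_ : (fun x => _ + _) = (fun x => phi x - psi x))//; apply/funext => x; rewrite mulN1r.
Qed.

Lemma cvD phi psi x : bw phi -> bw psi -> cv (fun x => phi x + psi x) x = cv phi x + cv psi x.
Proof. by move=> h1 h2; exact: (avgD hB (bw_adm x h1) (bw_adm x h2)). Qed.

Lemma cvZ c phi x : bw phi -> cv (fun x => c * phi x) x = c * cv phi x.
Proof. by move=> h1; exact: (avgZ hB c (bw_adm x h1)). Qed.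

Lemma cvB phi psi x : bw phi -> bw psi -> cv (fun x => phi x - psi x) x = cv phi x - cv psi x.
Proof.
move=> h1 h2; have := cvD x h1 (bwZ (-1) h2); rewrite cvZ// mulN1r => <-.
by congr (cv _ x); apply/funext => y; rewrite mulN1r.
Qed.

Lemma le_cv phi psi x : bw phi -> bw psi -> (forall y, phi y <= psi y) -> cv phi x <= cv psi x.
Proof. by move=> h1 h2 h; apply: (le_avg hB (bw_adm x h1) (bw_adm x h2)) => z. Qed.

Lemma cv_cst c x : cv (fun=> c) x = c.
Proof.
rewrite -[RHS]mulr1 -(avg1 hB) -(avgZ hB); last exact: adm_cst.
by congr avg; apply/funext => z; rewrite mulr1.
Qed.

Lemma bw_cst c : bw (fun=> c).
Proof.
split; first exact: continuous_cstr.
by exists `|c| => x; rewrite ler_peMr.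
Qed.

Lemma cv_ge0 phi x : bw phi -> (forall y, 0 <= phi y) -> 0 <= cv phi x.
Proof. by move=> h1 h; rewrite -(cv_cst 0 x); apply: le_cv => //; exact: bw_cst. Qed.

Lemma norm_cv phi C x : continuous phi -> (forall x, `|phi x| <= C * w x) ->
  `|cv phi x| <= C * CB * w x.
Proof.
move=> cphi phiC; have C0 := bound_ge0 phiC.
have bphi : bw phi by split=> //; exists C.
have h : cv (fun y => C * w y) x <= C * CB * w x.
  by rewrite (cvZ C x bw_w) -mulrA; apply: ler_wpM2l => //; exact: wavg.
have bC := bwZ C bw_w.
rewrite ler_norml; apply/andP; split; last first.
  apply: le_trans (le_cv x bphi bC _) h => y.
  exact: le_trans (ler_norm _) (phiC y).
rewrite lerNl; apply: le_trans h; rewrite -[- _]mulN1r -cvZ//.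
apply: le_cv => [||y] //; first exact: bwZ.
by rewrite mulN1r (le_trans _ (phiC y))// -normrN ler_norm.
Qed.

Lemma continuous_cv phi : bw phi -> continuous (cv phi).
Proof.
move=> [cphi [C phiC]] x; have C0 := bound_ge0 phiC.
apply: (continuous_seq (nbhs_le_add1 x cw)) => u ux uP.
apply: (avg_dct hB (C := C * (`|Ce| * (w x + 1)))) => [k|k z|z].
- exact: continuous_shiftl.
- by apply: bound_shift => //; exact: uP.
- have h := @continuous_shiftr _ _ phi z cphi.
  have := continuous_seqE h ux; apply.
Qed.

Lemma gd_bw m t : gd m -> bw (m t).
Proof. by move=> [mx _ mb]; split=> //; have [C hC] := mb t; exists C => x; exact: hC. Qed.

Lemma gdD m m' : gd m -> gd m' -> gd (fun t x => m t x + m' t x).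
Proof.
move=> [mx mt mb] [mx' mt' mb']; split=> [t|x|T]; [exact: continuous_addr..|].
have [C hC] := mb T; have [C' hC'] := mb' T; exists (C + C') => t tT x.
by rewrite mulrDl (le_trans (ler_normD _ _))// lerD// ?hC ?hC'.
Qed.

Lemma gd_cst phi : bw phi -> gd (fun=> phi).
Proof.
move=> [c1 [C h]]; split=> [t//|x|T]; first exact: continuous_cstr.
by exists C.
Qed.

Lemma gd_cv m : gd m -> gd (fun t => cv (m t)).
Proof.
move=> gm; have [mx mt mb] := gm; split=> [t|x t|T].
- exact: continuous_cv (gd_bw t gm).
- have [C hC] := mb (t + 1); have C0 := bound_ge0 (hC (t + 1) (lexx _)).
  have nP : nbhs t [set s : R | s <= t + 1].
    by apply: (@nbhs_le_add1 R R id t) => s; exact: cvg_id.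
  apply: (continuous_seq nP) => u ut uP.
  apply: (avg_dct hB (C := C * (`|Ce| * w x))) => [k|k z|z].
  + exact: continuous_shiftl.
  + by apply: bound_shift => //; apply: hC; exact: uP.
  + exact: (continuous_seqE (mt (x - z)) ut).
- by have [C hC] := mb T; exists (C * CB) => t tT x; apply: norm_cv => // y; exact: hC.
Qed.

Lemma gd_int0 m : gd m -> gd (fun t x => int0 t (m^~ x)).
Proof.
move=> [mx mt mb]; split=> [t x|x|T].
- have [C hC] := mb t; have C0 := bound_ge0 (hC t (lexx _)).
  apply: (continuous_seq (nbhs_le_add1 x cw)) => u ux uP.
  apply: (int0_dct (C := C * (w x + 1))) => // [k s s0 st|s s0 st].
    by apply: le_trans (hC _ st _) _; apply: ler_wpM2l => //; exact: uP.
  exact: continuous_seqE.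
- exact: continuous_int0.
- have [C hC] := mb T; have C0 := bound_ge0 (hC T (lexx _)).
  exists (C * Num.max T 0) => t tT x; have [t0|t0] := leP t 0.
    by rewrite int0_le0// normr0 !mulr_ge0 ?le_max ?lexx ?orbT// ltW// w_gt0.
  apply: (@le_trans _ _ (int0 t (fun=> C * w x))).
    apply: norm_int0_le => // [|s s0 st]; first exact: continuous_cstr.
    by apply: hC; exact: le_trans tT.
  rewrite int0_cst ?(ltW t0)// mulrAC; apply: ler_wpM2r; first exact/ltW/w_gt0.
  by apply: ler_wpM2l => //; rewrite le_max tT.
Qed.

(** Completeness of [gd] for sequences that are geometrically Cauchy on every [t <= T]: the ratio is
    common to all horizons, the constant is not. *)
Lemma gd_lim (m_ : nat -> R -> 'rV[R]_n -> R) (rho : R) : 0 <= rho -> rho < 1 ->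
  (forall k, gd (m_ k)) ->
  (forall T, exists D, forall k t x, t <= T -> `|m_ k.+1 t x - m_ k t x| <= D * rho ^+ k * w x) ->
  exists m, gd m /\
    forall T, exists D, forall k t x, t <= T -> `|m t x - m_ k t x| <= D * rho ^+ k * w x.
Proof.
move=> r0 r1 gm hd; have r1' : 0 < 1 - rho by rewrite subr_gt0.
have hc T : exists D, forall k j t x, t <= T ->
    `|m_ (k + j)%N t x - m_ k t x| <= D * rho ^+ k * w x.
  have [D hD] := hd T; have D0 : 0 <= D.
    have := hD 0%N T 0 (lexx _); rewrite expr0 mulr1 => /(le_trans (normr_ge0 _)).
    by rewrite pmulr_lge0// w_gt0.
  exists (D / (1 - rho)) => k j t x tT.
  (* The induction on [j] carries the exact partial sum of the geometric series, whence the factor 1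
     - rho^j. *)
  apply: (@le_trans _ _ (D / (1 - rho) * rho ^+ k * (1 - rho ^+ j) * w x)); last first.
    apply: ler_wpM2r; first exact/ltW/w_gt0.
    rewrite ler_piMr// ?mulr_ge0 ?exprn_ge0 ?invr_ge0 ?(ltW r1')//.
    by rewrite lerBlDr lerDl exprn_ge0.
  elim: j => [|j IH]; first by rewrite addn0 subrr normr0 expr0 subrr mulr0 mul0r.
  rewrite addnS (_ : _ - _ = (m_ (k + j).+1 t x - m_ (k + j)%N t x) + (m_ (k + j)%N t x - m_ k t x)); last by ring.
  apply: le_trans (ler_normD _ _) _; apply: le_trans (lerD (hD _ _ _ tT) IH) _.
  rewrite le_eqVlt; apply/orP; left; apply/eqP; rewrite exprD exprS.
  by field; exact: lt0r_neq0.
have cvgm t x : cvgn (fun k => m_ k t x).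
  have [D hD] := hc t; apply/cauchy_cvgP; apply/cauchy_exP => e e0.
  have hr : (D * rho ^+ k * w x) @[k --> \oo] --> D * 0 * w x.
    by apply: cvgMl; apply: cvgMr; apply: cvg_expr; rewrite ger0_norm.
  move: hr; rewrite mulr0 mul0r => /cvgr0Pnorm_lt /(_ _ e0)[K _ hK].
  exists (m_ K t x); exists K => // j /= Kj.
  rewrite /ball/= distrC -(subnKC Kj); apply: le_lt_trans (hD _ _ _ _ (lexx t)) _.
  exact: le_lt_trans (ler_norm _) (hK K (leqnn K)).
pose m t x := lim (m_ k t x @[k --> \oo]).
have hm T : exists D, forall k t x, t <= T -> `|m t x - m_ k t x| <= D * rho ^+ k * w x.
  have [D hD] := hc T; exists D => k t x tT.
  have : `|m_ (k + j)%N t x - m_ k t x| @[j --> \oo] --> `|m t x - m_ k t x|.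
    apply: cvg_norm; apply: cvgB; last exact: cvg_cst.
    have := cvgm t x; rewrite -(cvg_shiftn k).
    by under eq_fun do rewrite addnC.
  by move=> h; apply: (ler_cvg_to h (cvg_cst _)); apply: nearW => j; exact: hD.
exists m; split=> //.
have small D c e : 0 < e -> exists K, D * rho ^+ K * c <= e.
  move=> e0; have hr : (D * rho ^+ k * c) @[k --> \oo] --> D * 0 * c.
    by apply: cvgMl; apply: cvgMr; apply: cvg_expr; rewrite ger0_norm.
  move: hr; rewrite mulr0 mul0r => /cvgr0Pnorm_lt /(_ _ e0)[K _ hK].
  by exists K; apply: ltW; exact: le_lt_trans (ler_norm _) (hK K (leqnn K)).
have D0 T D : (forall k t x, t <= T -> `|m t x - m_ k t x| <= D * rho ^+ k * w x) -> 0 <= D.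
  move=> /(_ 0%N T 0 (lexx _)); rewrite expr0 mulr1 => /(le_trans (normr_ge0 _)).
  by rewrite pmulr_lge0// w_gt0.
split=> [t x|x t|T].
- have [D hD] := hm t; apply: continuous_unif => e e0.
  have [K hK] := small D (w x + 1) e e0; exists (m_ K t); split.
    by have [h _ _] := gm K; exact: h.
  apply: filterS (nbhs_le_add1 x cw) => y /= wy; apply: le_trans hK.
  apply: le_trans (hD K t y (lexx _)) _; apply: ler_wpM2l => //.
  by rewrite mulr_ge0 ?exprn_ge0//; exact: D0 hD.
- have [D hD] := hm (t + 1); apply: continuous_unif => e e0.
  have [K hK] := small D (w x) e e0; exists (m_ K ^~ x); split.
    by have [_ h _] := gm K; exact: h.
  have nP : nbhs t [set s : R | s <= t + 1].
    by apply: (@nbhs_le_add1 R R id t) => s; exact: cvg_id.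
  by apply: filterS nP => s /= st; apply: le_trans hK; exact: hD.
- have [D hD] := hm T; have [_ _ /(_ T)[C hC]] := gm 0%N.
  exists (D + C) => t tT x; have := hD 0%N t x tT; rewrite expr0 mulr1 => h.
  rewrite mulrDl -[m t x](subrK (m_ 0%N t x)); apply: le_trans (ler_normD _ _) _.
  by apply: lerD => //; exact: hC.
Unshelve. all: by end_near. Qed.

End weighted.

(** * The fixed point problem *)

Ltac nneg := repeat first [by [] | by apply: ltW | exact: powR_ge0 | exact: expR_ge0 |
  apply: mulr_ge0 | apply: addr_ge0 | rewrite invr_ge0].

Lemma continuous_scale {R : realType} {U : topologicalType} (c : R) (f : U -> R) :
  continuous f -> continuous (fun z => c * f z).
Proof. by move=> cf; exact: continuous_mulr (@continuous_cstr _ _ c) cf. Qed.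

(** * Radial cutoffs *)

Section cutoffs.
Context {R : realType} {n : nat}.
Implicit Types (x y z : 'rV[R]_n) (M b : R).

Definition mx x : R := Num.max 1 (enorm x).

Definition ramp M x : R := Num.min 1 (Num.max (enorm x - M) 0).

Lemma mx_ge1 x : 1 <= mx x. Proof. by rewrite le_max lexx. Qed.

Lemma mx_gt0 x : 0 < mx x. Proof. exact: lt_le_trans ltr01 (mx_ge1 x). Qed.

Lemma mxE1 x : 1 <= enorm x -> mx x = enorm x.
Proof. by move=> h; rewrite /mx max_r. Qed.

Lemma continuous_mx : continuous mx.
Proof.
rewrite (_ : mx = (fun x => 1 + Num.max (enorm x - 1) 0)); last first.
  by apply/funext => x; rewrite /mx; case: (leP 1 (enorm x)) => h; case: leP => h'; lra.
apply: continuous_addr; first exact: continuous_cstr.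
apply: continuous_compr (@continuous_maxr0 R); apply: continuous_subr; last exact: continuous_cstr.
exact: continuous_enorm.
Qed.

Lemma continuous_mx_powR b : 0 <= b -> continuous (fun x => mx x `^ b).
Proof.
move=> b0; rewrite (_ : (fun x => _) = (fun x => Num.max (mx x) 0 `^ b)); last first.
  by apply/funext => x; rewrite max_l// ltW// mx_gt0.
exact: continuous_compr continuous_mx (continuous_powR_max b0).
Qed.

Lemma continuous_ramp M : continuous (ramp M).
Proof.
rewrite (_ : ramp M = (fun x => 1 - Num.max (1 - Num.max (enorm x - M) 0) 0)); last first.
  apply/funext => x; rewrite /ramp; set r := Num.max _ _.
  by case: (leP 1 r) => h; case: leP => h'; lra.
apply: continuous_subr; first exact: continuous_cstr.
apply: continuous_compr (@continuous_maxr0 R); apply: continuous_subr; first exact: continuous_cstr.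
apply: continuous_compr (@continuous_maxr0 R); apply: continuous_subr; last exact: continuous_cstr.
exact: continuous_enorm.
Qed.

Lemma ramp_ge0 M x : 0 <= ramp M x.
Proof. by rewrite /ramp le_min ler01/= le_max lexx orbT. Qed.

Lemma ramp_le1 M x : ramp M x <= 1.
Proof. by rewrite /ramp ge_min lexx. Qed.

Lemma ramp0 M x : enorm x <= M -> ramp M x = 0.
Proof. by move=> h; rewrite /ramp max_r ?min_r// subr_le0. Qed.

Lemma ramp1 M x : M + 1 <= enorm x -> ramp M x = 1.
Proof. by move=> h; rewrite /ramp min_l// le_max lerBrDl h. Qed.

Lemma ramp_homo M x y : enorm x <= enorm y -> ramp M x <= ramp M y.
Proof. by move=> h; rewrite /ramp le_min2// le_max2// lerB. Qed.

Lemma gfun_ge0 (l : R) x : 0 <= gfun l x. Proof. exact: expR_ge0. Qed.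

Lemma gfun_le1 (l : R) x : 0 <= l -> gfun l x <= 1.
Proof. by move=> l0; rewrite /gfun -expR0 ler_expR oppr_le0 mulr_ge0// sqr_ge0. Qed.

End cutoffs.

(** * The map [Psi]; [g] and [W] stand for [Lambda] and [V] times exp((1 - p) t) *)

Section nonlinear.
Context {R : realType} (n : nat) (B : 'rV[R]_n -> R) (hB : is_bessel_kernel B).
Context (w : 'rV[R]_n -> R) (CB Ce : R).
Context (cw : continuous w) (w1 : forall x, 1 <= w x).
Context (wexp : forall x z, w (x - z) <= Ce * w x * expw z).
Context (wavg : forall x, avg B (fun z => w (x - z)) <= CB * w x).
Context (p sigma thl thu : R) (hp0 : 0 < p) (hp1 : p < 1) (hs : 0 <= sigma).
Context (hthl : 0 < thl) (hthu : 0 < thu).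
Context (g : R -> R) (cg : continuous g) (g0 : forall t, 0 < g t).
Context (gub : forall T, exists2 C, 0 < C & forall t, t <= T -> g t <= C).
Context (glb : forall T, exists2 c, 0 < c & forall t, t <= T -> c <= g t).
Context (W : 'rV[R]_n -> R -> R) (cWx : forall t, continuous (W^~ t)).
Context (cWt : forall x, continuous (W x)) (W0 : forall x t, 0 <= W x t).
Context (Wl : forall x t, 1 <= enorm x -> thl * g t * enorm x `^ sigma <= W x t).
Context (Wu : forall x t, W x t <= thu * g t * mx x `^ sigma).

(** The nonlinearity dictates both exponents: kap = 1 + p kap and b = sigma + p b, so that the time
    integral of W m^p reproduces the shape L^kap |x|^b. *)
Let kap := (1 - p)^-1.
Let b := sigma * kap.

Context (wb : forall x, mx x `^ b <= w x).
Context (u0 : 'rV[R]_n -> R) (bu0 : bw w u0) (u00 : forall x, 0 <= u0 x).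
Context (u0nz : exists x, u0 x != 0).
Implicit Types (x y z : 'rV[R]_n) (m : R -> 'rV[R]_n -> R) (s t T : R).

Let L t := int0 t g.

Let p1 : 0 < 1 - p. Proof. by rewrite subr_gt0. Qed.
Let kap0 : 0 < kap. Proof. by rewrite invr_gt0. Qed.
Let b0 : 0 <= b. Proof. by rewrite mulr_ge0// ltW. Qed.
Let kap1 : 1 < kap. Proof. by rewrite /kap invf_gt1// gtrBl. Qed.
Let kapp : kap * p = kap - 1. Proof. by rewrite /kap; field; rewrite gt_eqF. Qed.
Let kapV : kap^-1 = 1 - p. Proof. by rewrite invrK. Qed.
Let bp : sigma + b * p = b. Proof. by rewrite /b -mulrA kapp; ring. Qed.
Let w0 x : 0 < w x. Proof. exact: w_gt0. Qed.

Let cL : continuous L. Proof. exact: continuous_int0. Qed.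

Let L_ge0 t : 0 <= L t. Proof. by apply: int0_ge0 => s _ _; exact: ltW. Qed.

Let L_le0 t : t <= 0 -> L t = 0. Proof. exact: int0_le0. Qed.

Let L_mono s t : s <= t -> L s <= L t.
Proof. by move=> st; apply: le_int0_mono => // r; exact: ltW. Qed.

Lemma time_le_L T : exists2 C, 0 < C & forall t, t <= T -> t <= C * L t.
Proof.
have [c c0 hc] := glb T; exists c^-1; first by rewrite invr_gt0.
move=> t tT; have [t0|t0] := leP t 0; first by rewrite L_le0// mulr0.
rewrite ler_pdivlMl// -(int0_cst _ (ltW t0)); apply: le_int0 => //; first exact: continuous_cstr.
by move=> s s0 st; apply: hc; exact: le_trans tT.
Qed.

Lemma L_le_time T : exists2 C, 0 < C & forall t, 0 <= t -> t <= T -> L t <= C * t.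
Proof.
have [c c0 hc] := gub T; exists c => // t t0 tT.
rewrite -(int0_cst _ t0); apply: le_int0 => //; first exact: continuous_cstr.
by move=> s s0 st; apply: hc; exact: le_trans tT.
Qed.

Let L_gt0 t : 0 < t -> 0 < L t.
Proof.
move=> t0; have [C C0 hC] := time_le_L t.
by move: (lt_le_trans t0 (hC t (lexx _))); rewrite pmulr_rgt0.
Qed.

Let cLp c : 0 <= c -> continuous (fun t => L t `^ c).
Proof.
move=> c0; rewrite (_ : (fun s => _) = (fun s => Num.max (L s) 0 `^ c)).
  exact: continuous_compr cL (continuous_powR_max c0).
by apply/funext => s; rewrite max_l.
Qed.

Let L_int c t : 0 <= c -> int0 t (fun s => g s * L s `^ c) = L t `^ (c + 1) / (c + 1).
Proof. by move=> c0; apply: int0_powR => // s; exact: ltW. Qed.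

(** With the truncation the power is continuous and monotone on the whole line, so [Psi] acts on
    [gd] without any sign condition. *)
Definition pw (r : R) := Num.max r 0 `^ p.

Lemma pwE r : 0 <= r -> pw r = r `^ p. Proof. by move=> r0; rewrite /pw max_l. Qed.

Lemma pw_ge0 r : 0 <= pw r. Proof. exact: powR_ge0. Qed.

Lemma le_pw r s : r <= s -> pw r <= pw s.
Proof.
move=> rs; apply: le_powR_base; [exact: ltW|by rewrite le_max lexx orbT|].
by rewrite le_max2.
Qed.

(** [wb] bounds |x|^sigma by w^(1-p) outside the unit ball: the growth contributed by the potential
    is exactly what the sublinear power gives up. This is how the condition a >= sigma / (1 - p)
    acts. *)
Lemma wpow x : mx x `^ sigma * w x `^ p <= w x.
Proof.
have -> : w x = w x `^ (1 - p) * w x `^ p by rewrite -powRD_pos// subrK powRr1// ltW.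
have -> : (w x `^ (1 - p) * w x `^ p) `^ p = w x `^ p.
  by rewrite -powRD_pos// subrK powRr1// ltW.
apply: ler_wpM2r; first exact: powR_ge0.
have -> : mx x `^ sigma = (mx x `^ b) `^ (1 - p).
  by rewrite -powRrM /b -mulrA mulVf ?mulr1// gt_eqF.
apply: le_powR_base; [exact: ltW|exact: powR_ge0|exact: wb].
Qed.

Definition Nl m t x := m t x + W x t * pw (m t x).

Definition Psi m t x := u0 x + int0 t (fun s => cv B (Nl m s) x).

Lemma gd_Nl m : gd w m -> gd w (Nl m).
Proof.
move=> gm; have [mcx mct mb] := gm; apply: gdD => //.
have cpw : continuous pw by apply: continuous_powR_max; exact: ltW.
split=> [t|x|T].
- by apply: continuous_mulr => //; exact: (continuous_compr (mcx t) cpw).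
- by apply: continuous_mulr => //; exact: (continuous_compr (mct x) cpw).
have [C hC] := mb T; have C0 : 0 <= C := bound_ge0 w1 (hC T (lexx _)).
have [D D0 hD] := gub T.
exists (thu * D * C `^ p) => t tT x.
rewrite ger0_norm ?mulr_ge0 ?pw_ge0//.
have h1 : pw (m t x) <= C `^ p * w x `^ p.
  rewrite -powRM//; last exact: ltW.
  rewrite -pwE ?mulr_ge0//; last exact: ltW.
  by apply: le_pw; apply: le_trans (ler_norm _) (hC _ tT x).
apply: le_trans (ler_pM (W0 _ _) (pw_ge0 _) (Wu x t) h1) _.
have -> : thu * g t * mx x `^ sigma * (C `^ p * w x `^ p) =
  thu * g t * C `^ p * (mx x `^ sigma * w x `^ p) by ring.
apply: le_trans (ler_wpM2l _ (wpow x)) _.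
  by rewrite !mulr_ge0 ?powR_ge0//; exact: ltW.
apply: ler_wpM2r; first exact: ltW.
apply: ler_wpM2r; first exact: powR_ge0.
by rewrite ler_pM2l// hD.
Qed.

Lemma gd_cvNl m : gd w m -> gd w (fun s => cv B (Nl m s)).
Proof. by move=> gm; apply: (gd_cv hB) wavg _ (gd_Nl gm). Qed.

Lemma gd_Psi m : gd w m -> gd w (Psi m).
Proof. by move=> gm; apply: gdD; [exact: gd_cst|apply: gd_int0 => //; exact: gd_cvNl]. Qed.

Lemma bw_Nl m t : gd w m -> bw w (Nl m t).
Proof. by move=> gm; exact: gd_bw (gd_Nl gm). Qed.

Lemma continuous_cvNl m x : gd w m -> continuous (fun s => cv B (Nl m s) x).
Proof. by move=> gm; have [_ h _] := gd_cvNl gm; exact: h. Qed.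

Lemma Psi_ge_u0 m t x : gd w m -> (forall t x, 0 <= m t x) -> u0 x <= Psi m t x.
Proof.
move=> gm m0; rewrite /Psi lerDl; apply: int0_ge0 => s s0 st.
apply: (cv_ge0 hB w1 wexp); first exact: bw_Nl.
by move=> y; rewrite addr_ge0// mulr_ge0// pw_ge0.
Qed.

Lemma Psi_ge0 m : gd w m -> (forall t x, 0 <= m t x) -> forall t x, 0 <= Psi m t x.
Proof. by move=> gm m0 t x; exact: le_trans (u00 x) (Psi_ge_u0 t x gm m0). Qed.

Lemma le_Psi m m' T : gd w m -> gd w m' ->
  (forall t x, t <= T -> m t x <= m' t x) -> forall t x, t <= T -> Psi m t x <= Psi m' t x.
Proof.
move=> gm gm' mm t x tT; rewrite /Psi lerD2l; apply: le_int0; [exact: continuous_cvNl..|].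
move=> s s0 st; apply: (le_cv hB w1 wexp); [exact: bw_Nl..|move=> y].
have h := mm s y (le_trans st tT).
by rewrite lerD// ler_wpM2l// le_pw.
Qed.

Lemma Psi_lower m T (f : R -> R) psi : gd w m -> continuous f -> bw w psi ->
  (forall s y, 0 <= s -> s <= T -> f s * psi y <= Nl m s y) ->
  forall t x, t <= T -> int0 t f * cv B psi x <= Psi m t x.
Proof.
move=> gm cf bpsi h t x tT; rewrite mulrC -int0Z// /Psi.
apply: (@le_trans _ _ (int0 t (fun s => cv B (Nl m s) x))); last by rewrite lerDr.
apply: le_int0 => [||s s0 st].
- exact: continuous_scale.
- exact: continuous_cvNl.
- rewrite mulrC -(cvZ hB w1 wexp)//; apply: (le_cv hB w1 wexp).
  + exact: bwZ.
  + exact: bw_Nl.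
  + by move=> y; apply: h => //; exact: le_trans tT.
Qed.

Lemma Psi_diff m m' T (f : R -> R) : gd w m -> gd w m' -> continuous f ->
  (forall s y, 0 <= s -> s <= T -> `|Nl m s y - Nl m' s y| <= f s * w y) ->
  forall t x, t <= T -> `|Psi m t x - Psi m' t x| <= int0 t f * CB * w x.
Proof.
move=> gm gm' cf h t x tT.
have -> : Psi m t x - Psi m' t x = int0 t (fun s => cv B (Nl m s) x - cv B (Nl m' s) x).
  by rewrite int0B; [rewrite /Psi opprD addrACA subrr add0r|exact: continuous_cvNl..].
have -> : int0 t f * CB * w x = int0 t (fun s => (CB * w x) * f s) by rewrite int0Z//; ring.
apply: norm_int0_le => [||s s0 st].
- by apply: continuous_subr; exact: continuous_cvNl.
- exact: continuous_scale.
- have [b1 b2] := (bw_Nl s gm, bw_Nl s gm').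
  rewrite -(cvB hB w1 wexp)//.
  have -> : CB * w x * f s = f s * CB * w x by ring.
  apply: (norm_cv hB cw w1 wexp wavg); first by have [] := bwB b1 b2.
  by move=> y; apply: h => //; exact: le_trans tT.
Qed.

(** Only the linear part of [Nl] is kept. It gives a bound that is positive in all of space, also
    where the potential vanishes. *)
Lemma Psi_time m T : gd w m -> (forall t x, 0 <= m t x) -> (forall t x, t <= T -> u0 x <= m t x) ->
  forall t x, t <= T -> t * cv B u0 x <= Psi m t x.
Proof.
move=> gm m0 mu t x tT; have [t0|t0] := leP t 0.
  apply: (le_trans _ (Psi_ge0 gm m0 t x)); apply: mulr_le0_ge0 => //.
  exact: (cv_ge0 hB w1 wexp).
rewrite -[t in leLHS]mul1r -(int0_cst 1 (ltW t0)).
apply: (Psi_lower (T := T)) => // [|s y s0 sT]; first exact: continuous_cstr.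
rewrite mul1r; apply: le_trans (mu s y sT) _.
by rewrite /Nl lerDl mulr_ge0// pw_ge0.
Qed.

(** The ramp is there because [W] is bounded below for |x| >= 1 only; the Gaussian factor is the
    damping inherited from the lower bound of B * u0, and [l] is driven to 0. *)
Definition prof (l : R) x := ramp 1 x * mx x `^ b * gfun l x.

Lemma prof_ge0 l x : 0 <= prof l x.
Proof. by rewrite !mulr_ge0 ?ramp_ge0 ?powR_ge0 ?gfun_ge0. Qed.

Lemma bw_cut (f : 'rV[R]_n -> R) : continuous f -> (forall x, 0 <= f x) -> (forall x, f x <= mx x `^ b) ->
  bw w f.
Proof.
move=> cf f0 fb; split=> //; exists 1 => x; rewrite mul1r ger0_norm//.
exact: le_trans (fb x) (wb x).
Qed.

Lemma bw_prof l : 0 <= l -> bw w (prof l).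
Proof.
move=> l0; apply: bw_cut => [|x|x]; last 2 first.
- exact: prof_ge0.
- rewrite /prof mulrAC ler_piMl ?powR_ge0// -[leRHS]mulr1.
  by apply: ler_pM; rewrite ?ramp_ge0 ?gfun_ge0 ?ramp_le1 ?gfun_le1.
apply: continuous_mulr; last exact: continuous_gfun.
by apply: continuous_mulr; [exact: continuous_ramp|exact: continuous_mx_powR].
Qed.

Let eta := (1 - p) / (2 * p).
Let eta0 : 0 < eta. Proof. by rewrite divr_gt0// mulr_gt0. Qed.
Let rr := (1 + p) / 2.

(* On the half space z.x <= 0 we have |x - z| >= |x|, so the growing factors of the profile do not
   decrease, while Young's inequality with p (1 + eta) = r < 1 controls the Gaussian factor. *)
Lemma prof_half : exists2 k, 0 < k & forall l x, 0 <= l -> l <= 1 ->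
  k * prof (rr * l) x <= cv B (prof (p * l)) x.
Proof.
pose a := p * (1 + eta^-1).
have a0 : 0 <= a by rewrite mulr_ge0 ?addr_ge0 ?invr_ge0 ?ltW.
have [k k0 hk] := avg_half_space hB a0; exists k => // l x l0 l1.
have pl0 : 0 <= p * l by rewrite mulr_ge0// ltW.
have bp' := bw_prof pl0.
have := prof_ge0 (rr * l) x; rewrite le_eqVlt => /predU1P[<-|s0].
  by rewrite mulr0; apply: (cv_ge0 hB w1 wexp) => // y; exact: prof_ge0.
(* Divided by its value at [x], the profile falls under [avg_half_space], which asks for a Gaussian
   lower bound on a half space only. *)
rewrite -ler_pdivlMr// mulrC -(cvZ hB w1 wexp)//.
apply: (hk x) => [|z|z zx].
- exact: (bw_adm w1 wexp x (bwZ _ bp')).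
- by rewrite mulr_ge0 ?prof_ge0// invr_ge0 ltW.
rewrite ler_pdivlMl//.
have xz2 : enorm (x - z) ^+ 2 = enorm x ^+ 2 - 2 * edot z x + enorm z ^+ 2.
  rewrite enorm_sqrD enormN edotC (_ : edot (- z) x = - edot z x); first by ring.
  by rewrite /edot -sumrN; apply: eq_bigr => i _; rewrite mxE mulNr.
have xz : enorm x <= enorm (x - z).
  rewrite -(ler_pXn2r (isT : (0 < 2)%N)) ?nnegrE ?enorm_ge0// xz2.
  by have := sqr_ge0 (enorm z); lra.
have hg : gfun (rr * l) x * gfun a z <= gfun (p * l) (x - z).
  rewrite /gfun -expRD ler_expR xz2.
  have young : - (2 * edot z x) <= eta * enorm x ^+ 2 + eta^-1 * enorm z ^+ 2.
    have h1 : - edot z x <= enorm z * enorm x.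
      rewrite -(enormN z); apply: le_trans (edot_le _ _).
      by rewrite /edot -sumrN; apply: ler_sum => i _; rewrite mxE mulNr.
    have h2 : 0 <= eta * (enorm x - eta^-1 * enorm z) ^+ 2 by rewrite mulr_ge0 ?sqr_ge0// ltW.
    have h3 : eta * (enorm x - eta^-1 * enorm z) ^+ 2 =
      eta * enorm x ^+ 2 + eta^-1 * enorm z ^+ 2 - 2 * (enorm z * enorm x).
      by field; rewrite gt_eqF.
    by lra.
  have e1 : rr = p * (1 + eta) by rewrite /rr /eta; field; rewrite gt_eqF.
  rewrite e1 /a; move: young (sqr_ge0 (enorm x)) (sqr_ge0 (enorm z)).
  set X := enorm x ^+ 2; set Z := enorm z ^+ 2; set d := edot z x => young X0 Z0.
  have i0 : 0 <= eta^-1 by rewrite invr_ge0 ltW.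
  have h4 : p * l * (X - 2 * d + Z) <= p * l * ((1 + eta) * X + (1 + eta^-1) * Z).
    by apply: ler_wpM2l => //; lra.
  have h5 : p * l * ((1 + eta^-1) * Z) <= p * (1 + eta^-1) * Z.
    have q : 0 <= p * ((1 + eta^-1) * Z) by nneg.
    have -> : p * l * ((1 + eta^-1) * Z) = l * (p * ((1 + eta^-1) * Z)) by ring.
    by rewrite -[p * _ * Z]mulrA ler_piMl.
  have -> : p * (1 + eta) * l * X = p * l * ((1 + eta) * X) by ring.
  by lra.
rewrite /prof -[X in X <= _]mulrA; apply: ler_pM.
- by rewrite mulr_ge0 ?ramp_ge0 ?powR_ge0.
- by rewrite mulr_ge0 ?gfun_ge0.
- apply: ler_pM; [exact: ramp_ge0|exact: powR_ge0|exact: ramp_homo|].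
  by apply: le_powR_base => //; [exact/ltW/mx_gt0|rewrite /mx le_max2].
- exact: hg.
Qed.

(** The p-th power turns L^kap into L^(kap-1), and g L^(kap-1) integrates to (1 - p) L^kap. The
    ramp, being at most 1, only grows; the damping becomes p l, and the averaging of [prof_half]
    brings it to rr l. *)
Lemma crude_step : exists2 c, 0 < c & forall m T th l, gd w m -> 0 < th -> 0 <= l -> l <= 1 ->
  (forall t x, t <= T -> th * (c * L t `^ kap * prof l x) <= m t x) ->
  forall t x, t <= T -> th `^ p * (c * L t `^ kap * prof (rr * l) x) <= Psi m t x.
Proof.
have [k k0 hk] := prof_half.
have A0 : 0 < thl * (1 - p) * k by rewrite !mulr_gt0.
(* The fixed point of c |-> thl (1 - p) k c^p: one application of [Psi] reproduces this constant. *)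
pose c := (thl * (1 - p) * k) `^ kap.
have c0 : 0 < c by exact: powR_gt0.
exists c => // m T th l gm th0 l0 l1 hm t x tT.
have cE : thl * (1 - p) * k * c `^ p = c.
  rewrite /c -powRrM kapp -[X in X * _](powRr1 (ltW A0)) -powRD_pos//.
  by congr (_ `^ _); ring.
have pl0 : 0 <= p * l by rewrite mulr_ge0// ltW.
pose f s := thl * th `^ p * c `^ p * (g s * L s `^ (kap - 1)).
have k10 : 0 <= kap - 1 by rewrite subr_ge0 ltW.
have cgL : continuous (fun s => g s * L s `^ (kap - 1)).
  by apply: continuous_mulr => //; exact: cLp.
have cf : continuous f by exact: continuous_scale.
have h : forall s y, 0 <= s -> s <= T -> f s * prof (p * l) y <= Nl m s y.
  move=> s y s0 sT; have ms := hm s y sT.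
  have m0 : 0 <= m s y.
    by apply: le_trans ms; have pr0 := prof_ge0 l y; nneg.
  rewrite /Nl; apply: (@le_trans _ _ (W y s * pw (m s y))); last by rewrite lerDr.
  have [y1|y1] := leP (enorm y) 1.
    by rewrite /prof ramp0// !mul0r mulr0 mulr_ge0// pw_ge0.
  have hp : th `^ p * (c `^ p * L s `^ (kap - 1) * (ramp 1 y * mx y `^ (b * p) * gfun (p * l) y)) <= pw (m s y).
    apply: le_trans (le_pw ms); rewrite pwE; last by have pr0 := prof_ge0 l y; nneg.
    have r0 := ramp_ge0 1 y; have q0 := gfun_ge0 l y.
    rewrite /prof !powRM; try by nneg.
    apply: ler_wpM2l; first exact: powR_ge0.
    rewrite -powRrM kapp; apply: ler_wpM2l; first by rewrite mulr_ge0 ?powR_ge0.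
    rewrite -powRrM; apply: ler_pM; rewrite ?mulr_ge0 ?ramp_ge0 ?powR_ge0 ?gfun_ge0//.
      apply: ler_wpM2r; first exact: powR_ge0.
      by apply: powR_ge_id; rewrite ?ramp_ge0 ?ramp_le1// ltW.
    by rewrite /gfun -expRM ler_expR; lra.
  have hW : thl * g s * mx y `^ sigma <= W y s by rewrite (mxE1 (ltW y1)); exact: (Wl _ (ltW y1)).
  have q1 : 0 <= thl * g s * mx y `^ sigma by nneg.
  apply: le_trans (ler_pM q1 _ hW hp); last first.
    by nneg; rewrite ?ramp_ge0 ?gfun_ge0.
  rewrite le_eqVlt; apply/orP; left; apply/eqP; rewrite /f /prof -{1}bp powRD_pos ?mx_gt0//; ring.
apply: le_trans (Psi_lower gm cf (bw_prof pl0) h x tT).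
rewrite int0Z// L_int// subrK kapV.
apply: (@le_trans _ _ (thl * th `^ p * c `^ p * (L t `^ kap * (1 - p)) * (k * prof (rr * l) x))).
  rewrite -{1}cE le_eqVlt; apply/orP; left; apply/eqP; ring.
by apply: ler_wpM2l; [nneg|exact: hk].
Qed.

Lemma gd_sep (f : R -> R) psi : continuous f -> bw w psi ->
  (forall T, exists C, forall t, t <= T -> `|f t| <= C) -> gd w (fun t x => f t * psi x).
Proof.
move=> cf [cpsi [C hC]] fb; split=> [t|x|T].
- exact: continuous_scale.
- exact: (continuous_mulr cf (@continuous_cstr _ _ (psi x))).
have [D hD] := fb T; exists (D * C) => t tT x; rewrite normrM -mulrA.
by apply: ler_pM => //; exact: hD.
Qed.

(* A solution is at least t (B * u0), hence above a small multiple th of a Gaussian-damped profile.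
   Each application of Psi replaces th by th^p and multiplies the damping by r < 1; in the limit
   both disappear. *)
Lemma crude : exists2 c, 0 < c &
  let ell t x := c * L t `^ kap * prof 0 x in
  [/\ gd w ell, forall t x, ell t x <= Psi ell t x &
    forall m, gd w m -> (forall t x, 0 <= m t x) -> (forall t x, Psi m t x = m t x) ->
      forall t x, ell t x <= m t x].
Proof.
have [c c0 hc] := crude_step; exists c => // ell.
have gell : gd w ell.
  apply: gd_sep; last 2 first.
  - exact: bw_prof.
  - move=> T; exists (c * L T `^ kap) => t tT; rewrite ger0_norm; last by nneg.
    by apply: ler_wpM2l; [exact: ltW|apply: le_powR_base => //; [exact: ltW|exact: L_mono]].
  - by apply: continuous_mulr; [exact: continuous_cstr|apply: cLp; exact: ltW].
split=> // [t x|m gm m0 mP t x].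
  (* [th = 1] and [l = 0] are left unchanged by [crude_step], so [ell] is a subsolution. *)
  have := hc ell t 1 0 gell ltr01 (lexx 0) ler01.
  rewrite mulr0 powR_base1 => h; rewrite -[leLHS]mul1r; apply: h => // s y _.
  by rewrite mul1r; exact: lexx.
have [t0|t0] := leP t 0; first by rewrite /ell L_le0// powR0 ?gt_eqF// mulr0 mul0r.
have [A A0 hA] := avg_translate_lower hB (fun x => bw_adm w1 wexp x bu0) bu0.1 u00 u0nz.
have [Ct Ct0 hCt] := L_le_time t; have [Cb Cb0 hCb] := powR_le_expR b0.
have mu s y : u0 y <= m s y by rewrite -mP; exact: Psi_ge_u0.
have mA s y : s <= t -> 0 <= s -> s * (A * gfun 2^-1 y) <= m s y.
  move=> st s0; rewrite -mP; apply: le_trans (Psi_time gm m0 (fun s y _ => mu s y) y st).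
  by apply: ler_wpM2l => //; exact: hA.
have profb y : prof 1 y <= Cb * expR 1 * gfun 2^-1 y.
  have e0 := enorm_ge0 y.
  apply: (@le_trans _ _ (mx y `^ b * gfun 1 y)).
    apply: ler_wpM2r; first exact: gfun_ge0.
    by rewrite ler_piMl ?powR_ge0// ramp_le1.
  apply: (@le_trans _ _ (Cb * expR (enorm y / 2) * gfun 1 y)).
    apply: ler_wpM2r; first exact: gfun_ge0.
    apply: le_trans (hCb _ e0); apply: le_powR_base => //; first exact/ltW/mx_gt0.
    by rewrite /mx ge_max; apply/andP; split; lra.
  rewrite -!mulrA; apply: ler_wpM2l; first exact: ltW.
  rewrite /gfun -!expRD ler_expR.
  by have := sqr_ge0 (enorm y - 1); rewrite expr2; nra.
(* L^kap is at most a multiple of [s] because kap > 1, and the profile with damping 1 is at most a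
   multiple of [gfun 2^-1]. [K] collects these constants, so that the bound linear in time dominates
   A / K times the profile. *)
pose K := c * (Ct * (L t `^ (kap - 1) + 1)) * (Cb * expR 1).
have K0 : 0 < K.
  by rewrite !mulr_gt0 ?expR_gt0// ltr_wpDl// powR_ge0.
pose th := A / K; have th0 : 0 < th by rewrite divr_gt0.
have r0 : 0 <= rr by rewrite /rr; have := hp0; lra.
have r1 : rr < 1 by rewrite /rr; have := hp1; lra.
have start s y : s <= t -> th * (c * L s `^ kap * prof 1 y) <= m s y.
  move=> st; have [s0|s0] := leP s 0.
    by rewrite L_le0// powR0 ?gt_eqF// mulr0 mul0r mulr0.
  apply: le_trans (mA s y st (ltW s0)).
  have hL : L s `^ kap <= s * (Ct * (L t `^ (kap - 1) + 1)).
    rewrite -mulr_powRB1// mulrA [s * Ct]mulrC; apply: ler_pM => //; first exact: powR_ge0.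
      by apply: hCt => //; exact: ltW.
    apply: (@le_trans _ _ (L t `^ (kap - 1))); last by rewrite lerDl.
    by apply: le_powR_base => //; [rewrite subr_ge0 ltW|exact: L_mono].
  rewrite /th mulrAC ler_pdivrMr//.
  have -> : s * (A * gfun 2^-1 y) * K =
    A * (c * (s * (Ct * (L t `^ (kap - 1) + 1))) * (Cb * expR 1 * gfun 2^-1 y)) by rewrite /K; ring.
  apply: ler_wpM2l; first exact: ltW.
  apply: ler_pM; [by nneg|exact: prof_ge0| |exact: profb].
  by apply: ler_wpM2l; first exact: ltW.
have it j s y : s <= t -> th `^ (p ^+ j) * (c * L s `^ kap * prof (rr ^+ j) y) <= m s y.
  elim: j s y => [|j IH] s y st; first by rewrite !expr0 powRr1 ?(ltW th0)//; exact: start.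
  rewrite !exprS [p * _]mulrC powRrM -mP.
  apply: (hc m t _ _ gm _ _ _ IH) => //; [exact: powR_gt0|exact: exprn_ge0|].
  by rewrite exprn_ile1// ltW.
have c1 : th `^ (p ^+ j) @[j --> \oo] --> (1 : R).
  rewrite (_ : (fun j => _) = (fun j => expR (ln th * p ^+ j))); last first.
    by apply/funext => j; rewrite /powR gt_eqF// mulrC.
  rewrite -[X in _ --> X]expR0 -[X in expR X](mulr0 (ln th)).
  apply: (continuous_cvg _ (@continuous_expR R _)); apply: cvgMr.
  by apply: cvg_expr; rewrite gtr0_norm.
have c2 : prof (rr ^+ j) x @[j --> \oo] --> prof 0 x.
  apply: cvgMr; rewrite /gfun; apply: (continuous_cvg _ (@continuous_expR R _)).
  by apply: cvgN; apply: cvgMl; apply: cvg_expr; rewrite ger0_norm.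
have c3 : th `^ (p ^+ j) * (c * L t `^ kap * prof (rr ^+ j) x) @[j --> \oo] --> ell t x.
  by rewrite -[X in _ --> X]mul1r; apply: cvgM => //; exact: cvgMr.
by apply: (ler_cvg_to c3 (cvg_cst _)); apply: nearW => j; exact: it.
Qed.

(** * Sharp lower bounds at infinity *)

Definition zeta M x := ramp M x * mx x `^ b.

Lemma zeta_ge0 M x : 0 <= zeta M x. Proof. by rewrite mulr_ge0 ?ramp_ge0 ?powR_ge0. Qed.

Lemma bw_zeta M : bw w (zeta M).
Proof.
apply: bw_cut => [|x|x]; last 2 first.
- exact: zeta_ge0.
- by rewrite /zeta ler_piMl ?powR_ge0// ramp_le1.
by apply: continuous_mulr; [exact: continuous_ramp|exact: continuous_mx_powR].
Qed.

Lemma avg_cutoff_cvg : avg B (fun z => 1 - ramp k%:R z) @[k --> \oo] --> (1 : R).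
Proof.
rewrite -[X in _ --> X](avg1 hB); apply: (avg_dct hB (C := 1)) => [k|k z|z].
- by apply: continuous_subr; [exact: continuous_cstr|exact: continuous_ramp].
- rewrite mul1r ger0_norm ?subr_ge0 ?ramp_le1//; apply: (@le_trans _ _ 1).
    by rewrite lerBlDr lerDl ramp_ge0.
  by rewrite /expw -expR0 ler_expR divr_ge0 ?enorm_ge0.
- apply: cvg_near_cst; near=> k; rewrite ramp0 ?subr0//.
  near: k; exists (Num.truncn (enorm z)).+1 => // k /= hk.
  by rewrite (le_trans (ltW (truncnS_gt _)))// ler_nat.
Unshelve. all: by end_near. Qed.

(** Most of the mass, at least 1 - d/2, is carried by a fixed ball. For z in it and |x| large, |x -
    z| >= q |x| with q^b >= 1 - d/2, and (1 - d/2)^2 >= 1 - d. *)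
Lemma cv_zeta M d : 0 <= M -> 0 < d -> d < 1 ->
  exists2 M', 1 <= M' & forall x, M' <= enorm x -> (1 - d) * enorm x `^ b <= cv B (zeta M) x.
Proof.
move=> M0 d0 d1; have d2 : 0 < d / 2 by rewrite divr_gt0.
have /cvgrPdist_lt /(_ _ d2)[k _ /(_ k (leqnn k))] := avg_cutoff_cvg.
set chi := fun z => 1 - ramp k%:R z; rewrite ltr_norml => /andP[_ hk].
have q10 : 0 < 1 - d / 2 by lra.
(* The exponent is 1/(b + 1) rather than 1/b, so that q < 1 and q^b >= 1 - d/2 also when [b] is
   0. *)
pose q := (1 - d / 2) `^ (b + 1)^-1.
have b1 : 0 < b + 1 by rewrite ltr_wpDl.
have q0 : 0 < q by exact: powR_gt0.
have q1 : q < 1.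
  rewrite -[ltRHS](powR_base1 (b + 1)^-1); apply: gt0_ltr_powR; rewrite ?nnegrE ?invr_gt0//; last by lra.
  exact: ltW.
have qb : 1 - d / 2 <= q `^ b.
  rewrite /q -powRrM; apply: powR_ge_id => //; [exact: ltW|by lra|by nneg|].
  by rewrite mulrC ler_pdivrMr// mul1r lerDl.
have q1' : 0 < 1 - q by rewrite subr_gt0.
exists (1 + (k%:R + M + 2) + (k%:R + 1) / (1 - q)).
  by rewrite -addrA lerDl; nneg; rewrite subr_ge0 ltW.
move=> x hx; have k0 : 0 <= k%:R :> R by [].
have frac0 : 0 <= (k%:R + 1) / (1 - q) by nneg.
have hx1 : k%:R + M + 2 <= enorm x by lra.
have hx2 : q * enorm x <= enorm x - k%:R - 1.
  have : (k%:R + 1) / (1 - q) <= enorm x by lra.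
  by rewrite ler_pdivrMr//; lra.
have x0 := enorm_ge0 x.
have bchi : bw w (fun=> 1 : R) by exact: bw_cst.
have achi : adm chi.
  split; first by apply: continuous_subr; [exact: continuous_cstr|exact: continuous_ramp].
  exists 1 => z; rewrite mul1r ger0_norm ?subr_ge0 ?ramp_le1//; apply: (@le_trans _ _ 1).
    by rewrite lerBlDr lerDl ramp_ge0.
  by rewrite /expw -expR0 ler_expR divr_ge0 ?enorm_ge0.
have low : (enorm x - k%:R - 1) `^ b * avg B chi <= cv B (zeta M) x.
  rewrite -avgZ//; apply: (le_avg hB).
  - exact: admZ.
  - exact: (bw_adm w1 wexp x (bw_zeta M)).
  move=> z; rewrite /chi; have [zk|zk] := leP (enorm z) (k%:R + 1).
    have xz : enorm x - k%:R - 1 <= enorm (x - z) by have := enorm_distl x z; lra.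
    apply: (@le_trans _ _ ((enorm x - k%:R - 1) `^ b)).
      by rewrite ler_piMr ?powR_ge0// lerBlDr lerDl ramp_ge0.
    rewrite /zeta ramp1 ?mul1r; last by lra.
    apply: le_powR_base => //; first by lra.
    by rewrite (le_trans xz)// /mx le_max lexx orbT.
  by rewrite ramp1 ?(ltW zk)// subrr mulr0 zeta_ge0.
apply: le_trans low.
apply: (@le_trans _ _ ((1 - d / 2) * enorm x `^ b * (1 - d / 2))).
  rewrite mulrAC; apply: ler_wpM2r; first exact: powR_ge0.
  by have := sqr_ge0 d; rewrite expr2; nra.
apply: ler_pM; [by nneg|exact: ltW| |by lra].
apply: (@le_trans _ _ ((q * enorm x) `^ b)).
  by rewrite powRM ?(ltW q0)//; apply: ler_wpM2r => //; exact: powR_ge0.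
by apply: le_powR_base => //; nneg.
Qed.

(** The computation of [crude_step] with the averaging now costing only 1 - d, by [cv_zeta]. Each
    use enlarges the radius, so it may be applied finitely often only. *)
Lemma sharpen M c d : 1 <= M -> 0 < c -> 0 < d -> d < 1 ->
  exists2 M', 1 <= M' & forall m, gd w m -> (forall t x, 0 <= m t x) ->
    (forall t x, M <= enorm x -> c * L t `^ kap * enorm x `^ b <= m t x) ->
    forall t x, M' <= enorm x ->
      (1 - d) * (1 - p) * thl * c `^ p * L t `^ kap * enorm x `^ b <= Psi m t x.
Proof.
move=> M1 c0 d0 d1; have M0 : 0 <= M by lra.
have [M' M'1 hM] := cv_zeta M0 d0 d1; exists M' => // m gm m0 hm t x Mx.
pose f s := thl * c `^ p * (g s * L s `^ (kap - 1)).
have k10 : 0 <= kap - 1 by rewrite subr_ge0 ltW.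
have cgL : continuous (fun s => g s * L s `^ (kap - 1)).
  by apply: continuous_mulr => //; exact: cLp.
have cf : continuous f by exact: continuous_scale.
have h : forall s y, 0 <= s -> s <= t -> f s * zeta M y <= Nl m s y.
  move=> s y s0 st.
  rewrite /Nl; apply: (@le_trans _ _ (W y s * pw (m s y))); last by rewrite lerDr.
  have [yM|yM] := leP (enorm y) M.
    by rewrite /zeta ramp0// mul0r mulr0 mulr_ge0// pw_ge0.
  have y1 : 1 <= enorm y by lra.
  have ms := hm s y (ltW yM).
  have y0 := enorm_ge0 y.
  have hp : c `^ p * L s `^ (kap - 1) * enorm y `^ (b * p) <= pw (m s y).
    apply: le_trans (le_pw ms); rewrite pwE; last by nneg.
    by rewrite !powRM; [rewrite -!powRrM kapp|nneg..].
  have q1 : 0 <= thl * g s * enorm y `^ sigma by nneg.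
  apply: le_trans (ler_pM q1 _ (Wl s y1) hp); last by nneg.
  rewrite /f /zeta mxE1// -{1}bp powRD_pos; last by lra.
  have -> : thl * g s * enorm y `^ sigma * (c `^ p * L s `^ (kap - 1) * enorm y `^ (b * p)) =
    thl * c `^ p * (g s * L s `^ (kap - 1)) * (1 * (enorm y `^ sigma * enorm y `^ (b * p))) by ring.
  apply: ler_wpM2l; first by nneg.
  by apply: ler_wpM2r; [nneg|exact: ramp_le1].
apply: le_trans (Psi_lower gm cf (bw_zeta M) h x (lexx t)).
rewrite int0Z// L_int// subrK kapV.
have -> : (1 - d) * (1 - p) * thl * c `^ p * L t `^ kap * enorm x `^ b =
  thl * c `^ p * (L t `^ kap * (1 - p)) * ((1 - d) * enorm x `^ b) by ring.
by apply: ler_wpM2l; [nneg|exact: hM].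
Qed.

Lemma gd_iter j m : gd w m -> gd w (iter j Psi m).
Proof. by move=> gm; elim: j => //= j IH; exact: gd_Psi. Qed.

Lemma iter_ge0 j m : gd w m -> (forall t x, 0 <= m t x) -> forall t x, 0 <= iter j Psi m t x.
Proof. by move=> gm m0; elim: j => //= j IH; apply: Psi_ge0 => //; exact: gd_iter. Qed.

(* The iterates of c |-> A c^p, whose attracting fixed point is A^kap. *)
Definition csharp (A s0 : R) (j : nat) : R := A `^ kap * s0 `^ (p ^+ j).

Lemma csharpS A s0 j : 0 < A -> 0 < s0 -> A * csharp A s0 j `^ p = csharp A s0 j.+1.
Proof.
move=> A0 s00; rewrite /csharp powRM ?powR_ge0// -!powRrM kapp mulrA.
by rewrite -{1}[A](powRr1 (ltW A0)) -powRD_pos// addrC subrK exprSr.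
Qed.

(** [s0] measures the initial constant in units of the fixed point A^kap. Truncating it at 1 merely
    lowers that constant and lets the sequence increase to the fixed point. *)
Lemma sharp_iter d c0 j : 0 < c0 -> 0 < d -> d < 1 ->
  let A := (1 - d) * (1 - p) * thl in let s0 := Num.min 1 (c0 / A `^ kap) in
  exists2 M, 1 <= M & forall m, gd w m -> (forall t x, 0 <= m t x) ->
    (forall t x, 2 <= enorm x -> c0 * L t `^ kap * enorm x `^ b <= m t x) ->
    forall t x, M <= enorm x -> csharp A s0 j * L t `^ kap * enorm x `^ b <= iter j Psi m t x.
Proof.
move=> c00 d0 d1 A s0.
have A0 : 0 < A by rewrite !mulr_gt0// subr_gt0.
have Ak : 0 < A `^ kap by exact: powR_gt0.
have s00 : 0 < s0 by rewrite lt_min ltr01 divr_gt0.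
elim: j => [|j [M M1 IH]].
  exists 2; first by rewrite ler1n.
  move=> m gm m0 hm t x hx; apply: le_trans (hm t x hx).
  apply: ler_wpM2r; first exact: powR_ge0.
  apply: ler_wpM2r; first exact: powR_ge0.
  rewrite /csharp expr0 powRr1 ?(ltW s00)// mulrC -ler_pdivlMr//.
  by rewrite ge_min lexx orbT.
have cj0 : 0 < csharp A s0 j by rewrite mulr_gt0// powR_gt0.
have [M' M'1 hM] := sharpen M1 cj0 d0 d1.
exists M' => // m gm m0 hm t x hx; rewrite -csharpS//=.
apply: hM => //; [exact: gd_iter|exact: iter_ge0|].
by move=> s y; exact: IH.
Qed.

(** csharp^(1-p) is [A] times a power of [s0] whose exponent tends to 0. The power [p - 1] is the
    one that appears in the Lipschitz constant. *)
Lemma csharp_lim A s0 d : 0 < A -> 0 < s0 -> s0 <= 1 -> 0 < d -> d < 1 ->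
  exists j, csharp A s0 j `^ (p - 1) <= ((1 - d) * A)^-1.
Proof.
move=> A0 s00 s01 d0 d1.
have ln0 : ln s0 <= 0 by exact: ln_le0.
have /cvgrPdist_lt /(_ _ d0)[j _ /(_ j (leqnn j))] :
    ((1 - p) * ln s0 * p ^+ j) @[j --> \oo] --> (1 - p) * ln s0 * 0.
  by apply: cvgMr; apply: cvg_expr; rewrite gtr0_norm.
rewrite mulr0 sub0r normrN ltr_norml => /andP[hj _].
exists j; rewrite -[p - 1]opprB powRN lef_pV2 ?posrE ?powR_gt0 ?mulr_gt0 ?subr_gt0 ?powR_gt0//.
rewrite /csharp powRM ?powR_ge0// -!powRrM mulVf ?gt_eqF// powRr1 ?(ltW A0)// mulrC.
apply: ler_wpM2l; first exact: ltW.
rewrite /powR gt_eqF//; apply: le_trans (expR_ge1Dx _).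
have -> : p ^+ j * (1 - p) * ln s0 = (1 - p) * ln s0 * p ^+ j by ring.
by lra.
Qed.

(** The bound for large |x| carries the sharp constant; the one linear in [t], valid everywhere,
    serves on the ball of radius [M], where the potential may vanish. *)
Definition good c M A m := [/\ gd w m, forall t x, 0 <= m t x,
  forall t x, M <= enorm x -> c * L t `^ kap * enorm x `^ b <= m t x &
  forall t x, t * (A * gfun 2^-1 x) <= m t x].

Lemma iter_ge_sub (ell m : R -> 'rV[R]_n -> R) j : gd w ell -> gd w m ->
  (forall t x, ell t x <= Psi ell t x) -> (forall t x, ell t x <= m t x) ->
  forall t x, ell t x <= iter j Psi m t x.
Proof.
move=> ge gm he hm; elim: j => [|j IH]; first exact: hm.
move=> t x; apply: le_trans (he t x) _; rewrite iterS.
exact: (le_Psi ge (gd_iter j gm) (fun s y _ => IH s y) x (lexx t)).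
Qed.

Lemma good_exists c0 d : 0 < c0 -> 0 < d -> d < 1 ->
  let ell t x := c0 * L t `^ kap * prof 0 x in
  gd w ell -> (forall t x, ell t x <= Psi ell t x) ->
  exists c M A J, [/\ 0 < c, 1 <= M, 0 < A, c `^ (p - 1) <= ((1 - d) ^+ 2 * (1 - p) * thl)^-1 &
    forall m, gd w m -> (forall t x, 0 <= m t x) -> (forall t x, ell t x <= m t x) ->
      good c M A (iter J Psi m)].
Proof.
move=> c00 d0 d1 ell gell hell.
pose A := (1 - d) * (1 - p) * thl; pose s0 := Num.min 1 (c0 / A `^ kap).
have A0 : 0 < A by rewrite !mulr_gt0// subr_gt0.
have s00 : 0 < s0 by rewrite lt_min ltr01 divr_gt0// powR_gt0.
have s01 : s0 <= 1 by rewrite ge_min lexx.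
have [j hj] := csharp_lim A0 s00 s01 d0 d1.
have [M M1 hM] := sharp_iter j c00 d0 d1.
have [a a0 ha] := avg_translate_lower hB (fun x => bw_adm w1 wexp x bu0) bu0.1 u00 u0nz.
(* [j] applications sharpen the constant. The two extra ones, read as the outermost, give the bound
   linear in [t]: the first lifts the function above [u0], the second applies [Psi_time]. The square
   of 1 - d has one factor from averaging and one from stopping at [j]. *)
exists (csharp A s0 j), M, a, (j + 2)%N; split=> //.
- by rewrite mulr_gt0// powR_gt0.
- by apply: le_trans hj _; rewrite /A expr2 -!mulrA.
move=> m gm m0 hm; split.
- exact: gd_iter.
- exact: iter_ge0.
- move=> t x Mx; rewrite iterD.
  apply: (hM _ (gd_iter 2 gm) (iter_ge0 2 gm m0) _ t x Mx) => s y y2.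
  have y1 : 1 <= enorm y by lra.
  apply: le_trans (iter_ge_sub 2 gell gm hell hm s y).
  rewrite /ell /prof ramp1; last by lra.
  by rewrite mxE1// /gfun mul0r oppr0 expR0 mulr1 mul1r.
- move=> t x; rewrite addn2 !iterS; set m1 := iter j Psi m.
  have g1 : gd w m1 by exact: gd_iter.
  have p1' : forall t x, 0 <= m1 t x by exact: iter_ge0.
  have h := Psi_time (gd_Psi g1) (Psi_ge0 g1 p1') (fun s y _ => Psi_ge_u0 s y g1 p1') x (lexx t).
  have [t0|t0] := leP 0 t.
    by apply: le_trans h; apply: ler_wpM2l => //; exact: ha.
  apply: le_trans (Psi_ge0 (gd_Psi g1) (Psi_ge0 g1 p1') t x).
  by apply: mulr_le0_ge0; [exact: ltW|apply: mulr_ge0; [exact: ltW|exact: gfun_ge0]].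
Qed.

(* For |x| >= M the lower bound gives the term in g / L.  For |x| < M only t^(p-1) is available:
   it is absorbed by 1 / L for small t and bounded otherwise. *)
Lemma good_lip c M A T : 0 < c -> 1 <= M -> 0 < A -> exists2 C, 0 <= C &
  forall m m', good c M A m -> good c M A m' -> forall t x, 0 < t -> t <= T ->
    `|Nl m t x - Nl m' t x| <=
    (1 + C + p * thu * c `^ (p - 1) * (g t / L t)) * `|m t x - m' t x|.
Proof.
move=> c0 M1 A0; set k := p * thu * c `^ (p - 1).
have k0 : 0 < k by rewrite !mulr_gt0 ?powR_gt0.
pose G := A * expR (- (2^-1 * M ^+ 2)).
have G0 : 0 < G by rewrite mulr_gt0 ?expR_gt0.
pose C1 := thu * M `^ sigma * (p * G `^ (p - 1)).
have M0 : 0 < M by lra.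
have C10 : 0 < C1 by rewrite !mulr_gt0 ?powR_gt0.
have [Ct Ct0 hCt] := L_le_time T; have [D D0 hD] := gub T.
(* Chosen so that C1 Ct t1^p = k: since 1/t <= Ct / L t, the term in t^(p-1) stays below k g / L up
   to time [t1]. *)
pose t1 := (k / (C1 * Ct)) `^ p^-1.
have t10 : 0 < t1 by rewrite powR_gt0// divr_gt0// mulr_gt0.
have t1p : t1 `^ p = k / (C1 * Ct).
  rewrite /t1 -powRrM mulVf ?gt_eqF// powRr1//; apply: ltW.
  by apply: divr_gt0 => //; exact: mulr_gt0.
exists (C1 * D * t1 `^ (p - 1)); first by nneg.
set C := C1 * D * t1 `^ (p - 1) => m m' [gm m0 mM mA] [gm' m0' mM' mA'] t x t0 tT.
have C0 : 0 <= C by rewrite /C; nneg.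
have Lt := L_gt0 t0.
have kg : 0 <= k * (g t / L t) by nneg.
have suf : W x t * `|m t x `^ p - m' t x `^ p| <= (C + k * (g t / L t)) * `|m t x - m' t x|.
  have low lo : 0 < lo -> lo <= m t x -> lo <= m' t x ->
      W x t * (p * lo `^ (p - 1)) <= C + k * (g t / L t) ->
      W x t * `|m t x `^ p - m' t x `^ p| <= (C + k * (g t / L t)) * `|m t x - m' t x|.
    move=> lo0 h1 h2 h3; apply: le_trans (ler_wpM2l (W0 x t) (ler_powR_lip hp0 hp1 lo0 h1 h2)) _.
    by rewrite [leLHS]mulrA; apply: ler_wpM2r.
  have [xM|xM] := leP M (enorm x).
    have x1 : 1 <= enorm x by exact: le_trans xM.
    have x0 : 0 < enorm x by lra.
    apply: (low (c * L t `^ kap * enorm x `^ b)); [by rewrite !mulr_gt0 ?powR_gt0|exact: mM|exact: mM'|].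
    apply: (@le_trans _ _ (k * (g t / L t))); last by rewrite lerDr.
    apply: le_trans (ler_wpM2r _ (Wu x t)) _; first by nneg.
    rewrite mxE1// !powRM; try by nneg.
    rewrite -!powRrM.
    have -> : kap * (p - 1) = - 1 by rewrite mulrBr kapp; ring.
    have -> : b * (p - 1) = - sigma by rewrite mulrBr mulr1 -[in X in _ - X]bp; ring.
    rewrite !powRN powRr1; last exact: ltW.
    have xs : enorm x `^ sigma != 0 by rewrite gt_eqF// powR_gt0.
    rewrite le_eqVlt; apply/orP; left; apply/eqP; rewrite /k; field.
    by rewrite xs gt_eqF.
  have hG : t * G <= t * (A * gfun 2^-1 x).
    apply: ler_wpM2l; first exact: ltW.
    apply: ler_wpM2l; first exact: ltW.
    rewrite /gfun ler_expR lerN2; apply: ler_wpM2l => //.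
    by rewrite lerXn2r ?nnegrE ?enorm_ge0//; exact: ltW.
  apply: (low (t * G)); [exact: mulr_gt0|exact: le_trans hG (mA t x)|exact: le_trans hG (mA' t x)|].
  have hW : W x t <= thu * g t * M `^ sigma.
    apply: le_trans (Wu x t) _; apply: ler_wpM2l; first by nneg.
    by apply: le_powR_base => //; [exact/ltW/mx_gt0|rewrite /mx ge_max M1/= ltW].
  apply: le_trans (ler_wpM2r _ hW) _; first by nneg.
  rewrite powRM; [|exact: ltW..].
  have -> : thu * g t * M `^ sigma * (p * (t `^ (p - 1) * G `^ (p - 1))) = C1 * g t * t `^ (p - 1).
    by rewrite /C1; ring.
  have [tt|tt] := leP t t1.
    apply: (@le_trans _ _ (k * (g t / L t))); last by rewrite lerDr.
    have -> : t `^ (p - 1) = t `^ p / t.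
      by rewrite powRD_pos// powRN powRr1// ltW.
    have h1 : t `^ p <= k / (C1 * Ct) by rewrite -t1p; apply: le_powR_base => //; exact: ltW.
    have h2 : t^-1 <= Ct / L t.
      rewrite ler_pdivlMr// mulrC ler_pdivrMr//; apply: hCt => //; exact: ltW.
    apply: (@le_trans _ _ (C1 * g t * (k / (C1 * Ct) * (Ct / L t)))).
      apply: ler_wpM2l; first by nneg.
      by apply: ler_pM => //; nneg.
    by rewrite le_eqVlt; apply/orP; left; apply/eqP; field; rewrite !gt_eqF.
  apply: (@le_trans _ _ C); last by rewrite lerDl.
  apply: ler_pM; [by nneg|exact: powR_ge0| |].
    by apply: ler_wpM2l; [exact: ltW|exact: hD].
  rewrite -[p - 1]opprB !powRN lef_pV2 ?posrE; [|exact: powR_gt0..].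
  by apply: le_powR_base; exact: ltW.
have NE m1 : 0 <= m1 t x -> Nl m1 t x = m1 t x + W x t * m1 t x `^ p.
  by move=> h; rewrite /Nl pwE.
rewrite (NE m)// (NE m')// (_ : _ - _ = (m t x - m' t x) + W x t * (m t x `^ p - m' t x `^ p)); last by ring.
apply: le_trans (ler_normD _ _) _; rewrite normrM (ger0_norm (W0 x t)) -addrA mulrDl mul1r.
by rewrite lerD2l.
Qed.

(** * Contraction in the weighted norm and smoothing at time 0 *)

Let CB0 : 0 <= CB.
Proof.
have h : 0 <= cv B w 0.
  by apply: (cv_ge0 hB w1 wexp); [exact: bw_w|move=> y; exact: ltW].
have : 0 <= CB * w 0 by exact: le_trans h (wavg 0).
by rewrite pmulr_lge0.
Qed.

(** The regular part of the Lipschitz constant gains 1/K from the integral of exp(K s); the singular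
    part meets L^al as g L^(al-1), which integrates to L^al / al. A large [K] leaves CB k / al as
    the effective ratio. *)
Lemma contraction c M A T (al : R) : 0 < c -> 1 <= M -> 0 < A -> 1 <= al ->
  exists2 C, 0 <= C & forall K D m m', 0 < K -> 0 <= D -> good c M A m -> good c M A m' ->
    (forall t x, t <= T -> `|m t x - m' t x| <= D * (L t `^ al * expR (K * t)) * w x) ->
    forall t x, t <= T -> `|Psi m t x - Psi m' t x| <=
      CB * ((1 + C) / K + p * thu * c `^ (p - 1) / al) * D * (L t `^ al * expR (K * t)) * w x.
Proof.
move=> c0 M1 A0 al1; have [C C0 hC] := good_lip T c0 M1 A0; exists C => // K D m m' K0 D0 gm gm' hD.
set k := p * thu * c `^ (p - 1); have k0 : 0 <= k by rewrite /k; nneg.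
have al0 : 0 < al by lra.
have al10 : 0 <= al - 1 by lra.
have cE : continuous (fun s => expR (K * s)) by exact: continuous_expRM.
have cgL : continuous (fun s => g s * L s `^ (al - 1)) by apply: continuous_mulr => //; exact: cLp.
have cLa : continuous (fun s => L s `^ al) by apply: cLp; exact: ltW.
pose f s := D * ((1 + C) * (L s `^ al * expR (K * s)) + k * (g s * L s `^ (al - 1) * expR (K * s))).
have cf : continuous f.
  apply: continuous_mulr; first exact: continuous_cstr.
  by apply: continuous_addr; apply: continuous_mulr; try exact: continuous_cstr; exact: continuous_mulr.
have f0 s : 0 <= f s by rewrite /f; nneg.
have hf : forall s y, 0 <= s -> s <= T -> `|Nl m s y - Nl m' s y| <= f s * w y.
  (* At time 0 the weight vanishes and the two functions agree; [good_lip] covers positive times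
     only. *)
  move=> s y s0 sT; have h := hD s y sT; move: s0; rewrite le_eqVlt => /predU1P[s0|s0].
    move: h; rewrite -s0 L_le0// powR0 ?gt_eqF// mul0r mulr0 mul0r normr_le0 subr_eq0 => /eqP h.
    by rewrite /Nl h subrr normr0; nneg.
  apply: le_trans (hC m m' gm gm' s y s0 sT) _.
  have kg : 0 <= 1 + C + k * (g s / L s) by nneg.
  apply: le_trans (ler_wpM2l kg h) _.
  have Ls : L s != 0 by rewrite gt_eqF// L_gt0.
  rewrite /f -(mulr_powRB1 (L_ge0 s) al0) le_eqVlt; apply/orP; left; apply/eqP; field.
  exact: Ls.
have [[gm1 _ _ _] [gm2 _ _ _]] := (gm, gm').
move=> t x tT; apply: le_trans (Psi_diff gm1 gm2 cf hf x tT) _.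
apply: ler_wpM2r; first exact: ltW.
have -> : CB * ((1 + C) / K + k / al) * D * (L t `^ al * expR (K * t)) =
  (D * ((1 + C) / K + k / al) * (L t `^ al * expR (K * t))) * CB by ring.
apply: ler_wpM2r => //.
pose h1 s := D * (1 + C) * L t `^ al * expR (K * s).
pose h2 s := D * k * expR (K * t) * (g s * L s `^ (al - 1)).
have c1 : continuous h1 by exact: continuous_scale.
have c2 : continuous h2 by exact: continuous_scale.
apply: (@le_trans _ _ (int0 t (fun s => h1 s + h2 s))).
  apply: le_int0 => // [|s s0 st]; first exact: continuous_addr.
  rewrite /f /h1 /h2 mulrDr; apply: lerD.
    rewrite !mulrA; apply: ler_wpM2r; first exact: expR_ge0.
    by apply: ler_wpM2l; [nneg|apply: le_powR_base => //; [exact: ltW|exact: L_mono]].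
  have -> : D * (k * (g s * L s `^ (al - 1) * expR (K * s))) =
    D * k * (g s * L s `^ (al - 1)) * expR (K * s) by ring.
  have -> : D * k * expR (K * t) * (g s * L s `^ (al - 1)) =
    D * k * (g s * L s `^ (al - 1)) * expR (K * t) by ring.
  by apply: ler_wpM2l; [nneg|rewrite ler_expR ler_pM2l].
rewrite int0D// !int0Z// L_int// subrK.
apply: (@le_trans _ _ (D * (1 + C) * L t `^ al * (expR (K * t) / K) + D * k * expR (K * t) * (L t `^ al / al))).
  by rewrite lerD2r; apply: ler_wpM2l; [nneg|exact: int0_expR_le].
by rewrite le_eqVlt; apply/orP; left; apply/eqP; field; rewrite !gt_eqF.
Qed.

(** The bound |x^p - y^p| <= |x - y|^p requires no positive lower bound on the functions, and [wpow]
    preserves the spatial weight. With [al = 0] the lemma also expresses the continuity of [Psi]. *)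
Lemma smoothing m m' T al D : gd w m -> gd w m' -> (forall t x, 0 <= m t x) ->
  (forall t x, 0 <= m' t x) -> 0 <= al -> 0 <= D ->
  (forall t x, t <= T -> `|m t x - m' t x| <= D * L t `^ al * w x) ->
  forall t x, t <= T -> `|Psi m t x - Psi m' t x| <=
    int0 t (fun s => D * L s `^ al + thu * D `^ p * (g s * L s `^ (al * p))) * CB * w x.
Proof.
move=> gm gm' m0 m0' al0 D0 hD.
have alp : 0 <= al * p by nneg.
have cgL : continuous (fun s => g s * L s `^ (al * p)) by apply: continuous_mulr; [exact: cg|exact: cLp].
apply: Psi_diff => //.
  by apply: continuous_addr; apply: continuous_scale; [exact: cLp|exact: cgL].
move=> s y s0 sT; have h := hD s y sT.
have wy : 0 <= w y by exact: ltW.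
have NE m1 : 0 <= m1 s y -> Nl m1 s y = m1 s y + W y s * m1 s y `^ p.
  by move=> h1; rewrite /Nl pwE.
rewrite (NE m)// (NE m')//.
rewrite (_ : _ - _ = (m s y - m' s y) + W y s * (m s y `^ p - m' s y `^ p)); last by ring.
apply: le_trans (ler_normD _ _) _; rewrite mulrDl; apply: lerD => //.
rewrite normrM (ger0_norm (W0 y s)).
have h1 : `|m s y `^ p - m' s y `^ p| <= D `^ p * L s `^ (al * p) * w y `^ p.
  apply: le_trans (ler_powR_dist hp0 hp1 (m0 s y) (m0' s y)) _.
  rewrite powRrM -powRM//; last exact: powR_ge0.
  rewrite -powRM//; last by nneg.
  by apply: le_powR_base => //; exact: ltW.
apply: le_trans (ler_pM (W0 _ _) (normr_ge0 _) (Wu y s) h1) _.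
have -> : thu * g s * mx y `^ sigma * (D `^ p * L s `^ (al * p) * w y `^ p) =
  thu * D `^ p * (g s * L s `^ (al * p)) * (mx y `^ sigma * w y `^ p) by ring.
by apply: ler_wpM2l; [nneg|exact: wpow].
Qed.

(** The nonlinear part yields the order 1 + p al exactly. The linear part gains a full power of L,
    as t <= C L t, and its surplus is bounded by a power of [L T]. *)
Lemma smoothing_step m m' T al D : gd w m -> gd w m' -> (forall t x, 0 <= m t x) ->
  (forall t x, 0 <= m' t x) -> 0 <= al -> 0 <= D ->
  (forall t x, t <= T -> `|m t x - m' t x| <= D * L t `^ al * w x) ->
  exists2 D', 0 <= D' &
    forall t x, t <= T -> `|Psi m t x - Psi m' t x| <= D' * L t `^ (1 + p * al) * w x.
Proof.
move=> gm gm' m0 m0' al0 D0 hD; have [C C0 hC] := time_le_L T.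
have alp : 0 <= al * p by nneg.
have al1 : 0 <= al - al * p by rewrite -{1}[al]mulr1 -mulrBr; nneg.
have cgL : continuous (fun s => g s * L s `^ (al * p)) by apply: continuous_mulr; [exact: cg|exact: cLp].
exists ((D * C * L T `^ (al - al * p) + thu * D `^ p / (al * p + 1)) * CB); first by nneg.
move=> t x tT; apply: le_trans (smoothing gm gm' m0 m0' al0 D0 hD x tT) _.
apply: ler_wpM2r; first exact: ltW.
rewrite -mulrA [CB * _]mulrC mulrA; apply: ler_wpM2r; first exact: CB0.
rewrite int0D; [|by apply: continuous_scale; exact: cLp|exact: continuous_scale].
rewrite [X in _ + X]int0Z// L_int// mulrDl.
rewrite [1 + p * al]addrC [p * al]mulrC; apply: lerD; last first.
  by rewrite le_eqVlt; apply/orP; left; apply/eqP; ring.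
have [t0|t0] := leP t 0; first by rewrite int0_le0//; nneg.
apply: (@le_trans _ _ (int0 t (fun=> D * L t `^ al))).
  apply: le_int0; [by apply: continuous_scale; exact: cLp|exact: continuous_cstr|move=> s s0 st].
  by apply: ler_wpM2l; [exact: D0|apply: le_powR_base; [exact: al0|exact: L_ge0|exact: L_mono]].
rewrite int0_cst ?(ltW t0)//.
apply: (@le_trans _ _ (D * L t `^ al * (C * L t))).
  by apply: ler_wpM2l; [nneg|exact: hC].
have -> : L t `^ al = L t `^ (al - al * p) * L t `^ (al * p) by rewrite -powRD_nneg// subrK.
rewrite (powRD_nneg (L t) alp ler01) (powRr1 (L_ge0 t)).
have -> : D * (L t `^ (al - al * p) * L t `^ (al * p)) * (C * L t) =
  D * C * L t `^ (al - al * p) * (L t `^ (al * p) * L t) by ring.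
apply: ler_wpM2r; first by nneg.
by apply: ler_wpM2l; [nneg|apply: le_powR_base; [exact: al1|exact: L_ge0|exact: L_mono]].
Qed.

(* The iterates of al |-> 1 + p al from 0; they increase to kap. *)
Definition alpha (j : nat) : R := (1 - p ^+ j) * kap.

Lemma alphaS j : alpha j.+1 = 1 + p * alpha j.
Proof. by rewrite /alpha /kap exprS; field; rewrite gt_eqF. Qed.

Lemma alpha_ge0 j : 0 <= alpha j.
Proof.
apply: mulr_ge0; last exact: ltW.
by rewrite subr_ge0 exprn_ile1// ltW.
Qed.

Lemma smoothing_iter m m' T j : gd w m -> gd w m' -> (forall t x, 0 <= m t x) ->
  (forall t x, 0 <= m' t x) -> exists2 D, 0 <= D &
    forall t x, t <= T -> `|iter j Psi m t x - iter j Psi m' t x| <= D * L t `^ alpha j * w x.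
Proof.
move=> gm gm' m0 m0'; elim: j => [|j [D D0 IH]].
  have [_ _ /(_ T)[C hC]] := gm; have [_ _ /(_ T)[C' hC']] := gm'.
  have C0 : 0 <= C := bound_ge0 w1 (hC T (lexx _)).
  have C0' : 0 <= C' := bound_ge0 w1 (hC' T (lexx _)).
  exists (C + C'); first by nneg.
  move=> t x tT; rewrite /alpha expr0 subrr mul0r powRr0 mulr1 mulrDl.
  by apply: le_trans (ler_normB _ _) _; apply: lerD; [exact: hC|exact: hC'].
rewrite alphaS !iterS.
exact: (smoothing_step (gd_iter j gm) (gd_iter j gm') (iter_ge0 j gm m0) (iter_ge0 j gm' m0')
  (alpha_ge0 j) D0 IH).
Qed.

(** The condition [1 <= alpha j], true from [j = 1] on, keeps the exponent al - 1 in [contraction]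
    nonnegative. *)
Lemma alpha_lim d : 0 < d -> exists j, 1 <= alpha j /\ (1 - d) * kap <= alpha j.
Proof.
move=> d0; have /cvgrPdist_lt /(_ _ d0)[j _ hj] : p ^+ j @[j --> \oo] --> (0 : R).
  by apply: cvg_expr; rewrite gtr0_norm.
exists j.+1; have := hj j.+1 (leqnSn j); rewrite sub0r normrN gtr0_norm ?exprn_gt0// => h.
split; last by apply: ler_wpM2r; [exact: ltW|lra].
rewrite /alpha -[leLHS](mulfV (lt0r_neq0 p1)); apply: ler_wpM2r; first exact: ltW.
by rewrite lerD2l lerN2 exprS ler_piMr// ?exprn_ile1// ltW.
Qed.

(** The quantity assumed below 1 dominates CB k / al, through the bound on c^(p-1) from
    [good_exists] and al >= (1 - d) kap. Neither [rho] nor [k0] depends on [T]: the horizon enters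
    through [K] and [D] only. *)
Lemma contract_iter d c0 : 0 < d -> d < 1 -> 0 < c0 ->
  CB * (p * thu / ((1 - d) ^+ 2 * (1 - p) * thl)) / ((1 - d) * kap) < 1 ->
  let ell t x := c0 * L t `^ kap * prof 0 x in
  gd w ell -> (forall t x, ell t x <= Psi ell t x) ->
  exists rho k0, [/\ 0 <= rho, rho < 1 &
    forall m m', gd w m -> gd w m' -> (forall t x, 0 <= m t x) -> (forall t x, 0 <= m' t x) ->
    (forall t x, ell t x <= m t x) -> (forall t x, ell t x <= m' t x) ->
    forall T, exists D, forall k t x, t <= T ->
      `|iter (k + k0) Psi m t x - iter (k + k0) Psi m' t x| <= D * rho ^+ k * w x].
Proof.
move=> d0 d1 c00 hq ell gell hell.
have [c [M [A [J [cp M1 A0 hc hgood]]]]] := good_exists c00 d0 d1 gell hell.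
have [j [al1 ald]] := alpha_lim d0; set al := alpha j in al1 ald.
set k := p * thu * c `^ (p - 1).
have al0 : 0 < al by lra.
pose r0 := CB * (k / al).
have d1' : 0 < 1 - d by rewrite subr_gt0.
have r0lt : r0 < 1.
  apply: le_lt_trans hq; rewrite /r0 -mulrA; apply: ler_wpM2l; first exact: CB0.
  apply: ler_pM; [by rewrite /k; nneg|by nneg| |].
    by rewrite /k; apply: ler_wpM2l; [nneg|exact: hc].
  by rewrite lef_pV2 ?posrE// mulr_gt0.
have r00 : 0 <= r0 by rewrite /r0 /k; nneg.
(* [r0] is the singular part of the ratio; half of its distance to 1 is reserved for the regular
   part, which the choice of [K] below makes that small. *)
pose rho := (1 + r0) / 2.
have rho0 : 0 <= rho by rewrite /rho; lra.
(* [J] applications make both functions [good], and [j] more make their difference of order L^al. *)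
exists rho, (J + j)%N; split=> //; first by rewrite /rho; lra.
move=> m m' gm gm' m0 m0' hm hm' T.
have good_it i n1 : gd w n1 -> (forall t x, 0 <= n1 t x) -> (forall t x, ell t x <= n1 t x) ->
    good c M A (iter (i + (J + j)) Psi n1).
  move=> g1 p1' h1; rewrite addnCA iterD; apply: hgood.
  - exact: gd_iter.
  - exact: iter_ge0.
  - exact: (iter_ge_sub _ gell g1 hell h1).
have [C C0 hC] := contraction T cp M1 A0 al1.
pose K := 1 + 2 * CB * (1 + C) / (1 - r0).
have r01 : 0 < 1 - r0 by lra.
have K0 : 0 < K by rewrite /K; apply: ltr_wpDr => //; nneg.
have hK : CB * ((1 + C) / K + k / al) <= rho.
  have : CB * ((1 + C) / K) <= (1 - r0) / 2.
    rewrite mulrA ler_pdivrMr// /K.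
    have -> : (1 - r0) / 2 * (1 + 2 * CB * (1 + C) / (1 - r0)) = (1 - r0) / 2 + CB * (1 + C).
      by field; rewrite gt_eqF.
    by rewrite lerDr; lra.
  by rewrite mulrDr -/r0 /rho; lra.
have gJ : gd w (iter J Psi m) by exact: gd_iter.
have gJ' : gd w (iter J Psi m') by exact: gd_iter.
have [D D0 hD] := smoothing_iter T j gJ gJ' (iter_ge0 J gm m0) (iter_ge0 J gm' m0').
have key : forall i t x, t <= T ->
    `|iter (i + (J + j)) Psi m t x - iter (i + (J + j)) Psi m' t x| <=
    D * rho ^+ i * (L t `^ al * expR (K * t)) * w x.
  elim=> [|i IH] t x tT.
    rewrite add0n addnC !iterD expr0 mulr1; apply: le_trans (hD t x tT) _.
    apply: ler_wpM2r; first exact: ltW.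
    apply: ler_wpM2l => //; have [t0|t0] := leP t 0.
      by rewrite L_le0// powR0 ?gt_eqF// mul0r.
    rewrite ler_peMr ?powR_ge0// -expR0 ler_expR; apply: mulr_ge0; exact: ltW.
  rewrite addSn !iterS.
  have Dr : 0 <= D * rho ^+ i by rewrite mulr_ge0 ?exprn_ge0.
  apply: le_trans (hC K _ _ _ K0 Dr (good_it i m gm m0 hm) (good_it i m' gm' m0' hm') IH t x tT) _.
  apply: ler_wpM2r; first exact: ltW.
  apply: ler_wpM2r; first by nneg.
  rewrite exprS (_ : D * (rho * rho ^+ i) = rho * (D * rho ^+ i)); last by rewrite mulrCA.
  exact: ler_wpM2r.
exists (D * (L T `^ al * expR (K * T))) => i t x tT; apply: le_trans (key i t x tT) _.
apply: ler_wpM2r; first exact: ltW.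
rewrite mulrAC; apply: ler_wpM2r; first exact: exprn_ge0.
apply: ler_wpM2l; first exact: D0.
apply: ler_pM; [exact: powR_ge0|exact: expR_ge0| |].
  by apply: le_powR_base; [exact: ltW|exact: L_ge0|exact: L_mono].
by rewrite ler_expR ler_pM2l.
Qed.

Lemma le_geometric (a c D rho : R) : 0 <= rho -> rho < 1 ->
  (forall k, a <= D * rho ^+ k * c) -> a <= 0.
Proof.
move=> r0 r1 h; have hr : (D * rho ^+ k * c) @[k --> \oo] --> D * 0 * c.
  by apply: cvgMl; apply: cvgMr; apply: cvg_expr; rewrite ger0_norm.
move: hr; rewrite mulr0 mul0r => hr.
by apply: (ler_cvg_to (cvg_cst _) hr); apply: nearW.
Qed.

(** Existence iterates from the subsolution [ell]: consecutive iterates are iterates of [Psi ell]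
    and [ell], both above [ell]. For uniqueness, two solutions lie above [ell] and equal their own
    iterates, so their distance is below every term of a geometric sequence. *)
Lemma fixpoint_exists_unique d : 0 < d -> d < 1 ->
  CB * (p * thu / ((1 - d) ^+ 2 * (1 - p) * thl)) / ((1 - d) * kap) < 1 ->
  exists m, [/\ gd w m, forall t x, 0 <= m t x, forall t x, Psi m t x = m t x &
    forall m', gd w m' -> (forall t x, 0 <= m' t x) -> (forall t x, Psi m' t x = m' t x) ->
      forall t x, m' t x = m t x].
Proof.
move=> d0 d1 hq; have [c0 c00 [gell hell hsol]] := crude.
set ell := (fun t x => c0 * L t `^ kap * prof 0 x) in gell hell hsol.
have ell0 t x : 0 <= ell t x by rewrite /ell; have pr0 := prof_ge0 0 x; nneg.
have [rho [k0 [r0 r1 H]]] := contract_iter d0 d1 c00 hq gell hell.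
pose m_ k := iter (k + k0) Psi ell.
have gm_ k : gd w (m_ k) by exact: gd_iter.
have m_0 k t x : 0 <= m_ k t x by exact: (iter_ge0 _ gell ell0).
have hdiff T : exists D, forall k t x, t <= T -> `|m_ k.+1 t x - m_ k t x| <= D * rho ^+ k * w x.
  have [D hD] := H _ _ (gd_Psi gell) gell (Psi_ge0 gell ell0) ell0 hell (fun t x => lexx _) T.
  by exists D => k t x tT; have := hD k t x tT; rewrite -iterSr.
have [m [gm hm]] := gd_lim cw w1 r0 r1 gm_ hdiff.
have m0 t x : 0 <= m t x.
  have [D hD] := hm t; rewrite -oppr_le0; apply: (@le_geometric _ (w x) D rho r0 r1) => k.
  apply: le_trans (hD k t x (lexx t)); rewrite -normrN opprB; apply: le_trans (ler_norm _).
  by rewrite lerDr.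
have fixm t x : Psi m t x = m t x.
  have [D hD] := hm t.
  have D0 : 0 <= D.
    have := hD 0%N t 0 (lexx _); rewrite expr0 mulr1 => /(le_trans (normr_ge0 _)).
    by rewrite pmulr_lge0.
  pose e k := D * rho ^+ k.
  have e0 k : 0 <= e k by rewrite mulr_ge0 ?exprn_ge0.
  have ce : e k @[k --> \oo] --> (0 : R).
    by rewrite -(mulr0 D); apply: cvgMr; apply: cvg_expr; rewrite ger0_norm.
  have cep : e k `^ p @[k --> \oo] --> (0 : R).
    have c1 := continuous_seqE (continuous_powR_max (ltW hp0)) ce.
    move: c1; rewrite max_r// powR0 ?gt_eqF//.
    by under eq_fun do rewrite max_l//.
  (* [smoothing] with exponent 0 bounds the distance from [Psi m] to the next iterate by terms in e
     and e^p: [Psi] is continuous along the sequence although it is not Lipschitz. *)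
  pose F k := (e k * int0 t (fun=> 1) + thu * e k `^ p * L t) * CB * w x + e k.+1 * w x.
  have cF : F k @[k --> \oo] --> (0 * int0 t (fun=> 1) + thu * 0 * L t) * CB * w x + 0 * w x.
    apply: cvgD; last by apply: cvgMl; rewrite (cvg_shiftS e).
    apply: cvgMl; apply: cvgMl; apply: cvgD; first exact: cvgMl.
    by apply: cvgMl; exact: cvgMr.
  have FF k : `|Psi m t x - m t x| <= F k.
    have -> : Psi m t x - m t x = (Psi m t x - Psi (m_ k) t x) - (m t x - m_ k.+1 t x).
      by rewrite /m_ addSn iterS opprB addrA subrK.
    apply: le_trans (ler_normB _ _) _; apply: lerD; last exact: hD.
    have h : forall s y, s <= t -> `|m s y - m_ k s y| <= e k * L s `^ 0 * w y.
      by move=> s y st; rewrite powRr0 mulr1; exact: hD.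
    apply: le_trans (smoothing gm (gm_ k) m0 (m_0 k) (lexx 0) (e0 k) h x (lexx t)) _.
    apply: ler_wpM2r; first exact: ltW.
    apply: ler_wpM2r; first exact: CB0.
    rewrite -!int0Z; [|exact: cg|exact: continuous_cstr].
    rewrite -int0D; [|exact: continuous_cstr|exact: continuous_scale].
    rewrite le_eqVlt; apply/orP; left; apply/eqP; apply: eq_int0 => s _ _.
    by rewrite mul0r !powRr0 !mulr1.
  apply/eqP; rewrite -subr_eq0 -normr_le0.
  have -> : 0 = (0 * int0 t (fun=> 1) + thu * 0 * L t) * CB * w x + 0 * w x :> R by ring.
  by apply: (ler_cvg_to (cvg_cst _) cF); apply: nearW.
exists m; split=> // m' gm' m0' fix' t x.
have it m1 k : (forall t x, Psi m1 t x = m1 t x) -> iter k Psi m1 = m1.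
  move=> h; elim: k => // k IH; rewrite iterS IH; apply/funext => s; apply/funext => y; exact: h.
have [D hD] := H m' m gm' gm m0' m0 (hsol m' gm' m0' fix') (hsol m gm m0 fixm) t.
apply/eqP; rewrite -subr_eq0 -normr_le0.
apply: (@le_geometric _ (w x) D rho r0 r1) => k.
by have := hD k t x (lexx t); rewrite !it.
Qed.

End nonlinear.

(** * Power weights *)

Section dilation.
Context {R : realType} {n : nat}.
Implicit Types (x z : 'rV[R]_n) (s r : R).

(** The translation factor of the weight: r + |x - z| <= (r + |x|) (1 + (1 + |z|) / r). It tends to
    1 as [r] grows, which brings the averaging constant of [wt] close to 1. *)
Definition dil s r z : R := (1 + (1 + enorm z) / r) `^ s.

Lemma continuous_powR_ge0 {U : topologicalType} (f : U -> R) s : 0 <= s -> continuous f ->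
  (forall u, 0 <= f u) -> continuous (fun u => f u `^ s).
Proof.
move=> s0 cf f0; rewrite (_ : (fun u => _) = (fun u => Num.max (f u) 0 `^ s)); last first.
  by apply/funext => u; rewrite max_l.
exact: continuous_compr cf (continuous_powR_max s0).
Qed.

Lemma continuous_dil s r : 0 <= s -> 0 < r -> continuous (dil s r).
Proof.
move=> s0 r0; apply: continuous_powR_ge0 => // [|z]; last by have z0 := enorm_ge0 z; nneg.
apply: continuous_addr; first exact: continuous_cstr.
apply: continuous_mulr; last exact: continuous_cstr.
by apply: continuous_addr; [exact: continuous_cstr|exact: continuous_enorm].
Qed.

Lemma dil_bound s : 0 <= s -> exists C, forall r z, 1 <= r -> `|dil s r z| <= C * expw z.
Proof.
move=> s0; have [C C0 hC] := powR_le_expR s0; exists (C * expR 2^-1) => r z r1.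
have z0 := enorm_ge0 z; have r0 : 0 < r by lra.
rewrite ger0_norm ?powR_ge0//; apply: (@le_trans _ _ ((1 + (1 + enorm z)) `^ s)).
  apply: le_powR_base => //; first by nneg.
  rewrite lerD2l ler_pdivrMr// ler_peMr//; lra.
apply: le_trans (hC (1 + enorm z) _) _; first by nneg.
rewrite -mulrA; apply: ler_wpM2l; first exact: ltW.
by rewrite /expw -expRD ler_expR; lra.
Qed.

Lemma adm_dil s r : 0 <= s -> 1 <= r -> adm (dil s r).
Proof.
move=> s0 r1; split; first by apply: continuous_dil => //; lra.
by have [C hC] := dil_bound s0; exists C => z; exact: hC.
Qed.

End dilation.

Section dilation_average.
Context {R : realType} (n : nat) (B : 'rV[R]_n -> R) (hB : is_bessel_kernel B).
Implicit Types (x z : 'rV[R]_n) (s r : R).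

Lemma avg_dil_cvg s : 0 <= s -> avg B (dil s k.+1%:R) @[k --> \oo] --> (1 : R).
Proof.
move=> s0; have [C hC] := @dil_bound R n s s0.
rewrite -[X in _ --> X](avg1 hB); apply: (avg_dct hB (C := C)) => [k|k z|z].
- exact: continuous_dil.
- by apply: hC; rewrite ler1n.
have c : 1 + (1 + enorm z) / k.+1%:R @[k --> \oo] --> 1 + (1 + enorm z) * 0.
  apply: cvgD; first exact: cvg_cst.
  by apply: cvgMr; exact: cvg_harmonic.
have := continuous_seqE (continuous_powR_max s0) c.
rewrite mulr0 addr0 max_l// powR_base1.
under eq_fun do rewrite max_l ?addr_ge0 ?divr_ge0 ?addr_ge0 ?enorm_ge0//.
by [].
Qed.

Lemma rV_measurable_ge1 x : rV_measurable (fun y => (1 <= enorm (x - y))%R%:R : R).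
Proof.
apply: measurableT_comp => //; rewrite /rV_measurable.
apply: measurable_fun_ler => //.
exact: (continuous_rV_measurable (continuous_shiftl (x := x) (@continuous_enorm R n))).
Qed.

(** For |x| >= r, |x - y|^s <= |x|^s dil s r y. Division by |x|^s bounds [e] by the average of
    [dil s r], which tends to 1; positive dimension supplies vectors of norm at least [r]. *)
Lemma moment_ratio_le1 s e : (1 <= n)%N -> 0 <= s ->
  (forall x, ((e * enorm x `^ s)%:E <=
    iint (fun y => (if (1 <= enorm (x - y))%R then B y * enorm (x - y) `^ s else 0)%:E))%E) ->
  e <= 1.
Proof.
move=> n1 s0 he; apply: (ler_cvg_to (cvg_cst e) (avg_dil_cvg s0)); apply: nearW => k.
have [r [r1 <-]] : exists r : R, 1 <= r /\ r = k.+1%:R by exists k.+1%:R; rewrite ler1n.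
pose x : 'rV[R]_n := const_mx r.
have xr : r <= enorm x.
  rewrite -(ler_pXn2r (isT : (0 < 2)%N)) ?nnegrE ?enorm_ge0//; last by lra.
  rewrite enorm_sqr (bigD1 (Ordinal n1))//= mxE lerDl sumr_ge0// => i _.
  exact: sqr_ge0.
have x0 : 0 < enorm x by lra.
pose phi y := enorm (x - y) `^ s * (1 <= enorm (x - y))%R%:R.
have cps : continuous (fun y : 'rV[R]_n => enorm (x - y) `^ s).
  apply: (@continuous_shiftl R n (fun y => enorm y `^ s)).
  by apply: continuous_powR_ge0 => // [|y]; [exact: continuous_enorm|exact: enorm_ge0].
have mphi : rV_measurable phi.
  by apply: measurable_funM; [exact: (continuous_rV_measurable cps)|exact: rV_measurable_ge1].
have phile y : phi y <= enorm x `^ s * dil s r y.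
  have y0 := enorm_ge0 y; have r0 : 0 < r by lra.
  have ple : phi y <= enorm (x - y) `^ s.
    by rewrite /phi; case: (leP 1 (enorm (x - y))) => _; rewrite ?mulr1// mulr0 powR_ge0.
  apply: le_trans ple _; rewrite /dil -powRM ?(ltW x0)//; last by nneg.
  apply: le_powR_base => //; first exact: enorm_ge0.
  apply: le_trans (ler_enormB _ _) _; rewrite mulrDr mulr1 lerD2l.
  apply: (@le_trans _ _ (r * ((1 + enorm y) / r))).
    by rewrite mulrC divfK ?gt_eqF//; lra.
  by apply: ler_wpM2r => //; nneg.
have [C hC] := @dil_bound R n s s0.
have phi0 y : 0 <= phi y by rewrite mulr_ge0 ?powR_ge0.
have ip : (lam R n).-integrable setT (EFin \o (fun v => B (emb v) * phi (emb v))).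
  apply: (integrable_avg hB mphi (C := enorm x `^ s * C)) => z.
  rewrite ger0_norm//; apply: le_trans (phile z) _; rewrite -mulrA.
  apply: ler_wpM2l; first exact: powR_ge0.
  by apply: le_trans (ler_norm _) _; exact: hC.
have ad := admZ (enorm x `^ s) (@adm_dil R n s r s0 r1).
have hle := le_avg_integrable hB ip (adm_integrable hB ad) phile.
have := he x.
rewrite (_ : (fun y => _) = (fun y => (B y * phi y)%:E)); last first.
  apply/funext => y; rewrite /phi; congr EFin.
  by case: (leP 1 (enorm (x - y))) => _; rewrite ?mulr1// !mulr0.
rewrite iintE// (integrableE ip) lee_fin => h.
have := le_trans h hle; rewrite (avgZ hB _ (@adm_dil R n s r s0 r1)) mulrC ler_pM2l ?powR_gt0//.
Qed.

End dilation_average.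

Section japanese_bracket.
Context {R : realType} {n : nat}.
Implicit Types x : 'rV[R]_n.

Definition wq (a : R) x : R := (1 + enorm x ^+ 2) `^ (a / 2).

Lemma wq_gt0 (a : R) x : 0 < wq a x.
Proof. by rewrite powR_gt0// ltr_wpDr// sqr_ge0. Qed.

Lemma BCdist_leP (a : R) (phi psi : 'rV[R]_n -> R) e :
  BCdist_le a phi psi e <-> forall x, `|phi x - psi x| <= e * wq a x.
Proof.
have E x : (1 + enorm x ^+ 2) `^ (- a / 2) = (wq a x)^-1 by rewrite mulNr powRN.
split=> h x; have := h x; first by rewrite E mulrC ler_pdivrMr// wq_gt0.
by move=> hx; rewrite E mulrC ler_pdivrMr// wq_gt0.
Qed.

End japanese_bracket.

Section weight.
Context {R : realType} {n : nat}.
Context (a r : R) (a0 : 0 <= a) (r1 : 1 <= r).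
Implicit Types x z : 'rV[R]_n.

Definition wt x : R := (r + enorm x) `^ a.

Lemma continuous_wt : continuous wt.
Proof.
apply: continuous_powR_ge0 => // [|x]; last by have := enorm_ge0 x; have := r1; lra.
by apply: continuous_addr; [exact: continuous_cstr|exact: continuous_enorm].
Qed.

Lemma wt_ge1 x : 1 <= wt x.
Proof. by apply: powR_ge1 => //; have := enorm_ge0 x; have := r1; lra. Qed.

Lemma wt_shift x z : wt (x - z) <= wt x * dil a r z.
Proof.
have [x0 z0] := (enorm_ge0 x, enorm_ge0 z); have r0 : 0 < r by have := r1; lra.
rewrite /wt /dil -powRM; [|by nneg..]; apply: le_powR_base => //.
  by have e0 := enorm_ge0 (x - z); nneg.
apply: (@le_trans _ _ (r + enorm x + r * ((1 + enorm z) / r))).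
  rewrite mulrCA divff ?gt_eqF// mulr1; have := ler_enormB x z; lra.
rewrite [leRHS]mulrDr mulr1 lerD2l; apply: ler_wpM2r; first by nneg.
by rewrite lerDl.
Qed.

Lemma wt_exp : exists C, forall x z, wt (x - z) <= C * wt x * expw z.
Proof.
have [C hC] := @dil_bound R n a a0; exists C => x z; apply: le_trans (wt_shift x z) _.
rewrite [C * _]mulrC -mulrA; apply: ler_wpM2l; first exact: powR_ge0.
exact: le_trans (ler_norm _) (hC _ _ r1).
Qed.

Lemma wt_avg (B : 'rV[R]_n -> R) x : is_bessel_kernel B ->
  avg B (fun z => wt (x - z)) <= avg B (dil a r) * wt x.
Proof.
move=> hB; have ad := @adm_dil R n a r a0 r1; rewrite mulrC -avgZ//; apply: le_avg => //.
- have [C hC] := wt_exp; split; first exact: continuous_shiftl continuous_wt.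
  exists (C * wt x) => z; rewrite ger0_norm ?powR_ge0//.
- exact: admZ.
- by move=> z; exact: wt_shift.
Qed.

Lemma powR_sqr_half (q : R) : 0 <= q -> q `^ a = (q ^+ 2) `^ (a / 2).
Proof. by move=> q0; rewrite -powR_mulrn// -powRrM; congr (_ `^ _); field. Qed.

Lemma wq_le x : wq a x <= wt x.
Proof.
have x0 := enorm_ge0 x; have r0 := r1.
rewrite /wt powR_sqr_half; last by lra.
apply: le_powR_base; [by nneg|by rewrite addr_ge0 ?sqr_ge0|].
by nra.
Qed.

Lemma wt_le : exists2 C, 0 < C & forall x, wt x <= C * wq a x.
Proof.
have r0 := r1; have r20 : 0 < 2 * r ^+ 2 by rewrite mulr_gt0// exprn_gt0//; lra.
exists ((2 * r ^+ 2) `^ (a / 2)); first exact: powR_gt0.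
move=> x; have x0 := enorm_ge0 x.
rewrite /wt powR_sqr_half; last by lra.
rewrite -powRM; [|exact: ltW|by rewrite addr_ge0 ?sqr_ge0].
apply: le_powR_base; [by nneg|exact: sqr_ge0|].
have := sqr_ge0 (r - enorm x); have : 0 <= (r ^+ 2 - 1) * enorm x ^+ 2.
  by rewrite mulr_ge0 ?sqr_ge0// subr_ge0 expr2; nra.
by rewrite !expr2; nra.
Qed.

End weight.

Section bounds.
Context {R : realType} (n : nat).

Lemma ball_bounded (phi : 'rV[R]_n -> R) (M : R) : continuous phi ->
  exists2 C, 0 <= C & forall x, enorm x <= M -> `|phi x| <= C.
Proof.
move=> cphi; have cn : continuous (fun x => `|phi x|).
  by move=> x; apply: continuous_comp; [exact: cphi|exact: norm_continuous].
pose A := [set v : 'rV[R]_n | forall i, `[- M, M]%classic (v ord0 i)].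
have cA : compact A by apply: (@rV_compact _ _ (fun=> `[- M, M]%classic)) => _; exact: segment_compact.
have Ax x : enorm x <= M -> A x.
  move=> xM i /=; rewrite in_itv/= -ler_norml; apply: le_trans xM.
  rewrite -(ler_pXn2r (isT : (0 < 2)%N)) ?nnegrE ?enorm_ge0// enorm_sqr (bigD1 i)//=.
  by rewrite real_normK ?num_real// lerDl sumr_ge0// => j _; exact: sqr_ge0.
have [M0|M0] := leP 0 M; last first.
  by exists 0 => // x xM; move: (le_trans (enorm_ge0 x) xM); rewrite leNgt M0.
have A0 : A !=set0 by exists 0; apply: Ax; rewrite enorm0.
have [c _ hc] := EVT_max_rV A0 cA (continuous_subspaceT cn).
by exists `|phi c| => // x xM; apply: hc; rewrite inE; exact: Ax.
Qed.

Lemma inBC_bound (a r : R) (phi : 'rV[R]_n -> R) : 0 <= a -> 1 <= r -> inBC a phi ->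
  bw (wt a r) phi.
Proof.
move=> a0 r1 [cphi [C [M hC]]]; split=> //; have [D D0 hD] := ball_bounded M cphi.
exists (`|C| + D) => x; have w1 := wt_ge1 a0 r1 x.
have [xM|/ltW xM] := leP M (enorm x); last first.
  apply: le_trans (hD x xM) _; rewrite mulrDl; apply: ler_wpDl; first by nneg; exact: powR_ge0.
  by rewrite ler_peMr.
apply: le_trans (hC x xM) _; rewrite mulrDl; apply: ler_wpDr; first by nneg; exact: powR_ge0.
apply: (@le_trans _ _ (`|C| * enorm x `^ a)).
  by apply: ler_wpM2r; [exact: powR_ge0|exact: ler_norm].
apply: ler_wpM2l => //; apply: le_powR_base => //; first exact: enorm_ge0.
by rewrite lerDr; exact: le_trans r1.
Qed.

Lemma bw_inBC (a r : R) (phi : 'rV[R]_n -> R) : 0 <= a -> 1 <= r -> bw (wt a r) phi -> inBC a phi.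
Proof.
move=> a0 r1 [cphi [C hC]]; split=> //; exists (C * 2 `^ a), r => x rx.
have C0 : 0 <= C := bound_ge0 (wt_ge1 a0 r1) hC.
apply: le_trans (hC x) _; rewrite -mulrA; apply: ler_wpM2l => //.
rewrite -powRM ?enorm_ge0//; apply: le_powR_base => //; last by lra.
by have x0 := enorm_ge0 x; lra.
Qed.

Lemma ler_dist_max0 (s t : R) : `|Num.max s 0 - Num.max t 0| <= `|s - t|.
Proof.
wlog st : s t / s <= t => [hw|].
  by have [st|/ltW ts] := leP s t; [exact: hw|rewrite distrC [leRHS]distrC; exact: hw].
rewrite distrC [leRHS]distrC !ger0_norm ?subr_ge0//; last by rewrite le_max2.
by case: (leP s 0) => h1; case: (leP t 0) => h2; lra.
Qed.

(** Continuity in norm bounds [mu] near each time; compactness of [[0, T]], used as a covering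
    property relative to the filter of large constants, makes the bound uniform. Times are clipped
    at 0 because [inZ] constrains nonnegative ones only. *)
Lemma inZ_gd (a r : R) (mu : R -> 'rV[R]_n -> R) : 0 <= a -> 1 <= r -> inZ a mu ->
  gd (wt a r) (fun t => mu (Num.max t 0)).
Proof.
move=> a0 r1 [muBC muc]; have m0 t : 0 <= Num.max t 0 :> R by rewrite le_max lexx orbT.
split=> [t|x t|T].
- by have [] := muBC _ (m0 t).
- apply/cvgrPdist_lt => e e0; have q0 := wq_gt0 a x.
  have eq : 0 < e / 2 / wq a x by rewrite !divr_gt0.
  have [d d0 hd] := muc _ (m0 t) _ eq.
  near=> s; have st : `|t - s| < d.
    by near: s; apply/nbhs_ballP; exists d.
  have := hd _ (m0 s); rewrite (le_lt_trans (ler_dist_max0 _ _)) 1?distrC// => /(_ isT)/BCdist_leP/(_ x).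
  by rewrite divfK ?gt_eqF// distrC => /le_lt_trans; apply; lra.
- pose P C t := forall x, `|mu (Num.max t 0) x| <= C * wt a r x.
  have := @segment_compact R 0 T => /compact_near_coveringP.
  move=> /(_ R +oo P _) cov.
  have : \forall C \near +oo, `[0, T]%classic `<=` P C.
    apply: cov => t /=; rewrite in_itv/= => /andP[t0 tT].
    have [C hC] := (inBC_bound a0 r1 (muBC _ (m0 t))).2.
    have [d d0 hd] := muc _ (m0 t) 1 ltr01.
    exists (ball t d, [set D | C + 1 <= D]) => /=.
      by split; [exact: nbhsx_ballx|apply: nbhs_pinfty_ge; rewrite num_real].
    move=> [s D] [/= ts CD] x; have := hd _ (m0 s).
    rewrite (le_lt_trans (ler_dist_max0 _ _)) 1?distrC// => /(_ isT)/BCdist_leP/(_ x).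
    rewrite mul1r => h; apply: (@le_trans _ _ ((C + 1) * wt a r x)).
      rewrite mulrDl mul1r -[mu (Num.max s 0) x](subrK (mu (Num.max t 0) x)) addrC.
      apply: le_trans (ler_normD _ _) _; apply: lerD; first exact: hC.
      by apply: le_trans h _; exact: wq_le.
    by apply: ler_wpM2r => //; exact: powR_ge0.
  move=> /filter_ex[C hC]; have [D hD] := (inBC_bound a0 r1 (muBC 0 (lexx 0))).2.
  exists (`|C| + `|D|) => t tT x; have w0 : 0 <= wt a r x by exact: powR_ge0.
  have [t0|t0] := leP 0 t.
    have := hC t; rewrite /= in_itv/= t0 tT => /(_ isT x) h; rewrite max_l// in h *.
    apply: le_trans h _; apply: ler_wpM2r => //.
    by apply: le_trans (ler_norm _) _; rewrite lerDl.
  apply: le_trans (hD x) _; apply: ler_wpM2r => //.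
  by apply: le_trans (ler_norm _) _; rewrite lerDr.
Unshelve. all: by end_near. Qed.

Lemma gd_inZ (a r : R) (m : R -> 'rV[R]_n -> R) : 0 <= a -> 1 <= r -> gd (wt a r) m ->
  (forall T, exists2 K, 0 <= K & forall s t x, 0 <= s -> s <= t -> t <= T ->
    `|m t x - m s x| <= K * (t - s) * wt a r x) -> inZ a m.
Proof.
move=> a0 r1 gm lip; split=> [t t0|t t0 e e0].
  exact: (bw_inBC a0 r1 (gd_bw t gm)).
have [K K0 hK] := lip (t + 1); have [C C0 hC] := @wt_le R n a r a0 r1.
have KC : 0 < K * C + 1 by rewrite ltr_wpDl// mulr_ge0// ltW.
exists (Num.min 1 (e / (K * C + 1))); first by rewrite lt_min ltr01 divr_gt0.
move=> s s0; rewrite lt_min => /andP[st1 st2]; apply/BCdist_leP => x.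
have q0 := wq_gt0 a x.
have key : `|m s x - m t x| <= K * `|s - t| * wt a r x.
  have [h|/ltW h] := leP s t.
    by rewrite distrC [`|s - t|]distrC [`|t - s|]ger0_norm ?subr_ge0//; apply: hK => //; lra.
  rewrite [`|s - t|]ger0_norm ?subr_ge0//; apply: hK => //.
  by move: st1; rewrite ltr_norml => /andP[]; lra.
apply: le_trans key _; apply: (@le_trans _ _ (K * `|s - t| * (C * wq a x))).
  by apply: ler_wpM2l; [nneg|exact: hC].
rewrite (_ : _ * (C * _) = (`|s - t| * (K * C)) * wq a x); last by ring.
apply: ler_wpM2r; first exact: ltW.
move: st2; rewrite ltr_pdivlMr// => /ltW; apply: le_trans.
by apply: ler_wpM2l => //; rewrite lerDl.
Qed.

(** Applied with h t = exp(- t), to pass from mu back to u. *)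
Lemma inZ_mul (a : R) (h : R -> R) (m : R -> 'rV[R]_n -> R) : 0 <= a -> continuous h ->
  (forall t, 0 <= t -> `|h t| <= 1) -> inZ a m -> inZ a (fun t x => h t * m t x).
Proof.
move=> a0 ch h1 [mBC mc]; split=> [t t0|t t0 e e0].
  have [cm [C [M hC]]] := mBC t t0; split; first exact: continuous_scale.
  exists C, M => x /hC; apply: le_trans; rewrite normrM ler_piMl//; exact: h1.
have [C hC] := (inBC_bound a0 (lexx 1) (mBC t t0)).2.
have [D D0 hD] := @wt_le R n a 1 a0 (lexx 1).
have C0 : 0 <= C := bound_ge0 (wt_ge1 a0 (lexx 1)) hC.
have e2 : 0 < e / 2 by rewrite divr_gt0.
have CD : 0 < C * D + 1 by rewrite ltr_wpDl// mulr_ge0// ltW.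
have e3 : 0 < e / 2 / (C * D + 1) by rewrite divr_gt0.
have [d d0 hd] := mc t t0 _ e2.
have /cvgrPdist_lt /(_ _ e3) /nbhs_ballP[d' d'0 hd'] := ch t.
exists (Num.min d d'); first by rewrite lt_min d0.
move=> s s0; rewrite lt_min => /andP[sd sd']; apply/BCdist_leP => x.
have q0 := wq_gt0 a x; have /BCdist_leP /(_ x) h2 := hd s s0 sd.
have h3 : `|h t - h s| < e / 2 / (C * D + 1) by apply: hd'; rewrite /ball/= distrC.
rewrite (_ : _ - _ = h s * (m s x - m t x) - (h t - h s) * m t x); last by ring.
apply: le_trans (ler_normB _ _) _; rewrite !normrM.
have -> : e * wq a x = e / 2 * wq a x + e / 2 * wq a x by field.
apply: lerD.
  by apply: le_trans h2; rewrite ler_piMl//; exact: h1.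
apply: (@le_trans _ _ (e / 2 / (C * D + 1) * (C * (D * wq a x)))).
  apply: ler_pM => //; first exact: ltW.
  by apply: le_trans (hC x) _; apply: ler_wpM2l.
rewrite [C * (D * _)]mulrA mulrA; apply: ler_wpM2r; first exact: ltW.
rewrite mulrAC ler_pdivrMr//; apply: ler_wpM2l; first exact: ltW.
by rewrite lerDl.
Qed.

End bounds.

(** Composition with t |-> max t 0 turns continuity on nonnegative times into continuity on the
    whole line. *)
Lemma within_comp {R : realType} {T U : topologicalType} (A : set T) (f : T -> R) (h : U -> T) :
  {within A, continuous f} -> continuous h -> (forall u, A (h u)) -> continuous (fun u => f (h u)).
Proof.
move=> /subspace_continuousP cf ch hA u; apply: cvg_comp (cf _ (hA u)).
move=> s; rewrite /within/= => hs.
have H : nbhs u (fun v => A (h v) -> s (h v)) := ch u _ hs.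
suff : nbhs u (fun v => s (h v)) by [].
by apply: filterS H => v hv; exact: hv (hA v).
Qed.

Lemma continuous_ge0_at0 {R : realType} (f : R -> R) : continuous f ->
  (forall t, 0 < t -> 0 <= f t) -> 0 <= f 0.
Proof.
move=> cf f0; have := continuous_seqE cf (@cvg_harmonic R) => c.
apply: (ler_cvg_to (cvg_cst 0) c); apply: nearW => k; apply: f0.
by rewrite /harmonic/= invr_gt0.
Qed.

(** * Existence and uniqueness *)

Lemma continuous_pairl {T U : topologicalType} (u : U) : continuous (fun t : T => (t, u)).
Proof. by move=> t; apply: cvg_pair; [exact: cvg_id|exact: cvg_cst]. Qed.

Lemma continuous_pairr {S T U : topologicalType} (t : T) (h : S -> U) : continuous h ->
  continuous (fun s => (t, h s)).
Proof. by move=> ch s; apply: cvg_pair; [exact: cvg_cst|exact: ch]. Qed.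

(** The bounds on [V] are assumed for positive times only; continuity gives them at 0, and freezing
    carries them to negative times. *)
Lemma ge0_extend {R : realType} (f : R -> R) : continuous f ->
  (forall t, f t = f (Num.max t 0)) -> (forall t, 0 < t -> 0 <= f t) -> forall t, 0 <= f t.
Proof.
move=> cf fm f0 t; have [t0|t0] := leP t 0; last exact: f0.
by rewrite fm max_r//; exact: continuous_ge0_at0.
Qed.

Lemma max0K {R : realType} (t : R) : Num.max (Num.max t 0) 0 = Num.max t 0.
Proof. by rewrite max_l// le_max lexx orbT. Qed.

Lemma max_frozen_bounded {R : realType} (g : R -> R) T : continuous g ->
  (forall t, g t = g (Num.max t 0)) -> exists2 C, 0 < C & forall t, t <= T -> `|g t| <= C.
Proof.
move=> cg gm; have [C C0 hC] := locally_bounded (Num.max T 0) cg.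
exists C => // t tT; rewrite gm; apply: hC; first by rewrite le_max lexx orbT.
by rewrite le_max2.
Qed.

Definition mild {R : realType} {n : nat} (B : 'rV[R]_n -> R) (V : 'rV[R]_n -> R -> R) (p : R)
    (u0 : 'rV[R]_n -> R) (mu : R -> 'rV[R]_n -> R) t x :=
  u0 x + int0 t (fun tau => Defs.conv B (mu tau) x)
       + int0 t (fun tau => expR ((1 - p) * tau) * Defs.conv B (fun y => V y tau * mu tau y `^ p) x).

Lemma eq_mild {R : realType} {n : nat} (B : 'rV[R]_n -> R) V p u0 (mu nu : R -> 'rV[R]_n -> R) t x :
  (forall tau y, 0 <= tau -> mu tau y = nu tau y) -> mild B V p u0 mu t x = mild B V p u0 nu t x.
Proof.
move=> h; have E tau : 0 <= tau -> mu tau = nu tau by move=> t0; apply/funext => y; exact: h.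
have e1 : int0 t (fun tau => Defs.conv B (mu tau) x) = int0 t (fun tau => Defs.conv B (nu tau) x).
  by apply: eq_int0 => tau tau0 _; rewrite E.
have e2 : int0 t (fun tau => expR ((1 - p) * tau) * Defs.conv B (fun y => V y tau * mu tau y `^ p) x) =
    int0 t (fun tau => expR ((1 - p) * tau) * Defs.conv B (fun y => V y tau * nu tau y `^ p) x).
  by apply: eq_int0 => tau tau0 _; rewrite E.
by rewrite /mild e1 e2.
Qed.

Lemma existence_uniqueness (R : realType) (n : nat)
  (B : 'rV[R]_n -> R) (hB : is_bessel_kernel B)
  (p sigma : R) (hp0 : 0 < p) (hp1 : p < 1) (hs : 0 <= sigma)
  (Lambda : R -> R)
  (hLc : {within [set t : R | 0 <= t], continuous Lambda})
  (hLpos : forall t, 0 <= t -> 0 < Lambda t)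
  (thl thu : R) (hthl : 0 < thl) (hthu : 0 < thu)
  (V : 'rV[R]_n -> R -> R)
  (hVc : {within [set z : 'rV[R]_n * R | 0 <= z.2],
            continuous (fun z : 'rV[R]_n * R => V z.1 z.2)})
  (hV0 : forall x t, 0 <= V x t)
  (hVl : forall x t, 1 <= enorm x -> 0 < t -> thl * Lambda t * enorm x `^ sigma <= V x t)
  (hVu : forall x t, 0 < t -> V x t <= thu * Lambda t * enorm x `^ sigma)
  (a : R) (ha : sigma / (1 - p) <= a)
  (u0 : 'rV[R]_n -> R) (hu0 : forall x, 0 <= u0 x) (hu0BC : inBC a u0)
  (hu0nz : exists x, u0 x != 0) (hq : p * thu < thl) :
  exists u, [/\ nonneg_sol u, inZ a (fun t x => u x t), s_solution B V p a u0 u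
    & forall v, nonneg_sol v -> s_solution B V p a u0 v -> forall x t, 0 <= t -> v x t = u x t].
Proof.
have p1 : 0 < 1 - p by rewrite subr_gt0.
have b0 : 0 <= sigma / (1 - p) by nneg.
have a0 : 0 <= a by exact: le_trans ha.
pose q0 := p * thu / thl.
have q00 : 0 < q0 by rewrite divr_gt0// mulr_gt0.
have q01 : q0 < 1 by rewrite ltr_pdivrMr// mul1r.
(* With q0 = p thu / thl = 1 - 5 d, the losses (1 - d)^3 (two factors from the constant of the lower
   bound, one from [al]) and 1 + d (from averaging the weight) are affordable: (1 + d) (1 - 5 d) <
   (1 - d)^3. *)
have [d [d0 d5 dE]] : exists d, [/\ 0 < d, d < 1 / 5 & q0 = 1 - 5 * d].
  by exists ((1 - q0) / 5); split; [lra|lra|field].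
have d1 : d < 1 by lra.
have [r r1 hCB] : exists2 r, 1 <= r & avg B (dil a r) <= 1 + d.
  have /cvgrPdist_lt /(_ _ d0)[k _ /(_ k (leqnn k))] := avg_dil_cvg hB a0.
  rewrite ltr_norml => /andP[h _]; exists k.+1%:R; first by rewrite ler1n.
  by move: h; set X := avg B _; lra.
set CB := avg B (dil a r) in hCB.
pose w : 'rV[R]_n -> R := wt a r.
have cw : continuous w by exact: continuous_wt.
have w1 x : 1 <= w x by exact: wt_ge1.
have [Ce wexp] : exists C, forall x z, w (x - z) <= C * w x * expw z by exact: wt_exp.
have wavg x : avg B (fun z => w (x - z)) <= CB * w x by exact: wt_avg.
have wb x : mx x `^ (sigma / (1 - p)) <= w x.
  have x0 := enorm_ge0 x; apply: (@le_trans _ _ ((r + enorm x) `^ (sigma / (1 - p)))).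
    apply: le_powR_base => //; first exact/ltW/mx_gt0.
    by rewrite /mx ge_max; apply/andP; split; lra.
  by apply: ler_powR => //; lra.
have max0 t : 0 <= Num.max t 0 :> R by rewrite le_max lexx orbT.
(* All data are frozen for t <= 0, so that regularity in time can be stated on the whole line. *)
pose ex (t : R) := expR ((1 - p) * Num.max t 0).
have cex : continuous ex.
  apply: continuous_compr (@continuous_expR R); apply: continuous_scale.
  exact: continuous_maxr0.
have ex0 t : 0 < ex t by exact: expR_gt0.
have exm t : ex t = ex (Num.max t 0) by rewrite /ex max0K.
pose g t := ex t * Lambda (Num.max t 0).
have cg : continuous g.
  apply: continuous_mulr => //.
  exact: (within_comp hLc (@continuous_maxr0 R) max0).
have g0 t : 0 < g t by rewrite mulr_gt0// hLpos.
have gm t : g t = g (Num.max t 0) by rewrite /g max0K -exm.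
have gub T : exists2 C, 0 < C & forall t, t <= T -> g t <= C.
  have [C C0 hC] := max_frozen_bounded T cg gm; exists C => // t tT.
  exact: le_trans (ler_norm _) (hC t tT).
have glb T : exists2 c, 0 < c & forall t, t <= T -> c <= g t.
  have cgV : continuous (fun t => (g t)^-1).
    by move=> t; apply: (cvgV (lt0r_neq0 (g0 t))); exact: cg.
  have [C C0 hC] := max_frozen_bounded T cgV (fun t => congr1 GRing.inv (gm t)).
  exists C^-1; first by rewrite invr_gt0.
  move=> t tT; have := le_trans (ler_norm _) (hC t tT).
  by rewrite -[X in _ -> _ <= X]invrK lef_pV2 ?posrE ?invr_gt0.
pose W (x : 'rV[R]_n) (t : R) := ex t * V x (Num.max t 0).
have cWx t : continuous (W^~ t).
  apply: continuous_scale.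
  apply: (within_comp (h := fun x : 'rV[R]_n => (x, Num.max t 0)) hVc) => [|x]; last exact: max0.
  exact: continuous_pairl.
have cWt x : continuous (W x).
  apply: continuous_mulr => //.
  apply: (within_comp (h := fun t : R => (x, Num.max t 0)) hVc) => [|t]; last exact: max0.
  by apply: continuous_pairr; exact: continuous_maxr0.
have W0 x t : 0 <= W x t by rewrite mulr_ge0// ltW.
have Wm x t : W x t = W x (Num.max t 0) by rewrite /W max0K -exm.
have Wl x t : 1 <= enorm x -> thl * g t * enorm x `^ sigma <= W x t.
  move=> x1; rewrite -subr_ge0; move: t; apply: ge0_extend => [|t|t t0].
  - apply: continuous_subr => //; apply: continuous_mulr; last exact: continuous_cstr.
    exact: continuous_scale.
  - by rewrite Wm gm.
  - rewrite /W /g max_l ?(ltW t0)// subr_ge0.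
    have -> : thl * (ex t * Lambda t) * enorm x `^ sigma = ex t * (thl * Lambda t * enorm x `^ sigma) by ring.
    by apply: ler_wpM2l; [exact: ltW|exact: hVl].
have Wu x t : W x t <= thu * g t * mx x `^ sigma.
  rewrite -subr_ge0; move: t; apply: ge0_extend => [|t|t t0].
  - apply: continuous_subr => //; apply: continuous_mulr; last exact: continuous_cstr.
    exact: continuous_scale.
  - by rewrite [in LHS]Wm [in LHS]gm.
  - rewrite /W /g max_l ?(ltW t0)// subr_ge0.
    have -> : thu * (ex t * Lambda t) * mx x `^ sigma = ex t * (thu * Lambda t * mx x `^ sigma) by ring.
    apply: ler_wpM2l; first exact: ltW.
    apply: le_trans (hVu x t t0) _; apply: ler_wpM2l.
      by apply: mulr_ge0; [exact: ltW|apply: ltW; apply: hLpos; exact: ltW].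
    by apply: le_powR_base => //; [exact: enorm_ge0|rewrite /mx le_max lexx orbT].
have bu0 : bw w u0 by exact: inBC_bound.
have hcon : CB * (p * thu / ((1 - d) ^+ 2 * (1 - p) * thl)) / ((1 - d) / (1 - p)) < 1.
  have d1' : 0 < 1 - d by lra.
  have -> : CB * (p * thu / ((1 - d) ^+ 2 * (1 - p) * thl)) / ((1 - d) / (1 - p)) =
      CB * q0 / (1 - d) ^+ 3.
    by rewrite /q0; field; rewrite !gt_eqF.
  rewrite ltr_pdivrMr ?exprn_gt0// mul1r.
  apply: (@le_lt_trans _ _ ((1 + d) * q0)); first by apply: ler_wpM2r => //; exact: ltW.
  by rewrite dE !exprS expr0; nra.
have [m [gm' m0 fixm uniqm]] := fixpoint_exists_unique hB cw w1 wexp wavg hp0 hp1 hs hthl hthu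
  cg g0 gub glb cWx cWt W0 Wl Wu wb bu0 hu0 hu0nz d0 d1 hcon.
have bN m1 t := bw_Nl w1 hp0 hp1 hthu g0 gub cWx cWt W0 Wu wb (m := m1) t.
have gN m1 := gd_cvNl hB cw w1 wexp wavg hp0 hp1 hthu g0 gub cWx cWt W0 Wu wb (m := m1).
(* On nonnegative functions the integral equation and [Psi] agree: the two time integrals merge, the
   exponential factor moves into [W], and the truncated power is the true one. *)
have eqPsi m1 : gd w m1 -> (forall t x, 0 <= m1 t x) -> forall x t, 0 <= t ->
    mild B V p u0 m1 t x =
    Psi B p W u0 m1 t x.
  move=> g1 p1' x t t0; rewrite /mild.
  pose N tau y := W y tau * pw p (m1 tau y).
  have NE tau : N tau = (fun y => Nl p W m1 tau y - m1 tau y).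
    by apply/funext => y; rewrite /N /Nl addrAC subrr add0r.
  have bm tau := gd_bw tau g1.
  have bNN tau : bw w (N tau) by rewrite NE; apply: bwB => //; exact: bN.
  rewrite (@eq_int0 _ t _ (fun tau => cv B (m1 tau) x)); last first.
    by move=> tau _ _; exact: (conv_avg hB (bw_adm w1 wexp x (bm tau))).
  rewrite (@eq_int0 _ t (fun tau => expR _ * _) (fun tau => cv B (Nl p W m1 tau) x - cv B (m1 tau) x)); last first.
    move=> tau tau0 _; rewrite -(cvB hB w1 wexp)//; last exact: bN.
    rewrite -NE; set e := expR _; have e0 : 0 < e by exact: expR_gt0.
    have -> : (fun y => V y tau * m1 tau y `^ p) = (fun y => e^-1 * N tau y).
      apply/funext => y; rewrite /N /W /ex max_l// pwE// -/e.
      by rewrite !mulrA mulVf ?mul1r// gt_eqF.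
    rewrite (conv_avg hB (bw_adm w1 wexp x (bwZ e^-1 (bNN tau)))).
    rewrite -/(cv B (fun y => e^-1 * N tau y) x) (cvZ hB w1 wexp)//.
    by rewrite mulrA mulfV ?mul1r// gt_eqF.
  have c1 : continuous (fun tau => cv B (m1 tau) x).
    by have [_ h _] := gd_cv hB cw w1 wexp wavg g1; exact: h.
  have c2 : continuous (fun tau => cv B (Nl p W m1 tau) x).
    by have [_ h _] := gN _ g1; exact: h.
  by rewrite int0B// /Psi addrA addrAC addrK.
pose u x t := expR (- t) * m t x.
have muP t x : expR t * u x t = m t x by rewrite /u mulrA -expRD subrr expR0 mul1r.
have muE : (fun t x => expR t * u x t) = m.
  by apply/funext => t; apply/funext => x; exact: muP.
have izm : inZ a m.
  (* The integrand of [Psi] is bounded by a multiple of the weight on [[0, T]], so a fixed point is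
     Lipschitz in time for the weighted norm. *)
  apply: (gd_inZ a0 r1 gm') => T; have [_ _ /(_ T)[C hC]] := gN m gm'.
  have C0 : 0 <= C := bound_ge0 w1 (hC T (lexx _)).
  exists C => // s t x s0 st tT; rewrite -!fixm /Psi opprD addrACA subrr add0r mulrAC.
  apply: int0_lip => // [|tau tau0 taut]; first by have [_ h _] := gN m gm'; exact: h.
  by apply: hC; exact: le_trans tT.
exists u; split.
- by move=> x t t0; rewrite /u mulr_ge0 ?expR_ge0.
- apply: (inZ_mul a0 _ _ izm) => [|t t0].
    apply: continuous_compr (@continuous_expR R).
    by apply: continuous_oppr => s; exact: cvg_id.
  by rewrite ger0_norm ?expR_ge0// -expR0 ler_expR oppr_le0.
- rewrite /s_solution; split=> [|x t t0]; first by rewrite muE.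
  rewrite muP -(fixm t x) -(eqPsi m gm' m0 x t t0).
  exact: (@eq_mild R n B V p u0 m (fun t x => expR t * u x t) t x (fun tau y _ => esym (muP tau y))).
move=> v v0 [izv eqv] x t t0.
pose mu t x := expR t * v x t.
(* Frozen at negative times, [mu] takes there its value at time 0, which the equation identifies
   with [u0]; [Psi] also gives [u0] there, as [int0] vanishes. *)
pose m1 t := mu (Num.max t 0).
have g1 : gd w m1 by exact: inZ_gd izv.
have m10 s y : 0 <= m1 s y by rewrite mulr_ge0 ?expR_ge0//; exact: v0.
have fix1 s y : Psi B p W u0 m1 s y = m1 s y.
  have [s0|s0] := leP 0 s.
    rewrite -(eqPsi m1 g1 m10 y s s0); apply: etrans (_ : mu s y = _); last by rewrite /m1 max_l.
    apply: etrans (@eq_mild R n B V p u0 m1 mu s y _) (esym (eqv y s s0)).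
    by move=> tau z tau0; rewrite /m1 max_l.
  rewrite /Psi int0_le0 ?(ltW s0)// addr0 /m1 max_r ?(ltW s0)// /mu eqv//.
  by rewrite !int0_le0// !addr0.
have := uniqm m1 g1 m10 fix1 t x; rewrite /m1 max_l// /mu /u => <-.
by rewrite mulrA -expRD addNr expR0 mul1r.
Qed.

Theorem mainTheorem5 (R : realType) (n : nat) (hn : (1 <= n)%N)
  (B : 'rV[R]_n -> R) (hB : is_bessel_kernel B)
  (p sigma : R) (hp0 : 0 < p) (hp1 : p < 1) (hsigma : in_Jn n sigma)
  (Lambda : R -> R)
  (hLc : {within [set t : R | 0 <= t], continuous Lambda})
  (hLpos : forall t, 0 <= t -> 0 < Lambda t)
  (thl thu : R) (hthl : 0 < thl) (hthu : 0 < thu)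
  (V : 'rV[R]_n -> R -> R)
  (hVc : {within [set z : 'rV[R]_n * R | 0 <= z.2],
            continuous (fun z : 'rV[R]_n * R => V z.1 z.2)})
  (hV0 : forall x t, 0 <= V x t)
  (hVl : forall x t, 1 <= enorm x -> 0 < t -> thl * Lambda t * enorm x `^ sigma <= V x t)
  (hVu : forall x t, 0 < t -> V x t <= thu * Lambda t * enorm x `^ sigma)
  (a : R) (ha : sigma / (1 - p) <= a)
  (u0 : 'rV[R]_n -> R) (hu0 : forall x, 0 <= u0 x) (hu0BC : inBC a u0)
  (hu0nz : exists x, u0 x != 0)
  (eps0 : R) (heps0 : 0 < eps0)
  (heps0B : forall (x : 'rV[R]_n) (d : R), 0 <= d -> d <= sigma * p / (1 - p) ->
     ((eps0 * enorm x `^ (sigma + d))%:E <=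
      iint (fun y => (if 1 <= enorm (x - y)
                      then B y * enorm (x - y) `^ (sigma + d) else 0)%:E))%E) :
  (p < eps0 * thl / thu ->
     exists u, [/\ nonneg_sol u, inZ a (fun t x => u x t), s_solution B V p a u0 u
       & forall v, nonneg_sol v -> s_solution B V p a u0 v ->
                   forall x t, 0 <= t -> v x t = u x t])
  /\
  ((forall x t, V x t = Lambda t * enorm x `^ sigma) ->
     exists u, [/\ nonneg_sol u, inZ a (fun t x => u x t), s_solution B V p a u0 u
       & forall v, nonneg_sol v -> s_solution B V p a u0 v ->
                   forall x t, 0 <= t -> v x t = u x t]).
Proof.
have hs : 0 <= sigma.
  move: hsigma; rewrite /in_Jn; case: ifP => _ //; case=> [->//|]; exact: le_trans.
split=> [hp|VE].
- have e1 : eps0 <= 1.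
    apply: (moment_ratio_le1 hB hn hs) => x.
    have p0 : 0 <= sigma * p / (1 - p).
      by apply: divr_ge0; [apply: mulr_ge0 => //; exact: ltW|rewrite subr_ge0 ltW].
    by have := heps0B x 0 (lexx 0) p0; rewrite addr0.
  apply: (existence_uniqueness hB hp0 hp1 hs hLc hLpos hthl hthu) => //.
  move: hp; rewrite ltr_pdivlMr// => /lt_le_trans; apply.
  by rewrite ler_piMl// ltW.
- apply: (existence_uniqueness hB hp0 hp1 hs hLc hLpos ltr01 ltr01) => // [x t _ _|x t _|].
  + by rewrite VE mul1r.
  + by rewrite VE mul1r.
  + by rewrite mulr1.
Qed.
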